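(* Let $p$ be a prime, let $m \ge 1$, and suppose that the family $\{P_1, \dots, P_m\} \subseteq (\mathbb{F}_p[t])[y]$ is good for irrational equidistribution. Then there exist $\gamma > 0$ and a constant $K > 0$, both depending only on $P_1, \dots, P_m$, such that for any $q = p^k$ and any $f_1, \dots, f_m : \mathbb{F}_q \to \mathbb{D}$, $$\left\| \mathbb{E}_{y \in \mathbb{F}_q} \prod_{i=1}^m f_i(x + P_i(y)) - \prod_{i=1}^m \mathbb{E}_{z \in \mathbb{F}_q} f_i(z) \right\|_{L^2(\mathbb{F}_q)} \le K q^{-\gamma},$$ where the $L^2$-norm is taken with respect to the variable $x$.
   Context: Notation. $\mathbb{D} = \{z \in \mathbb{C} : |z| \le 1\}$. For a finite set $S$ and $f : S \to \mathbb{C}$, $\mathbb{E}_{x \in S} f(x) = \frac{1}{|S|}\sum_{x \in S} f(x)$ and $\|f\|_{L^2(S)} = \left( \mathbb{E}_{x \in S} |f(x)|^2 \right)^{1/2}$. Polynomials over $\mathbb{F}_q$. For $q = p^k$, the field $\mathbb{F}_q$ is identified with $\mathbb{F}_p[t]/Q(t)\mathbb{F}_p[t]$ for a monic irreducible $Q(t) \in \mathbb{F}_p[t]$ of degree $k$, and $P \in (\mathbb{F}_p[t])[y]$ acts as a function $\mathbb{F}_q \to \mathbb{F}_q$ by reducing its coefficients mod $Q$; the constants do not depend on the choice of $Q$. Good for irrational equidistribution. For nonzero $n \in \mathbb{F}_p[t]$ of degree $N$ put $|n| = p^N$, and extend to $\mathbb{F}_p(t)$ by $|m/n| = |m|/|n|$.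 The completion of $\mathbb{F}_p(t)$ is $\mathbb{F}_p((t^{-1})) = \left\{ \sum_{j=-\infty}^N c_j t^j : N \in \mathbb{Z}, c_j \in \mathbb{F}_p \right\}$. An element of $\mathbb{F}_p((t^{-1}))$ is rational if it lies in $\mathbb{F}_p(t)$ and irrational otherwise. A F{\o}lner sequence in $\mathbb{F}_p[t]$ is a sequence $(\Phi_N)_{N \in \mathbb{N}}$ of finite (nonempty) subsets of $\mathbb{F}_p[t]$ with $\lim_{N \to \infty} |(\Phi_N + n) \triangle \Phi_N| / |\Phi_N| = 0$ for every $n \in \mathbb{F}_p[t]$. A map $a : \mathbb{F}_p[t] \to \mathbb{F}_p((t^{-1}))$ is well-distributed mod $\mathbb{F}_p[t]$ if $$\lim_{N \to \infty} \frac{1}{|\Phi_N|} \sum_{n \in \Phi_N} f(a(n)) = \int_{\mathbb{F}_p((t^{-1}))/\mathbb{F}_p[t]} f \, dm$$ for every continuous $f : \mathbb{F}_p((t^{-1}))/\mathbb{F}_p[t] \to \mathbb{C}$ and every F{\o}lner sequence $(\Phi_N)$ in $\mathbb{F}_p[t]$, where $m$ is the Haar probability measure on the compact group $\mathbb{F}_p((t^{-1}))/\mathbb{F}_p[t]$ and $a(n)$ is reduced mod $\mathbb{F}_p[t]$. A family $a_1, \dots, a_m : \mathbb{F}_p[t] \to \mathbb{F}_p[t]$ is good for irrational equidistribution if for any $\alpha_1, \dots, \alpha_m \in \mathbb{F}_p((t^{-1}))$, not all rational, $\left( \sum_{i=1}^m a_i(n) \alpha_i \right)_{n \in \mathbb{F}_p[t]}$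 is well-distributed mod $\mathbb{F}_p[t]$. Polynomials $P_i \in (\mathbb{F}_p[t])[y]$ are regarded as sequences $n \mapsto P_i(n)$, $\mathbb{F}_p[t] \to \mathbb{F}_p[t]$. *)

(* Defs.v *)
From HB Require Import structures.
From mathcomp Require Import all_boot all_order all_algebra all_field.
From mathcomp Require Import complex finmap.
From mathcomp Require Import all_classical all_reals all_analysis.
Import numFieldNormedType.Exports.
Set Implicit Arguments.
Unset Strict Implicit.
Unset Printing Implicit Defensive.
Import Order.TTheory GRing.Theory Num.Theory.
Local Open Scope classical_set_scope.
Local Open Scope ring_scope.
Local Open Scope quotient_scope.

Section Laurent.
Context {F : fieldType}.

(* [c : int -> F] stands for the element \sum_j c_j t^j of F((t^{-1})), in which
   only finitely many positive exponents may occur. *)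
Definition laurent_pred : (int -> F) -> bool :=
  fun c => `[< exists N : int, forall j, N < j -> c j = 0 >].

Fact laurent_zmod_closed : zmod_closed laurent_pred.
Proof.
split=> [|u v /asboolP[M uM] /asboolP[N vN]]; apply/asboolP.
  by exists 0.
exists (Num.max M N) => j; rewrite gt_max => /andP[Mj Nj].
by rewrite !fctE uM// vN// subr0.
Qed.
HB.instance Definition _ :=
  GRing.isZmodClosed.Build (int -> F) laurent_pred laurent_zmod_closed.

Record laurent := Laurent {
  lcoef :> int -> F;
  _ : lcoef \in laurent_pred }.
HB.instance Definition _ := [isSub for lcoef].
HB.instance Definition _ := [Choice of laurent by <:].
HB.instance Definition _ := [SubChoice_isSubZmodule of laurent by <:].

Lemma laurentP (u v : laurent) : (forall j, u j = v j) -> u = v.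
Proof. by move=> uv; apply/val_inj/funext. Qed.

Lemma lcoefD (u v : laurent) j : (u + v) j = u j + v j. Proof. by []. Qed.
Lemma lcoefB (u v : laurent) j : (u - v) j = u j - v j. Proof. by []. Qed.

(* The Cauchy product of a polynomial and a Laurent series in t^{-1}. *)
Definition pscale_fun (n : {poly F}) (c : int -> F) : int -> F :=
  fun j => \sum_(i < size n) n`_i * c (j - i%:Z).

Fact pscale_subproof (n : {poly F}) (u : laurent) :
  pscale_fun n u \in laurent_pred.
Proof.
case: u => c /= /asboolP[N cN]; apply/asboolP.
exists (N + (size n)%:Z) => j Nj; rewrite /pscale_fun big1// => i _.
rewrite cN ?mulr0// ltrBrDr (le_lt_trans _ Nj)// lerD2l lez_nat.
exact: ltnW.
Qed.
Definition pscale n u : laurent := Laurent (pscale_subproof n u).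

Lemma pscaleE M (n : {poly F}) (u : laurent) j : (size n <= M)%N ->
  pscale n u j = \sum_(i < M) n`_i * u (j - i%:Z).
Proof.
move=> nM; rewrite /pscale /= /pscale_fun (big_ord_widen _ (fun i => n`_i * u (j - i%:Z)) nM).
rewrite big_mkcond; apply: eq_bigr => i _; case: ltnP => // ni.
by rewrite nth_default ?mul0r.
Qed.

Fact pscaleDl u : {morph pscale^~ u : m n / m + n}.
Proof.
move=> m n; apply: laurentP => j; rewrite lcoefD.
rewrite (pscaleE _ _ (size_polyD m n)).
rewrite (pscaleE _ _ (leq_maxl (size m) (size n))).
rewrite (pscaleE _ _ (leq_maxr (size m) (size n))) -big_split.
by apply: eq_bigr => i _; rewrite coefD mulrDl.
Qed.

Fact pscaleDr n : {morph pscale n : u v / u + v}.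
Proof.
move=> u v; apply: laurentP => j; rewrite lcoefD /= /pscale_fun -big_split.
by apply: eq_bigr => i _; exact: mulrDr.
Qed.

Fact pscaleZ c n u j : pscale (c *: n) u j = c * pscale n u j.
Proof.
rewrite (pscaleE _ _ (size_scale_leq c n)) (pscaleE _ _ (leqnn _)) mulr_sumr.
by apply: eq_bigr => i _; rewrite coefZ mulrA.
Qed.

Fact pscaleMX n u j : pscale (n * 'X) u j = pscale n u (j - 1).
Proof.
have sn : (size (n * 'X)%R <= (size n).+1)%N.
  by rewrite (leq_trans (size_polyMleq _ _))// size_polyX addn2.
rewrite (pscaleE _ _ sn) (pscaleE _ _ (leqnn _)) big_ord_recl coefMX mul0r add0r.
apply: eq_bigr => i _; rewrite coefMX /=; congr (_ * u _).
by rewrite /bump leq0n add1n -addn1 PoszD opprD addrCA addrC.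
Qed.

Fact pscaleA m n u : pscale m (pscale n u) = pscale (m * n) u.
Proof.
elim/poly_ind: m => [|m c IHm].
  by apply: laurentP => j; rewrite mul0r /= /pscale_fun size_poly0 !big_ord0.
rewrite mulrDl !pscaleDl mulrAC mul_polyC; apply: laurentP => j.
rewrite !lcoefD !pscaleMX pscaleZ IHm; congr (_ + _).
by rewrite (pscaleE _ _ (size_polyC_leq1 c)) big_ord1 coefC subr0.
Qed.

Fact pscale1 : left_id 1 pscale.
Proof.
move=> u; apply: laurentP => j.
by rewrite /= /pscale_fun size_poly1 big_ord1 coef1 mul1r subr0.
Qed.

HB.instance Definition _ := GRing.Zmodule_isLmodule.Build {poly F} laurent
  pscaleA pscale1 pscaleDr (fun u m n => pscaleDl u m n).

Definition poly_coefz (n : {poly F}) : int -> F :=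
  fun j => if j is Posz i then n`_i else 0.

Fact laurent_of_poly_subproof n : poly_coefz n \in laurent_pred.
Proof.
apply/asboolP; exists (size n)%:Z => -[j|//] nj /=.
by rewrite nth_default// ltnW.
Qed.
Definition laurent_of_poly n : laurent := Laurent (laurent_of_poly_subproof n).

(* [u] lies in the subfield F(t) of F((t^{-1})): u = m / n. *)
Definition rational (u : laurent) :=
  exists m n : {poly F}, n != 0 /\ n *: u = laurent_of_poly m.

(* The topology of |.|, where |u| = #|F|^N for u of degree N: in terms of
   coefficients, |v - u| < #|F|^N says that u and v agree in degrees >= N. *)

Definition lball (u : laurent) (N : int) : set laurent :=
  [set v | forall j, N <= j -> v j = u j].

Definition laurent_nbhs (u : laurent) : set_system laurent :=
  [set A | exists N, lball u N `<=` A].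

HB.instance Definition _ := hasNbhs.Build laurent laurent_nbhs.

Fact laurent_nbhs_filter (u : laurent) : ProperFilter (nbhs u).
Proof.
apply: Build_ProperFilter_ex => [A [N uA]|]; first by exists u; apply: uA.
split.
- by exists 0.
- move=> A B [M uA] [N uB]; exists (Num.min M N) => v uv; split.
    by apply: uA => j Mj; apply: uv; rewrite ge_min Mj.
  by apply: uB => j Nj; apply: uv; rewrite ge_min Nj orbT.
- by move=> A B AB [N uA]; exists N; apply: subset_trans AB.
Qed.

Fact laurent_nbhs_singleton (u : laurent) A : nbhs u A -> A u.
Proof. by move=> [N uA]; apply: uA. Qed.

Fact laurent_nbhs_nbhs (u : laurent) A : nbhs u A -> nbhs u (nbhs^~ A).
Proof.
move=> [N uA]; exists N => v uv; exists N => w vw; apply: uA => j Nj.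
by rewrite vw// uv.
Qed.

HB.instance Definition _ := Nbhs_isNbhsTopological.Build laurent
  laurent_nbhs_filter laurent_nbhs_singleton laurent_nbhs_nbhs.
HB.instance Definition _ := isPointed.Build laurent 0.

Definition polynomial_pred : laurent -> bool :=
  fun u => `[< exists n, u = laurent_of_poly n >].

Fact polynomial_zmod_closed : zmod_closed polynomial_pred.
Proof.
split=> [|u v /asboolP[m ->] /asboolP[n ->]]; apply/asboolP.
  by exists 0; apply: laurentP => -[j|j] //=; rewrite coef0.
exists (m - n); apply: laurentP => j; rewrite lcoefB.
by case: j => j /=; rewrite ?subr0// coefB.
Qed.
HB.instance Definition _ :=
  GRing.isZmodClosed.Build laurent polynomial_pred polynomial_zmod_closed.

(* F((t^{-1})) / F[t]. [quotient_topology] forgets the group structure of the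
   quotient and has its own choice structure, so the group structure is rebuilt
   on [torus] from the group laws of [torus_zmod]. *)
Definition torus_zmod :=
  Quotient.quot (GRing.ZmodClosed.clone laurent polynomial_pred _).
Definition torus := quotient_topology torus_zmod.
HB.instance Definition _ := PointedTopological.on torus.
HB.instance Definition _ := GRing.isZmodule.Build torus
  (@addrA torus_zmod) (@addrC torus_zmod) (@add0r torus_zmod)
  (@addNr torus_zmod).

Definition modpoly (u : laurent) : torus := \pi_torus u.

Definition borel_torus := g_sigma_algebraType (@open torus).

End Laurent.
Arguments laurent F : clear implicits.
Arguments torus F : clear implicits.
Arguments borel_torus F : clear implicits.

Section Equidistribution.
Context {R : realType} {F : fieldType}.

Definition is_haar (mu : probability (borel_torus F) R) :=
  forall (a : torus F) (A : set (borel_torus F)), measurable A ->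
    mu [set a + x | x in (A : set (torus F))] = mu A.

Definition cintegral (mu : probability (borel_torus F) R) (f : torus F -> R[i])
    : R[i] :=
  Complex (\int[mu]_(x in setT) complex.Re (f x))
          (\int[mu]_(x in setT) complex.Im (f x)).

Definition folner (Phi : nat -> {fset {poly F}}) :=
  (forall N, Phi N != fset0) /\
  forall n : {poly F},
    (fun N => let S := [fset (k + n)%R | k in Phi N]%fset in
      #|` ((S `\` Phi N) `|` (Phi N `\` S))%fset|%:R / #|` Phi N|%:R : R)
    @ \oo --> (0 : R).

(* The Haar probability measure exists and is unique when F is finite, so [mu]
   is that measure. [R[i]^o] is [R[i]] with the topology of its norm. *)
Definition well_distributed (a : {poly F} -> laurent F) :=
  exists2 mu : probability (borel_torus F) R, is_haar mu &
  forall f : torus F -> R[i]^o, continuous f ->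
  forall Phi : nat -> {fset {poly F}}, folner Phi ->
    (fun N => #|` Phi N|%:R^-1 * \sum_(n <- Phi N) f (modpoly (a n)) : R[i]^o)
    @ \oo --> (cintegral mu f : R[i]^o).

Definition good_for_irrational_equidistribution (m : nat)
    (a : 'I_m -> {poly F} -> {poly F}) :=
  forall alpha : 'I_m -> laurent F, ~ (forall i, rational (alpha i)) ->
    well_distributed (fun n => \sum_i a i n *: alpha i).

End Equidistribution.
Arguments good_for_irrational_equidistribution R {F m} a.

Definition avg (K : fieldType) (T : finType) (f : T -> K) : K :=
  #|T|%:R^-1 * \sum_(x : T) f x.

Definition L2norm (R : realType) (T : finType) (f : T -> R[i]) : R :=
  Num.sqrt (avg (fun x => ComplexField.Normc.normc (f x) ^+ 2)).

(* P acting on F[t]/(Q) by reducing its coefficients mod Q. *)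
Definition poly_mod (F : fieldType) (Q : {poly F})
    (hQ : monic_irreducible_poly Q) (P : {poly {poly F}})
    (y : {poly %/ Q with hQ}) : {poly %/ Q with hQ} :=
  (map_poly (in_qpoly Q : {poly F} -> {poly %/ Q with hQ}) P).[y].

(* Main.v *)
Require Import Defs.
From HB Require Import structures.
From mathcomp Require Import all_boot all_order all_algebra all_field.
From mathcomp Require Import complex finmap.
From mathcomp Require Import all_classical all_reals all_analysis.
From mathcomp Require Import ring lra zify.
Import numFieldNormedType.Exports.
Set Implicit Arguments.
Unset Strict Implicit.
Unset Printing Implicit Defensive.
Import Order.TTheory GRing.Theory Num.Theory.
Local Open Scope ring_scope.
Import ComplexField.Normc.

(** The proof has an arithmetic half, over F_p[t], and an analytic half, over a
    finite field L = F_p[t] / (Q).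

    Arithmetic half.  Write res for the coefficient of t^-1.  A tuple alpha of
    Laurent series defines the functional v |-> res (\sum_i v_i alpha_i) on
    F_p[t]^m.  If this functional vanishes on every P(n) - P(0), then
    res (\sum_i P_i(n) alpha_i) does not depend on n, so that the sequence stays
    in one level set of res; this level set would have full Haar measure, as
    would its translate by t^-1 ([not_well_distributed]).  For a good family the
    functional is therefore given by a rational tuple, that is, it is killed by
    some nonzero N.  The functionals vanishing on all P(n) - P(0) form a compact
    group, and a gliding hump ([uniform_torsion]) shows that one N kills them
    all.  Reducing modulo a Q of degree larger than that of N, for which N is
    invertible, one gets [independent_mod]: for every nonzero a in L^m the phase
    psi (\sum_i a_i P_i(y)) is not constant in y.  The other Q have bounded
    degree and only influence the constant K.

    Analytic half.  Polynomials over L of bounded degree satisfy Weyl's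
    inequality in the form [weyl_dichotomy]: an exponential sum is small unless
    its phase is constant.  In characteristic p this uses that
    psi (c y^(s p^a)) only depends on the twist c^(1/p^a) and on y^s; once the
    terms with the same s prime to p are collected, a phase is constant exactly
    when all the collected coefficients vanish, and for a difference
    P(y+h) - P(y) these coefficients are polynomials in h.  Hence the statement
    holds when all f_i are characters ([joint0]).  It is extended to arbitrary
    f_i one index at a time ([jointS]).  By PET induction the average is
    controlled by a Gowers norm of f_l ([gowers_control]), hence, after
    replacing f_l by the centred dual function, by a Gowers norm of that dual
    function.  Degree lowering ([degree_lowering]) reduces the order of this norm
    step by step: the phases that appear in the inverse theorem for the norm of
    order two are tested against averages in which f_l has become a character,
    to which the induction hypothesis applies.  At order one the norm of a
    centred function is zero.

    All estimates are quantified by a number e with 0 < e <= 1/2, and a quantity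
    bounded below by e is shown to be small unless #|L| * e ^ a <= 1 for an
    exponent a that does not depend on L.  As e <= 1/2, numerical constants are
    absorbed into the exponents, and compositions of estimates only multiply or
    add exponents. *)

(** * Averages over finite sets *)

Notation "'EE' x .. y , e" := (avg (fun x => .. (avg (fun y => e)) ..))
  (at level 200, x binder, y binder, right associativity).

Section Average.
Context {K : numFieldType}.
Implicit Types (S T : finType).

Lemma card_neq0 T (x0 : T) : #|T|%:R != 0 :> K.
Proof. by rewrite pnatr_eq0 -lt0n; apply/card_gt0P; exists x0. Qed.

Lemma eq_avg T (f g : T -> K) : f =1 g -> avg f = avg g.
Proof. by move=> fg; rewrite /avg; congr (_ * _); apply: eq_bigr. Qed.

Lemma avg_empty T (f : T -> K) : (fun _ : T => true) =1 xpred0 -> avg f = 0.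
Proof. by move=> T0; rewrite /avg big1 ?mulr0// => x; have := T0 x. Qed.

Lemma avg_cst T (x0 : T) (c : K) : avg (fun _ : T => c) = c.
Proof.
by rewrite /avg sumr_const -(mulr_natl c) mulrA mulVf ?mul1r// (card_neq0 x0).
Qed.

Lemma avgD T (f g : T -> K) : (EE x, (f x + g x)) = avg f + avg g.
Proof. by rewrite /avg big_split mulrDr. Qed.

Lemma avgZ T (c : K) (f : T -> K) : (EE x, (c * f x)) = c * avg f.
Proof. by rewrite /avg -mulr_sumr mulrCA. Qed.

Lemma avgZr T (c : K) (f : T -> K) : (EE x, (f x * c)) = avg f * c.
Proof. by rewrite mulrC -avgZ; apply: eq_avg => x; rewrite mulrC. Qed.

Lemma avgN T (f : T -> K) : (EE x, (- f x)) = - avg f.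
Proof. by rewrite /avg sumrN mulrN. Qed.

Lemma avgB T (f g : T -> K) : (EE x, (f x - g x)) = avg f - avg g.
Proof. by rewrite avgD avgN. Qed.

Lemma avg_exch S T (f : S -> T -> K) : (EE x, EE y, f x y) = EE y, EE x, f x y.
Proof.
rewrite /avg -!mulr_sumr mulrCA; congr (_ * _); congr (_ * _).
exact: exchange_big.
Qed.

Lemma avg_pair S T (f : S * T -> K) : avg f = EE x, EE y, f (x, y).
Proof.
rewrite /avg card_prod natrM invfM -mulr_sumr mulrA; congr (_ * _).
by rewrite pair_bigA; apply: eq_bigr => -[].
Qed.

Lemma avg_bij S T (h : S -> T) (f : T -> K) : bijective h ->
  avg f = EE x, f (h x).
Proof.
move=> hb; rewrite /avg (bij_eq_card hb); congr (_ * _).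
exact: (reindex h (onW_bij _ hb)).
Qed.

Lemma avg_shift (G : finZmodType) (a : G) (f : G -> K) : avg f = EE x, f (x + a).
Proof. by apply: avg_bij; exists (fun x => x - a) => x; rewrite ?addrK ?subrK. Qed.

Lemma avg_cons T n (f : seq T -> K) :
  avg (fun h : n.+1.-tuple T => f h) = EE a, avg (fun h : n.-tuple T => f (a :: h)).
Proof.
rewrite (@avg_bij (T * n.-tuple T)%type _ (fun x => cons_tuple x.1 x.2)); last first.
  exists (fun t => (thead t, [tuple of behead t])) => [[a t]|t] /=.
    by congr (_, _); apply/val_inj.
  by apply/val_inj; case: t => -[].
by rewrite avg_pair.
Qed.

Lemma avg_nil T (f : seq T -> K) : avg (fun h : 0.-tuple T => f h) = f [::].
Proof.
rewrite (@eq_avg _ _ (fun=> f [::])) => [|t]; last by rewrite (tuple0 t).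
exact: (avg_cst [tuple]).
Qed.
End Average.
Arguments avg_cons {K T n} f.

Section RealAverage.
Context {R : realFieldType}.
Implicit Types (T : finType).

Lemma avg_ge0 T (f : T -> R) : (forall x, 0 <= f x) -> 0 <= avg f.
Proof. by move=> f0; rewrite mulr_ge0 ?invr_ge0// sumr_ge0. Qed.

Lemma ler_avg T (f g : T -> R) : (forall x, f x <= g x) -> avg f <= avg g.
Proof. by move=> fg; rewrite ler_wpM2l ?invr_ge0// ler_sum. Qed.

Lemma avg_le_cst T (x0 : T) (f : T -> R) c : (forall x, f x <= c) -> avg f <= c.
Proof. by move=> fc; rewrite -[leRHS](avg_cst x0) ler_avg. Qed.

Lemma sqr_avg T (f : T -> R) : (avg f) ^+ 2 <= EE x, (f x ^+ 2).
Proof.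
have [x0 _|T0] := pickP (fun _ : T => true); last first.
  by rewrite !avg_empty// expr0n.
set m := avg f.
have : 0 <= EE x, ((f x - m) ^+ 2) by apply: avg_ge0 => x; exact: sqr_ge0.
rewrite (eq_avg (g := fun x => f x ^+ 2 + ((- (2 * m)) * f x + m ^+ 2))).
  by rewrite avgD avgD avgZ (avg_cst x0) -/m !expr2; lra.
by move=> x; ring.
Qed.

(** The points where [f] is below [d / 2] contribute at most [d / 2] to the mean. *)
Lemma popular T (f : T -> R) (d : R) : (forall x, f x <= 1) -> 0 <= d ->
  d <= avg f -> d / 2 * #|T|%:R <= #|[set x | d / 2 <= f x]|%:R.
Proof.
move=> f1 d0 df; have [x0 _|T0] := pickP (fun _ : T => true); last first.
  by rewrite (eq_card0 T0) mulr0.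
have T0 : 0 < #|T|%:R :> R by rewrite lt0r (card_neq0 x0) ler0n.
have : avg f <= EE x, ((x \in [set x | d / 2 <= f x])%:R + d / 2).
  apply: ler_avg => x; rewrite inE; case: (leP (d / 2) (f x)) => fx.
    by rewrite (_ : true%:R = 1 :> R)//; move: (f1 x) d0; lra.
  by rewrite add0r ltW.
rewrite avgD (avg_cst x0) /avg => H.
rewrite -(ler_pM2l (x := #|T|%:R^-1)) ?invr_gt0// [leLHS]mulrCA mulVf ?lt0r_neq0// mulr1.
suff -> : #|[set x | d / 2 <= f x]|%:R = \sum_x ((x \in [set x | d / 2 <= f x])%:R : R).
  by move: (le_trans df H); lra.
rewrite -sum1_card natr_sum big_mkcond; apply: eq_bigr => x _.
by case: (x \in _).
Qed.
End RealAverage.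

Section ComplexAverage.
Context {R : realType}.
Local Notation C := R[i].
Implicit Types (S T : finType).

Lemma normcE1 (z : C) : `|z| = (normc z)%:C%C.
Proof. by case: z => a b; rewrite normc_def. Qed.

Lemma normc_le1 (z : C) : `|z| <= 1 -> normc z <= 1.
Proof. by rewrite normcE1 -[1]/(1%:C%C) lecR. Qed.

Lemma normc_ge0 (z : C) : 0 <= normc z.
Proof. by case: z => a b; exact: sqrtr_ge0. Qed.

Lemma normcJ (z : C) : normc (z^*)%C = normc z.
Proof. by case: z => a b /=; rewrite sqrrN. Qed.

Lemma sqr_normcE (z : C) : ((normc z ^+ 2)%:C)%C = z * (z^*)%C.
Proof. by rewrite -sqr_normc normcE1 rmorphXn. Qed.

Lemma normc_real (r : R) : normc (r%:C)%C = `|r|.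
Proof. by rewrite /= expr0n addr0 sqrtr_sqr. Qed.

Lemma normcX (z : C) n : normc (z ^+ n) = normc z ^+ n.
Proof. by elim: n => [|n IH]; rewrite ?normc1// !exprS normcM IH. Qed.

Lemma normcM_le1 (z w : C) : normc z <= 1 -> normc w <= 1 -> normc (z * w) <= 1.
Proof. by move=> z1 w1; rewrite normcM mulr_ile1 ?normc_ge0. Qed.

Lemma normc_prod_le1 I (r : seq I) (P : pred I) (f : I -> C) :
  (forall i, normc (f i) <= 1) -> normc (\prod_(i <- r | P i) f i) <= 1.
Proof.
move=> f1; elim/big_rec: _ => [|i z _ z1]; first by rewrite normc1.
exact: normcM_le1.
Qed.

Lemma normc_sum T (f : T -> C) (P : pred T) :
  normc (\sum_(x | P x) f x) <= \sum_(x | P x) normc (f x).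
Proof.
elim/big_rec2: _ => [|x u v _ uv]; first by rewrite normc0.
by rewrite (le_trans (le_normcD _ _))// lerD2l.
Qed.

Lemma avgC T (f : T -> R) : ((avg f)%:C)%C = EE x, ((f x)%:C)%C.
Proof. by rewrite /avg rmorphM fmorphV rmorph_nat rmorph_sum. Qed.

Lemma avgJ T (f : T -> C) : ((avg f)^*)%C = EE x, ((f x)^*)%C.
Proof. by rewrite /avg rmorphM fmorphV rmorph_nat rmorph_sum. Qed.

Lemma normc_avg T (f : T -> C) : normc (avg f) <= EE x, normc (f x).
Proof.
rewrite /avg normcM normcV.
have -> : normc (#|T|%:R : C) = #|T|%:R.
  by rewrite -(rmorph_nat (real_complex R)) normc_real ger0_norm.
by rewrite ler_wpM2l ?invr_ge0// normc_sum.
Qed.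

Lemma normc_avg_le1 T (f : T -> C) : (forall x, normc (f x) <= 1) ->
  normc (avg f) <= 1.
Proof.
move=> f1; have [x0 _|T0] := pickP (fun _ : T => true).
  by rewrite (le_trans (normc_avg _))// (avg_le_cst x0).
by rewrite avg_empty// normc0.
Qed.

Lemma normc_avg_sqr T (f : T -> C) :
  ((normc (avg f) ^+ 2)%:C)%C = EE x, EE y, (f x * ((f y)^*)%C).
Proof.
rewrite sqr_normcE avgJ -avgZr; apply: eq_avg => x; by rewrite avgZ.
Qed.

(** A bounded factor [b] can be discarded because it enters the mean only through
    its modulus. *)
Lemma cauchy_schwarz T (b g : T -> C) : (forall x, normc (b x) <= 1) ->
  normc (EE x, (b x * g x)) ^+ 2 <= EE x, (normc (g x) ^+ 2).
Proof.
move=> b1; apply: le_trans (sqr_avg _).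
have H : normc (EE x, (b x * g x)) <= EE x, normc (g x).
  apply: le_trans (normc_avg _) _; apply: ler_avg => x.
  by rewrite normcM ler_piMl ?normc_ge0.
by rewrite lerXn2r ?nnegrE ?normc_ge0 ?(le_trans (normc_ge0 _) H).
Qed.
End ComplexAverage.

(** * The box Cauchy--Schwarz inequality and Gowers norms *)

Section BoxCauchySchwarz.
Context {R : realType} {T : finType}.
Local Notation C := R[i].

(** The alternately conjugated product of [g] over the vertices of the box with
    sides [u_i, v_i]; [u] is its base vertex. *)
Fixpoint cube k (g : seq T -> C) (u v : seq T) : C :=
  match k, u, v with
  | k'.+1, a :: u', b :: v' =>
      cube k' (fun h => g (a :: h) * ((g (b :: h))^*)%C) u' v'
  | _, _, _ => g [::]
  end.

Lemma cubeM k g g' (u v : seq T) :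
  cube k (fun h => g h * g' h) u v = cube k g u v * cube k g' u v.
Proof.
elim: k g g' u v => [|k IH] g g' [|a u] [|b v] //=.
rewrite -IH; congr (cube _ _ _ _); apply/funext => h.
by rewrite rmorphM mulrACA.
Qed.

Lemma normc_cube k g (u v : k.-tuple T) :
  (forall h, normc (g h) <= 1) -> normc (cube k g u v) <= 1.
Proof.
elim: k g u v => [|k IH] g [[|a u] su] [[|b v] sv] g1 //=.
have uk : size u == k by []. have vk : size v == k by [].
by apply: (IH _ (Tuple uk) (Tuple vk)) => h; rewrite normcM_le1 ?normcJ.
Qed.

(** The value at the base vertex is one of the factors. *)
Lemma cube_neq0 k g (u v : k.-tuple T) : cube k g u v != 0 -> g u != 0.
Proof.
elim: k g u v => [|k IH] g [[|a u] su] [[|b v] sv] //=.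
have uk : size u == k by []. have vk : size v == k by [].
by move=> /(IH _ (Tuple uk) (Tuple vk)) /=; rewrite mulf_eq0 negb_or => /andP[].
Qed.

(** [B] does not depend on the [i]-th entry of its argument. *)
Definition indep (A : Type) (t0 : T) (i : nat) (B : seq T -> A) :=
  forall h h', size h = size h' ->
    (forall j, j != i -> nth t0 h j = nth t0 h' j) -> B h = B h'.

Lemma indep_cons A t0 i (B : seq T -> A) a :
  indep t0 i.+1 B -> indep t0 i (fun h => B (a :: h)).
Proof. by move=> Bi h h' hh' e; apply: Bi => [|[|j]] //=; rewrite ?hh' // => /e. Qed.

(** One application of Cauchy--Schwarz in each of the [k] variables: the one in
    which the [i]-th variable is doubled removes [B i], which does not see that
    variable. *)
Lemma box_cauchy_schwarz (t0 : T) k (X : finType) (g : X -> seq T -> C)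
    (B : nat -> X -> seq T -> C) :
  (forall i x h, normc (B i x h) <= 1) ->
  (forall i x, indep t0 i (B i x)) ->
  normc (EE x : X, EE h : k.-tuple T, (g x h * \prod_(i < k) B i x h)) ^+ (2 ^ k)
  <= normc (EE x : X, EE u : k.-tuple T, EE v : k.-tuple T, cube k (g x) u v).
Proof.
elim: k X g B => [|k IH] X g B B1 Bi.
  rewrite expr1 le_eqVlt; apply/orP; left; apply/eqP; congr normc.
  apply: eq_avg => x.
  rewrite (avg_nil (fun h => g x h * \prod_(i < 0) B i x h)) big_ord0 mulr1.
  rewrite (avg_nil (fun u => EE v : 0.-tuple T, cube 0 (g x) u v)).
  by rewrite (avg_nil (fun v => cube 0 (g x) [::] v)).
pose B' i (z : X * T * T) h :=
  B i.+1 z.1.1 (z.1.2 :: h) * ((B i.+1 z.1.1 (z.2 :: h))^*)%C.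
pose g' (z : X * T * T) h := g z.1.1 (z.1.2 :: h) * ((g z.1.1 (z.2 :: h))^*)%C.
have B'1 i z h : normc (B' i z h) <= 1 by rewrite normcM_le1 ?normcJ.
have B'i i z : indep t0 i (B' i z).
  move=> h h' hh' e; rewrite /B'.
  have E a : B i.+1 z.1.1 (a :: h) = B i.+1 z.1.1 (a :: h').
    exact: (indep_cons a (Bi i.+1 z.1.1) hh' e).
  by rewrite !E.
have {IH B'1 B'i} := IH _ g' B' B'1 B'i.
set M := normc (EE x, EE h, _); set M' := normc (EE x, EE u, EE v, _) => IH.
have -> : normc (EE x : X, EE u : k.+1.-tuple T, EE v : k.+1.-tuple T,
    cube k.+1 (g x) u v) = M'.
  congr normc; rewrite avg_pair avg_pair; apply: eq_avg => x.
  rewrite (avg_cons (fun u => EE v : k.+1.-tuple T, cube k.+1 (g x) u v)).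
  apply: eq_avg => a; rewrite [RHS]avg_exch; apply: eq_avg => u.
  by rewrite (avg_cons (fun v => cube k.+1 (g x) (a :: u) v)).
rewrite expnS exprM; apply: le_trans _ IH.
rewrite lerXn2r ?nnegrE ?exprn_ge0 ?normc_ge0//.
pose G x a h := g x (a :: h) * \prod_(i < k) B i.+1 x (a :: h).
pose b (z : X * k.-tuple T) := B 0 z.1 (t0 :: z.2).
have -> : (EE x : X, EE h : k.+1.-tuple T, (g x h * \prod_(i < k.+1) B i x h)) =
    EE z : X * k.-tuple T, (b z * EE a : T, G z.1 a z.2).
  rewrite avg_pair; apply: eq_avg => x.
  rewrite (avg_cons (fun h => g x h * \prod_(i < k.+1) B i x h)) avg_exch.
  apply: eq_avg => h; rewrite -avgZ; apply: eq_avg => a.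
  rewrite big_ord_recl mulrCA; congr (_ * _).
  by apply: Bi => [|[|j]].
apply: le_trans (cauchy_schwarz _ _) _ => [z|]; first exact: B1.
rewrite (_ : (EE z, _) = M)// /M -[LHS]ger0_norm; last first.
  by apply: avg_ge0 => z; rewrite sqr_ge0.
rewrite -normc_real avgC !avg_pair; congr normc; apply: eq_avg => x.
under eq_avg => h do rewrite normc_avg_sqr.
rewrite [LHS]avg_exch; apply: eq_avg => a /=; rewrite [LHS]avg_exch; apply: eq_avg => c.
apply: eq_avg => h; rewrite /G /g' /B' /= big_split /= rmorphM rmorph_prod.
by rewrite mulrACA.
Qed.
End BoxCauchySchwarz.

Section Gowers.
Context {R : realType} {G : finZmodType}.
Local Notation C := R[i].
Implicit Types (f : G -> C).

Definition dif f (a : G) : G -> C := fun x => f x * ((f (x + a))^*)%C.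

Fixpoint difs (l : seq G) f : G -> C :=
  if l is a :: l' then difs l' (dif f a) else f.

Lemma difC f a b : dif (dif f a) b = dif (dif f b) a.
Proof.
apply/funext => x; rewrite /dif !rmorphM /= !conjcK.
by rewrite (addrAC x b a) mulrACA.
Qed.

Lemma difs_dif l f a : difs l (dif f a) = dif (difs l f) a.
Proof. by elim: l f => //= b l IH f; rewrite difC IH. Qed.

Lemma dif_le1 f a : (forall x, normc (f x) <= 1) -> forall x, normc (dif f a x) <= 1.
Proof. by move=> f1 x; rewrite normcM_le1 ?normcJ. Qed.

Lemma difs_le1 l f : (forall x, normc (f x) <= 1) -> forall x, normc (difs l f x) <= 1.
Proof. by elim: l f => //= a l IH f f1; apply/IH/dif_le1. Qed.

Lemma difs_prod I (r : seq I) (P : pred I) (f : I -> G -> C) l (s : I -> G) x :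
  difs l (fun x => \prod_(i <- r | P i) f i (x + s i)) x =
  \prod_(i <- r | P i) difs l (f i) (x + s i).
Proof.
elim: l f x => //= a l IH f x; rewrite -IH; congr (difs _ _ _).
apply/funext => z; rewrite /dif rmorph_prod -big_split; apply: eq_bigr => i _ /=.
by rewrite addrAC.
Qed.

Fixpoint lsum (L : nat -> G -> G) (h : seq G) : G :=
  if h is a :: h' then L 0 a + lsum (fun i => L i.+1) h' else 0.

Fixpoint lmap (L : nat -> G -> G) (h : seq G) : seq G :=
  if h is a :: h' then L 0 a :: lmap (fun i => L i.+1) h' else [::].

Fixpoint ldif (L : nat -> G -> G) (u v : seq G) : seq G :=
  match u, v with
  | a :: u', b :: v' => L 0 b - L 0 a :: ldif (fun i => L i.+1) u' v'
  | _, _ => [::]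
  end.

Lemma size_ldif L k (u v : k.-tuple G) : size (ldif L u v) = k.
Proof.
elim: k L u v => [|k IH] L [[|a u] su] [[|b v] sv] //=.
have uk : size u == k by []. have vk : size v == k by [].
by rewrite (IH _ (Tuple uk) (Tuple vk)).
Qed.

(** A box along which [f] is translated linearly yields an iterated difference,
    whose steps are the sides of the box. *)
Lemma cube_difs k f L x (u v : k.-tuple G) :
  cube k (fun h => f (x + lsum L h)) u v = difs (ldif L u v) f (x + lsum L u).
Proof.
elim: k f L x u v => [|k IH] f L x [[|a u] su] [[|b v] sv] //=.
have uk : size u == k by []. have vk : size v == k by [].
rewrite addrA -(IH _ _ _ (Tuple uk) (Tuple vk)) /=; congr (cube _ _ _ _).
apply/funext => h; rewrite /dif addrA; congr (_ * (f _)^*%C).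
by rewrite [RHS]addrAC -(addrA x) (addrC (L 0 a)) subrK addrA.
Qed.

(** For additive [L] the sides of a uniformly random box are the images of
    independent uniform elements. *)
Lemma avg_ldif (K : numFieldType) k L (phi : seq G -> K) :
  (forall i a b, L i (a - b) = L i a - L i b) ->
  (EE u : k.-tuple G, EE v : k.-tuple G, phi (ldif L u v)) =
  EE h : k.-tuple G, phi (lmap L h).
Proof.
elim: k L phi => [|k IH] L phi LB.
  rewrite (avg_nil (fun u => EE v : 0.-tuple G, phi (ldif L u v))).
  by rewrite (avg_nil (fun v => phi (ldif L [::] v))) (avg_nil (fun h => phi (lmap L h))).
rewrite (avg_cons (fun u => EE v : k.+1.-tuple G, phi (ldif L u v))).
rewrite (avg_cons (fun h => phi (lmap L h))).
transitivity (EE a, EE b, EE h : k.-tuple G, phi (L 0 (b - a) :: lmap (fun i => L i.+1) h)).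
  apply: eq_avg => a; under eq_avg => u.
    rewrite (avg_cons (fun v => phi (ldif L (a :: u) v))); over.
  rewrite avg_exch; apply: eq_avg => b /=; rewrite LB.
  by rewrite (IH (fun i => L i.+1) (fun h => phi (_ :: h))).
rewrite (eq_avg (g := fun a => EE b, EE h : k.-tuple G, phi (L 0 b :: lmap (fun i => L i.+1) h))).
  exact: (avg_cst 0).
by move=> a; rewrite (avg_shift a); apply: eq_avg => b; rewrite addrK.
Qed.

Lemma avg_cube k f L :
  (forall i a b, L i (a - b) = L i a - L i b) ->
  (EE x, EE u : k.-tuple G, EE v : k.-tuple G, cube k (fun h => f (x + lsum L h)) u v) =
  EE h : k.-tuple G, EE x, difs (lmap L h) f x.
Proof.
move=> LB; rewrite avg_exch -(avg_ldif _ (fun l => avg (difs l f)))//.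
apply: eq_avg => u; rewrite avg_exch; apply: eq_avg => v.
rewrite [RHS](avg_shift (lsum L u)); apply: eq_avg => x; exact: cube_difs.
Qed.

(** The (2 ^ k.+1)-th power of the Gowers norm of order k.+1. Peeling off one
    difference makes it a real number that is visibly nonnegative. *)
Definition gowers k f : R := EE h : k.-tuple G, (normc (avg (difs h f)) ^+ 2).

Lemma gowers_ge0 k f : 0 <= gowers k f.
Proof. by apply: avg_ge0 => h; exact: sqr_ge0. Qed.

Lemma gowersS k f : gowers k.+1 f =
  EE h : k.-tuple G, EE a, (normc (avg (dif (difs h f) a)) ^+ 2).
Proof.
rewrite /gowers (avg_cons (fun h => normc (avg (difs h f)) ^+ 2)) avg_exch.
by apply: eq_avg => h; apply: eq_avg => a /=; rewrite difs_dif.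
Qed.

Lemma avg_dif f : (EE a, EE x, dif f a x) = ((normc (avg f) ^+ 2)%:C)%C.
Proof.
rewrite normc_avg_sqr avg_exch; apply: eq_avg => x.
rewrite [RHS](avg_shift x); apply: eq_avg => a; by rewrite addrC.
Qed.

Lemma gowersE k f : (EE a, EE h : k.-tuple G, EE x, difs h (dif f a) x) = ((gowers k f)%:C)%C.
Proof.
rewrite /gowers avgC avg_exch; apply: eq_avg => h; rewrite -avg_dif.
by apply: eq_avg => a; rewrite difs_dif.
Qed.

Lemma gowers_mono1 k f : gowers k f ^+ 2 <= gowers k.+1 f.
Proof.
rewrite gowersS; apply: le_trans (sqr_avg _) _; apply: ler_avg => h.
have -> : normc (avg (difs h f)) ^+ 2 = normc (EE a, EE x, dif (difs h f) a x).
  by rewrite avg_dif normc_real ger0_norm ?sqr_ge0.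
apply: le_trans _ (sqr_avg _).
by rewrite lerXn2r ?nnegrE ?normc_ge0 ?normc_avg// avg_ge0// => a; exact: normc_ge0.
Qed.

Lemma gowers_mono k n f : gowers k f ^+ (2 ^ n) <= gowers (k + n) f.
Proof.
elim: n => [|n IH]; first by rewrite addn0.
rewrite addnS expnSr exprM; apply: le_trans _ (gowers_mono1 _ _).
by rewrite lerXn2r ?nnegrE ?gowers_ge0 ?exprn_ge0 ?gowers_ge0.
Qed.

(** The vertices of the cube other than its base each miss one coordinate, once
    the base point is moved to the far vertex. *)
Fixpoint far (f : G -> C) (h : seq G) (x : G) (i : nat) : C :=
  if h is a :: h' then
    if i is i'.+1 then far f h' (x - a) i'
    else ((difs h' f (x + lsum (fun _ => -%R) h'))^*)%C
  else 1.

Lemma difs_far f h x :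
  difs h f (x + lsum (fun _ => -%R) h) =
  f (x + lsum (fun _ => -%R) h) * \prod_(i < size h) far f h x i.
Proof.
elim: h x => [|a h IH] x /=; first by rewrite big_ord0 mulr1.
rewrite big_ord_recl /= mulrCA addrA -IH difs_dif /dif mulrC.
by congr (((difs _ _ _)^*)%C * _); rewrite addrAC subrK.
Qed.

Lemma far_le1 f h x i : (forall x, normc (f x) <= 1) -> normc (far f h x i) <= 1.
Proof.
move=> f1; elim: h x i => [|a h IH] x [|i] //; try by rewrite normc1.
- by rewrite /far normcJ difs_le1.
- exact: IH.
Qed.

Lemma far_indep f x i : indep 0 i (fun h => far f h x i).
Proof.
move=> h; elim: h x i => [|a h IH] x i [|b h'] //= [hh'] e.
case: i e => [|i] e.
  suff -> : h = h' by [].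
  by apply: (@eq_from_nth _ 0) => // j _; exact: (e j.+1).
have -> : a = b by exact: (e 0).
by apply: IH => // j ji; exact: (e j.+1).
Qed.
End Gowers.

(** * Polynomial maps on a finite field *)

Section PolynomialMaps.
Context {F : finFieldType}.
Implicit Types (P Q : F -> F).

Definition shift (h : F) P : F -> F := fun y => P (y + h).
Definition delta (h : F) P : F -> F := fun y => P (y + h) - P y.

(** Degree at most [k] in the sense of finite differences. In characteristic p
    additive polynomials such as y^p have degree 1 in this sense, which is what
    makes PET induction terminate at additive families. *)
Fixpoint fdeg k P : Prop :=
  if k is k'.+1 then forall h, fdeg k' (delta h P) else forall y z, P y = P z.

Lemma fdegD k P Q : fdeg k P -> fdeg k Q -> fdeg k (fun y => P y + Q y).
Proof.
elim: k P Q => [|k IH] P Q /= HP HQ.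
  by move=> y z; rewrite (HP y z) (HQ y z).
move=> h; have := IH _ _ (HP h) (HQ h).
by congr fdeg; apply/funext => y; rewrite /delta opprD addrACA.
Qed.

Lemma fdegN k P : fdeg k P -> fdeg k (fun y => - P y).
Proof.
elim: k P => [|k IH] P /= HP; first by move=> y z; rewrite (HP y z).
move=> h; have := IH _ (HP h).
by congr fdeg; apply/funext => y; rewrite /delta opprD.
Qed.

Lemma fdegB k P Q : fdeg k P -> fdeg k Q -> fdeg k (fun y => P y - Q y).
Proof. by move=> HP HQ; apply: fdegD => //; exact: fdegN. Qed.

Lemma fdeg0 k : fdeg k (fun=> 0).
Proof.
elim: k => [|k IH] //= h; suff -> : delta h (fun=> 0) = fun=> 0 by [].
by apply/funext => y; rewrite /delta subrr.
Qed.

Lemma fdegS k P : fdeg k P -> fdeg k.+1 P.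
Proof.
elim: k P => [|k IH] P HP h; last by apply: IH; exact: HP.
by move=> y z; rewrite /delta !(HP _ 0) subrr.
Qed.

Lemma fdeg_leq k l P : (k <= l)%N -> fdeg k P -> fdeg l P.
Proof.
move=> /subnKC <-; elim: (l - k)%N => [|n IH]; first by rewrite addn0.
by move=> /IH HP; rewrite addnS; exact: fdegS.
Qed.

Definition poly_map d P := exists2 p : {poly F}, (size p <= d.+1)%N & P =1 horner p.

Lemma poly_mapD d P Q : poly_map d P -> poly_map d Q -> poly_map d (fun y => P y + Q y).
Proof.
move=> [p sp Pp] [q sq Qq]; exists (p + q) => [|y].
  by rewrite (leq_trans (size_polyD _ _))// geq_max sp.
by rewrite hornerD Pp Qq.
Qed.

Lemma poly_mapN d P : poly_map d P -> poly_map d (fun y => - P y).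
Proof. by move=> [p sp Pp]; exists (- p) => [|y]; rewrite ?size_polyN// hornerN Pp. Qed.

Lemma poly_mapB d P Q : poly_map d P -> poly_map d Q -> poly_map d (fun y => P y - Q y).
Proof. by move=> HP HQ; apply: poly_mapD => //; exact: poly_mapN. Qed.

Lemma poly_mapZ d c P : poly_map d P -> poly_map d (fun y => c * P y).
Proof.
move=> [p sp Pp]; exists (c *: p) => [|y]; last by rewrite hornerZ Pp.
exact: leq_trans (size_scale_leq _ _) sp.
Qed.

Lemma poly_map_cst d c : poly_map d (fun=> c).
Proof.
by exists c%:P => [|y]; rewrite ?hornerC// (leq_trans (size_polyC_leq1 _)).
Qed.

Lemma poly_map_sum d I (r : seq I) (f : I -> F -> F) :
  (forall i, poly_map d (f i)) -> poly_map d (fun y => \sum_(i <- r) f i y).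
Proof.
move=> Hf; elim: r => [|i r IH].
  by have [p sp Pp] := poly_map_cst d 0; exists p => // y; rewrite big_nil; exact: Pp.
have [p sp Pp] := poly_mapD (Hf i) IH.
by exists p => // y; rewrite big_cons; exact: Pp.
Qed.

Lemma poly_map_shift d h P : poly_map d P -> poly_map d (shift h P).
Proof.
move=> [p sp Pp]; exists (p \Po ('X + h%:P)) => [|y].
  by rewrite size_comp_poly2// size_XaddC.
by rewrite horner_comp /shift Pp !hornerE.
Qed.

Lemma poly_map_reflect d c P : poly_map d P -> poly_map d (fun h => P (c + h)).
Proof. 
move=> /(poly_map_shift c) [p sp Pp]; exists p => // h.
by rewrite addrC; exact: Pp. Qed.

(** The leading terms of P(y + h) and P(y) cancel. *)
Lemma poly_map_delta d h P : poly_map d.+1 P -> poly_map d (delta h P).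
Proof.
move=> [p sp Pp]; exists (p \Po ('X + h%:P) - p) => [|y]; last first.
  by rewrite hornerD hornerN horner_comp /delta !Pp !hornerE.
apply/leq_sizeP => j; rewrite leq_eqVlt => /predU1P[<-|dj]; rewrite coefB; last first.
  by rewrite !nth_default ?subrr// ?size_comp_poly2 ?size_XaddC// (leq_trans sp).
have [p0|/negPf sp'] := eqVneq (size p) d.+2; last first.
  have {sp} sp : (size p <= d.+1)%N by move: sp; rewrite leq_eqVlt sp'.
  by rewrite !nth_default ?subrr// ?size_comp_poly2 ?size_XaddC.
have := lead_coef_comp p (q := 'X + h%:P); rewrite size_XaddC lead_coefXaddC expr1n mulr1.
by rewrite /lead_coef size_comp_poly2 ?size_XaddC// p0 /= => ->; rewrite ?subrr.
Qed.

Lemma poly_map_fdeg d P : poly_map d P -> fdeg d P.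
Proof.
elim: d P => [|d IH] P; last by move=> HP h; apply/IH/poly_map_delta.
by move=> [p sp Pp] y z; rewrite !Pp (size1_polyC sp) !hornerC.
Qed.

Lemma poly_map_zeros d P (S : {set F}) : poly_map d P -> (d < #|S|)%N ->
  (forall y, y \in S -> P y = 0) -> forall y, P y = 0.
Proof.
move=> [p sp Pp] dS S0 y; rewrite Pp; suff -> : p = 0 by rewrite horner0.
apply/eqP/contraT => p0; have : (#|S| < size p)%N.
  rewrite cardE; apply: max_poly_roots => //; last exact: enum_uniq.
  by apply/allP => x; rewrite mem_enum => xS; rewrite /root -Pp S0.
by rewrite ltnNge (leq_trans sp).
Qed.

(** For fixed [y] and [z], that [P - shift h Q] takes the same value at both is a
    polynomial condition on [h] of degree at most [d]. *)
Lemma generic_shift d P Q (S : {set F}) : poly_map d P -> poly_map d Q ->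
  (d < #|S|)%N -> (forall h, h \in S -> fdeg 0 (fun y => P y - shift h Q y)) ->
  forall h, fdeg 0 (fun y => P y - shift h Q y).
Proof.
move=> HP HQ dS HS h y z.
pose U h' := (P y - Q (y + h')) - (P z - Q (z + h')).
suff /(_ h)/eqP : forall h', U h' = 0 by rewrite subr_eq0 => /eqP.
apply: (poly_map_zeros (d := d) (S := S)) => // [|h' /HS /(_ y z) H]; last first.
  by apply/eqP; rewrite subr_eq0; apply/eqP; exact: H.
by do 2!apply: poly_mapB; rewrite ?{1}/U; try exact: poly_map_cst; exact: poly_map_reflect.
Qed.
End PolynomialMaps.

(** * Van der Corput differencing *)

Section SmallNumbers.
Context {R : realFieldType}.
Implicit Types (d : R).

Lemma exp_le d a b : 0 < d -> d <= 1 / 2 -> (a <= b)%N -> d ^+ b <= d ^+ a.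
Proof. by move=> d0 d1 ab; rewrite ler_wiXn2l ?(ltW d0)//; lra. Qed.

(** The source of all constants: K < 2 ^ K. *)
Lemma exp_small d K : 0 < d -> d <= 1 / 2 -> K%:R * d ^+ K <= 1.
Proof.
move=> d0 d1; have H : d ^+ K <= (2 ^+ K)^-1.
  rewrite -exprVn lerXn2r ?nnegrE ?invr_ge0 ?ler0n ?(ltW d0)//.
  by rewrite -[leRHS]mul1r.
apply: le_trans (ler_wpM2l (ler0n _ _) H) _.
rewrite ler_pdivrMr ?exprn_gt0// mul1r -natrX ler_nat ltnW//.
exact: ltn_expl.
Qed.

Lemma exp_le_half d a : 0 < d -> d <= 1 / 2 -> d ^+ a.+1 <= 1 / 2.
Proof. by move=> d0 d1; rewrite (le_trans _ d1)// -[leRHS]expr1 exp_le. Qed.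

Lemma absorb (q K b : nat) d : 0 < d -> d <= 1 / 2 ->
  q%:R * d ^+ b <= K%:R -> q%:R * d ^+ (b + K) <= 1.
Proof.
move=> d0 d1 H; rewrite exprD mulrA (le_trans _ (exp_small K d0 d1))//.
by rewrite ler_wpM2r// exprn_ge0// ltW.
Qed.

Lemma small_le (q a b : nat) d : 0 < d -> d <= 1 / 2 -> (a <= b)%N ->
  q%:R * d ^+ a <= 1 -> q%:R * d ^+ b <= 1.
Proof.
move=> d0 d1 ab; apply: le_trans; rewrite ler_wpM2l//; exact: exp_le.
Qed.
End SmallNumbers.

Section VanDerCorput.
Context {R : realType} {F : finFieldType}.
Local Notation C := R[i].
Implicit Types (P : F -> F) (f : F -> C) (X : seq ((F -> F) * (F -> C))).

Definition average X P f : C :=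
  EE x, EE y, (f (x + P y) * \prod_(u <- X) u.2 (x + u.1 y)).

Lemma avg_translate P (g : F -> F -> C) :
  (EE x, EE y, g x y) = EE x, EE y, g (x - P y) y.
Proof.
rewrite avg_exch [RHS]avg_exch; apply: eq_avg => y; exact: avg_shift.
Qed.

Definition conjf f : F -> C := fun x => ((f x)^*)%C.

Definition vdc_rest X Q := [seq u <- X | ~~ `[< fdeg 0 (u.1 - Q) >]].

(** The family obtained by differencing in [y], after subtracting [Q] and
    discarding what no longer depends on [y]; the tracked pair is not listed, but
    its shifted copy is. *)
Definition vdc X P f Q h : seq ((F -> F) * (F -> C)) :=
  (shift h (P - Q), conjf f) ::
  [seq (u.1 - Q, u.2) | u <- vdc_rest X Q] ++
  [seq (shift h (u.1 - Q), conjf u.2) | u <- vdc_rest X Q].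

(** Translating [x] by [Q y] makes some factors independent of [y]; these are
    discarded by Cauchy--Schwarz, which doubles [y]. *)
Lemma van_der_corput X P f Q :
  (forall u, u \in X -> forall x, normc (u.2 x) <= 1) ->
  normc (average X P f) ^+ 2 <= EE h, normc (average (vdc X P f Q h) (P - Q) f).
Proof.
move=> X1; pose Xc := [seq u <- X | `[< fdeg 0 (u.1 - Q) >]].
pose b x := \prod_(u <- Xc) u.2 (x + (u.1 0 - Q 0)).
pose G x y := f (x + (P - Q) y) * \prod_(u <- vdc_rest X Q) u.2 (x + (u.1 - Q) y).
have -> : average X P f = EE x, (b x * EE y, G x y).
  rewrite /average (avg_translate Q); apply: eq_avg => x.
  rewrite -avgZ; apply: eq_avg => y; rewrite mulrCA /G.
  congr (_ * _); first by congr f; rewrite fctE addrAC addrA.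
  rewrite [LHS](bigID (fun u => `[< fdeg 0 (u.1 - Q) >])) /b /Xc /vdc_rest !big_filter /=.
  congr (_ * _); apply: eq_bigr => u.
    move=> /asboolP H; congr (u.2 _).
    by have := H y 0; rewrite !fctE => <-; rewrite addrAC addrA.
  by move=> _; rewrite fctE addrAC addrA.
have b1 x : normc (b x) <= 1.
  rewrite /b big_seq; elim/big_ind: _ => [||u]; first by rewrite normc1.
    exact: normcM_le1.
  by rewrite mem_filter => /andP[_ uX]; apply: X1.
apply: le_trans (cauchy_schwarz _ b1) _.
apply: le_trans (normc_avg _); rewrite -[leLHS]ger0_norm; last first.
  by apply: avg_ge0 => x; rewrite sqr_ge0.
rewrite -normc_real avgC le_eqVlt; apply/orP; left; apply/eqP; congr normc.
rewrite avg_exch; apply: eq_avg => x; rewrite normc_avg_sqr [RHS]avg_exch.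
apply: eq_avg => y; rewrite [LHS](avg_shift y); apply: eq_avg => h.
rewrite /G /vdc big_cons big_cat !big_map /= rmorphM rmorph_prod (addrC h y).
by rewrite -!mulrA; congr (_ * _); rewrite mulrCA; congr (_ * _).
Qed.

Lemma vdc_bounded X P f Q h : (forall x, normc (f x) <= 1) ->
  (forall u, u \in X -> forall x, normc (u.2 x) <= 1) ->
  forall u, u \in vdc X P f Q h -> forall x, normc (u.2 x) <= 1.
Proof.
move=> f1 X1 u; rewrite inE mem_cat => /or3P[/eqP->|/mapP[v]|/mapP[v]] /=.
- by move=> x; rewrite normcJ.
- by rewrite mem_filter => /andP[_ vX] -> x; exact: (X1 v vX x).
- by rewrite mem_filter => /andP[_ vX] -> x; rewrite normcJ; exact: (X1 v vX x).
Qed.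

Lemma size_vdc X P f Q h : (size (vdc X P f Q h) <= (size X).*2.+1)%N.
Proof.
rewrite /= size_cat !size_map addnn ltnS leq_double size_filter.
exact: count_size.
Qed.

Lemma bad_shifts d P Q : poly_map d P -> poly_map d Q ->
  ~ (forall h, fdeg 0 (P - shift h Q)) ->
  (#|[set h | `[< fdeg 0 (P - shift h Q)%R >]]| <= d)%N.
Proof.
move=> HP HQ H; rewrite leqNgt; apply/negP => dS; apply: H.
by apply: (generic_shift HP HQ dS) => h; rewrite inE => /asboolP.
Qed.

(** For each member of the family, and for the tracked map itself, at most [d]
    shifts [h] make the tracked map differ by a constant from the shifted copy, so
    that a good shift exists unless the field is small. The tracked function must differ from [Q] by more than an additive map,
    as otherwise its shifted copy is always a translate of it. *)
Lemma good_difference N d X P f Q (e : R) : 0 < e -> e <= 1 / 2 ->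
  (size X <= N)%N -> (forall x, normc (f x) <= 1) ->
  (forall u, u \in X -> forall x, normc (u.2 x) <= 1) ->
  poly_map d P -> poly_map d Q -> (forall u, u \in X -> poly_map d u.1) ->
  ~ fdeg 1 (P - Q) -> (forall u, u \in X -> ~ fdeg 0 (u.1 - P)) ->
  e <= normc (average X P f) ->
  #|F|%:R * e ^+ (3 + N.+1 * d) <= 1 \/
  exists2 h, e ^+ 3 <= normc (average (vdc X P f Q h) (P - Q) f) &
    forall u, u \in vdc X P f Q h -> ~ fdeg 0 (u.1 - (P - Q)).
Proof.
move=> e0 e1 XN f1 X1 dP dQ dX PQ XP eX.
pose S := [set h | e ^+ 2 / 2 <= normc (average (vdc X P f Q h) (P - Q) f)].
have avg1 h : normc (average (vdc X P f Q h) (P - Q) f) <= 1.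
  apply: normc_avg_le1 => x; apply: normc_avg_le1 => y; rewrite normcM_le1//.
  rewrite big_seq; elim/big_ind: _ => [||u]; first by rewrite normc1.
    exact: normcM_le1.
  by move=> uX; apply: (vdc_bounded f1 X1 uX).
have Sbig : e ^+ 2 / 2 * #|F|%:R <= #|S|%:R.
  apply: popular => //; first by rewrite exprn_ge0// ltW.
  apply: le_trans (van_der_corput P f Q X1).
  by rewrite lerXn2r ?nnegrE ?normc_ge0// ltW.
pose W := P - Q :: [seq u.1 - Q | u <- X].
pose B w := [set h | `[< fdeg 0 ((P - Q) - shift h w) >]].
have Bd w : w \in W -> (#|B w| <= d)%N.
  move=> wW; have dw : poly_map d w.
    move: wW; rewrite inE => /predU1P[->|/mapP[u uX ->]]; first exact: poly_mapB.
    exact: poly_mapB (dX _ uX) dQ.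
  apply: bad_shifts => //; first exact: poly_mapB.
  move=> H; move: wW; rewrite inE => /predU1P[wE|/mapP[u uX wE]].
    apply: PQ => h; have := fdegN (H h); rewrite wE; congr fdeg.
    by apply/funext => y; rewrite /delta /shift !fctE; ring.
  apply: (XP u uX); have := fdegN (H 0); rewrite wE; congr fdeg.
  by apply/funext => y; rewrite /shift !fctE addr0; ring.
pose BB := \bigcup_(w <- W) B w.
have BBd : (#|BB| <= N.+1 * d)%N.
  have : (#|BB| <= size W * d)%N.
    rewrite /BB; elim: (W) Bd => [|w W' IH] Bd; first by rewrite big_nil cards0.
    rewrite big_cons mulSn (leq_trans (leq_card_setU _ _))// leq_add//.
      by rewrite Bd// mem_head.
    by apply: IH => v vW; rewrite Bd// inE vW orbT.
  move=> /leq_trans -> //; rewrite leq_mul2r /= size_map ltnS XN orbT //.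
have [SB|BS] := leqP #|S| #|BB|.
  left; apply: absorb => //; apply: le_trans (_ : #|S|%:R <= _); last first.
    by rewrite ler_nat (leq_trans SB).
  apply: le_trans Sbig; rewrite mulrC ler_wpM2r// exprSr.
  rewrite ler_wpM2l ?exprn_ge0 ?(ltW e0)//; lra.
right; have /subsetPn[h hS hB] : ~~ (S \subset BB).
  by apply/negP => /subset_leq_card; rewrite leqNgt BS.
have good w : w \in W -> ~ fdeg 0 ((P - Q) - shift h w).
  move=> wW H; move/negP: hB; apply; rewrite /BB; elim: (W) wW => // v W' IH.
  rewrite big_cons !inE => /predU1P[<-|/IH ->]; last by rewrite orbT.
  by apply/orP; left; apply/asboolP.
exists h.
  rewrite inE in hS; apply: le_trans hS; rewrite exprSr.
  rewrite ler_wpM2l ?exprn_ge0 ?(ltW e0)//; lra.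
move=> u; rewrite inE mem_cat => /or3P[/eqP->|/mapP[v]|/mapP[v]] /=.
- move=> H0; have H := fdegN (k := 0) H0; apply: (good (P - Q)); first exact: mem_head.
  by move: H; congr fdeg; apply/funext => y; rewrite !fctE; ring.
- rewrite mem_filter => /andP[_ vX] -> /= H; apply: (XP v vX).
  move: (H : fdeg 0 ((v.1 - Q) - (P - Q))); congr fdeg.
  by apply/funext => y; rewrite !fctE; ring.
- rewrite mem_filter => /andP[_ vX] -> /= H0; have H := fdegN (k := 0) H0.
  apply: (good (v.1 - Q)); first by rewrite inE; apply/orP; right; apply/mapP; exists v.
  by move: H; congr fdeg; apply/funext => y; rewrite !fctE; ring.
Qed.
End VanDerCorput.

(** * Families with additive differences *)

Section LinearCase.
Context {R : realType} {F : finFieldType}.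
Local Notation C := R[i].
Implicit Types (P L : F -> F) (f : F -> C) (X : seq ((F -> F) * (F -> C))).

Lemma lsumE (L : nat -> F -> F) h : lsum L h = \sum_(j < size h) L j (nth 0 h j).
Proof.
elim: h L => [|a h IH] L /=; first by rewrite big_ord0.
by rewrite big_ord_recl /= IH.
Qed.

Lemma avg_lmap d k (L : nat -> F -> F) (phi : seq F -> R) :
  (forall l, 0 <= phi l) -> (forall i b, (#|[set a | L i a == b]| <= d)%N) ->
  avg (fun h : k.-tuple F => phi (lmap L h)) <= (d ^ k)%:R * avg (fun h : k.-tuple F => phi h).
Proof.
elim: k L phi => [|k IH] L phi phi0 Ld.
  by rewrite (avg_nil (fun h => phi (lmap L h))) avg_nil expn0 mul1r.
rewrite (avg_cons (fun h => phi (lmap L h))) (avg_cons phi) expnS natrM.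
apply: le_trans (_ : (EE a, ((d ^ k)%:R * avg (fun h : k.-tuple F => phi (L 0 a :: h)))) <= _).
  apply: ler_avg => a /=.
  by apply: (IH (fun i => L i.+1) (fun h => phi (L 0 a :: h))) => // i b; exact: Ld.
rewrite avgZ (mulrC d%:R) -mulrA ler_wpM2l//.
pose psi b := avg (fun h : k.-tuple F => phi (b :: h)).
have psi0 b : 0 <= psi b by exact: avg_ge0.
rewrite -[X in X <= _]/(EE a, psi (L 0 a)) -[X in _ <= _ * X]/(avg psi) /avg.
rewrite mulrCA ler_wpM2l ?invr_ge0// (partition_big (L 0) xpredT)//= mulr_sumr.
apply: ler_sum => b _; rewrite (eq_bigr (fun=> psi b)) => [|a /eqP -> //].
rewrite sumr_const -[X in X <= _]mulr_natl ler_wpM2r//.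
by rewrite ler_nat; apply: leq_trans (Ld 0%N b); rewrite cardsE.
Qed.

Lemma fdeg1_additive P : fdeg 1 P -> forall a b, P (a - b) - P 0 = (P a - P 0) - (P b - P 0).
Proof.
move=> HP a b; have := HP b (a - b) 0; rewrite /delta subrK add0r => /eqP.
rewrite subr_eq => /eqP ->; ring.
Qed.

(** When all differences are additive, replace [y] by y + h_1 + ... + h_n and
    translate [x] so that the [i]-th function no longer depends on h_i. The box
    Cauchy--Schwarz inequality then removes all functions but [f], and the
    additive maps that remain have kernels of size at most [d]. *)
Lemma linear_control N d X P f (e : R) : 0 < e -> e <= 1 / 2 ->
  (size X <= N)%N -> (forall x, normc (f x) <= 1) ->
  (forall u, u \in X -> forall x, normc (u.2 x) <= 1) ->
  poly_map d P -> (forall u, u \in X -> poly_map d u.1) ->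
  (forall u, u \in X -> fdeg 1 (u.1 - P)) ->
  (forall u, u \in X -> ~ fdeg 0 (u.1 - P)) ->
  e <= normc (average X P f) ->
  e ^+ ((2 ^ N + d.+1 ^ N) * 2 * 2 ^ N) <= gowers N f.
Proof.
move=> e0 e1 XN f1 X1 dP dX lX XP eX; set n := size X.
(* The default member keeps [L i] injective beyond the end of [X]. *)
pose u0 : (F -> F) * (F -> C) := (P + id, fun=> 1).
pose u i := nth u0 X i.
pose M i := (u i).1 - P.
have un i : (i < n)%N -> u i \in X by move=> ni; exact: mem_nth.
have linM i : fdeg 1 (M i).
  have [ni|ni] := ltnP i n; first exact/lX/un.
  move=> h y z; rewrite /M /u nth_default //= /delta !fctE.
  by ring.
pose L i y := - (M i y - M i 0).
have LB i a b : L i (a - b) = L i a - L i b.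
  by rewrite /L fdeg1_additive//; ring.
pose Y (z : F * F) h := f (z.1 + lsum L h).
pose B i (z : F * F) h := if (i < n)%N
  then (u i).2 (z.1 + (M i z.2 + lsum (fun j y => L j y - L i y) h)) else 1.
have B1 i z h : normc (B i z h) <= 1.
  by rewrite /B; case: ifP => [/un/X1|]; rewrite ?normc1.
have Bi i z : indep 0 i (B i z).
  move=> h h' hh' e'; rewrite /B; case: ifP => // _; congr ((u i).2 (_ + (_ + _))).
  rewrite !lsumE hh'; apply: eq_bigr => j _.
  by have [->|ji] := eqVneq (j : nat) i; rewrite ?subrr// e'.
have := box_cauchy_schwarz n Y B1 Bi.
set LHS := (X in normc X ^+ _ <= _); have -> : LHS = average X P f.
  rewrite /LHS avg_pair.
  transitivity (EE h : n.-tuple F, EE x, EE y,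
      (f (x + lsum L h) * \prod_(i < n) B i (x, y) h)).
    by rewrite [RHS]avg_exch; apply: eq_avg => x; rewrite [RHS]avg_exch.
  rewrite (eq_avg (g := fun=> average X P f)) => [|h].
    exact: (avg_cst [tuple of nseq n 0]).
  rewrite /average [RHS](avg_translate P) avg_exch [RHS]avg_exch.
  rewrite [RHS](avg_shift (\sum_(j < size h) nth 0 h j)); apply: eq_avg => y.
  rewrite [RHS](avg_shift (lsum L h)); apply: eq_avg => x.
  rewrite subrK; congr (_ * _).
  rewrite (big_nth u0) big_mkord; apply: eq_bigr => i _; rewrite /B ltn_ord.
  congr ((u i).2 _); set s := \sum_(j < _) _.
  have L0 : L i 0 = 0 by rewrite /L subrr oppr0.
  have LD a b : L i (a + b) = L i a + L i b.
    by rewrite -{1}(opprK b) LB -(sub0r b) LB L0 sub0r opprK.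
  have -> : lsum (fun j y => L j y - L i y) h = lsum L h - L i s.
    by rewrite !lsumE sumrB; congr (_ - _); rewrite /s (big_morph _ LD L0).
  have := linM i s y 0; rewrite /delta add0r => /eqP; rewrite subr_eq => /eqP E.
  have {E} -> : (nth u0 X i).1 (y + s) = M i s - M i 0 + M i y + P (y + s).
    by rewrite -E /M /u !fctE subrK.
  by rewrite /L /=; ring.
rewrite avg_pair (eq_avg (g := fun x => EE u : n.-tuple F, EE v : n.-tuple F,
    cube n (fun h => f (x + lsum L h)) u v)) => [|x]; last by rewrite /Y /= (avg_cst (0 : F)).
rewrite (avg_cube n f LB) => H.
pose phi l := normc (avg (difs l f)).
have nD : (d.+1 ^ n <= d.+1 ^ N)%N.
  by rewrite leq_pexp2l.
have phiU : (avg (fun h : n.-tuple F => phi h)) ^+ 2 <= gowers n f by exact: sqr_avg.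
have phi0 : 0 <= avg (fun h : n.-tuple F => phi h) by apply: avg_ge0 => h; exact: normc_ge0.
have Ld i b : (#|[set a | L i a == b]| <= d.+1)%N.
  have [ni|ni] := ltnP i n; last first.
    apply: leq_trans (_ : #|pred1 (- b)%R| <= _)%N; last by rewrite card1.
    apply/subset_leq_card/fintype.subsetP => y; rewrite !inE /L /M /u nth_default //= !fctE.
    by move=> /eqP <-; apply/eqP; ring.
  rewrite leqNgt; apply/negP => dS; apply: (XP _ (un _ ni)).
  have Lb : forall y, L i y - b = 0.
    apply: (poly_map_zeros (d := d) (S := [set a | L i a == b])).
    - apply: poly_mapB; last exact: poly_map_cst.
      apply: poly_mapN; apply: poly_mapB; last exact: poly_map_cst.
      by apply: poly_mapB => //; apply/dX/un.
    - exact: ltnW.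
    - by move=> y; rewrite inE => /eqP ->; rewrite subrr.
  move=> y z; have := Lb y; rewrite -(Lb z) => /addIr /oppr_inj /addIr; exact.
have {}H : e ^+ (2 ^ n) <= (d.+1 ^ n)%:R * avg (fun h : n.-tuple F => phi h).
  apply: le_trans (avg_lmap n _ Ld); last by move=> l; exact: normc_ge0.
  apply: le_trans (normc_avg _); apply: le_trans H.
  by rewrite lerXn2r ?nnegrE ?normc_ge0// ltW.
have {}H : e ^+ (2 ^ n + d.+1 ^ n) <= avg (fun h : n.-tuple F => phi h).
  rewrite exprD; apply: le_trans (ler_wpM2r _ H) _; first by rewrite exprn_ge0// ltW.
  rewrite mulrAC -[leRHS]mul1r ler_wpM2r//; exact: exp_small.
have {}H : e ^+ ((2 ^ n + d.+1 ^ n) * 2) <= gowers n f.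
  apply: le_trans phiU; rewrite exprM lerXn2r ?nnegrE ?exprn_ge0// ltW//.
have := gowers_mono n (N - n) f; rewrite subnKC//; apply: le_trans.
apply: le_trans (_ : (e ^+ ((2 ^ n + d.+1 ^ n) * 2)) ^+ (2 ^ (N - n)) <= _); last first.
  by rewrite lerXn2r ?nnegrE ?gowers_ge0 ?exprn_ge0// ltW.
rewrite -exprM exp_le// leq_mul// ?leq_pexp2l ?leq_subr//.
by rewrite leq_mul2r/= leq_add// leq_pexp2l.
Qed.
End LinearCase.

(** * PET induction: control by Gowers norms *)

Section PET.
Context {R : realType}.
Local Notation C := R[i].

Lemma eq_fdegP (F : finFieldType) k (P Q : F -> F) : fdeg k P -> P = Q -> fdeg k Q.
Proof. by move=> HP <-. Qed.

Lemma gowers_up (F : finFieldType) (f : F -> C) (e : R) s t a :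
  0 < e -> e ^+ a <= gowers s f -> e ^+ (a * 2 ^ t) <= gowers (s + t) f.
Proof.
move=> e0 H; apply: le_trans (gowers_mono s t f).
by rewrite exprM lerXn2r ?nnegrE ?gowers_ge0 ?exprn_ge0// ltW.
Qed.

Lemma map_cst A B (c : B) (r : seq A) : map (fun=> c) r = nseq (size r) c.
Proof. by elim: r => //= a r ->. Qed.

Definition admissible (F : finFieldType) N d (X : seq ((F -> F) * (F -> C)))
    (P : F -> F) (f : F -> C) :=
  [/\ (size X <= N)%N, poly_map d P, forall x, normc (f x) <= 1 &
    forall u, u \in X ->
      [/\ poly_map d u.1, forall x, normc (u.2 x) <= 1 & ~ fdeg 0 (u.1 - P)]].

(** Uniform control of the tracked function by a Gowers norm, for all families
    with a given shape. Fields of every characteristic are treated at once. *)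
Definition controlled
    (Phi : forall F : finFieldType, seq ((F -> F) * (F -> C)) -> (F -> F) -> Prop) :=
  forall N d, exists s a : nat, forall (F : finFieldType) X P f (e : R),
    0 < e -> e <= 1 / 2 -> admissible N d X P f -> Phi F X P ->
    e <= normc (average X P f) ->
    #|F|%:R * e ^+ a <= 1 \/ e ^+ a <= gowers s f.

Definition within E (F : finFieldType) (X : seq ((F -> F) * (F -> C))) (P : F -> F) :=
  forall u, u \in X -> fdeg E (u.1 - P).

(** The shape of a family during PET induction. Members at distance at most [E]
    from the tracked map [P] are left alone; the others lie in cells: a cell is a
    pair (k, c) and contains the maps at distance at most k from c, where the
    distance of two maps is the degree of their difference. Centres of cells are
    close enough to each other for differencing by a member of the smallest cell
    to preserve all cells. The list [ks] of the sizes is what decreases, in the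
    multiset order. *)
Definition covered E ks (F : finFieldType) (X : seq ((F -> F) * (F -> C))) (P : F -> F) :=
  exists Z : seq (nat * (F -> F)),
  [/\ map fst Z = ks, within E.+1 X P,
      forall u, u \in X -> fdeg E (u.1 - P) \/ exists2 c, c \in Z & fdeg c.1 (u.1 - c.2) &
      forall c c', c \in Z -> c' \in Z -> (c'.1 <= c.1)%N -> fdeg c.1.+1 (c.2 - c'.2)].

(** What remains of a cell of size [k] after it has been used: its members are
    the centres of new cells of size [k.-1]. *)
Definition cells k n : seq nat := if k == 0%N then [::] else nseq n k.-1.

(** One differencing step, by a member [v] of a smallest cell, which for [k = 0]
    eliminates this cell altogether. If no such member is far from [P] then the
    cell can be forgotten. *)
Lemma controlled_cons E k ks : (0 < E)%N -> all (leq k) ks ->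
  (forall n, controlled (covered E (cells k n ++ ks))) ->
  controlled (covered E (k :: ks)).
Proof.
move=> E0 kks H N d.
have [s1 [a1 H1]] := H 0 N d; have [s2 [a2 H2]] := H N N.*2.+1 d.
pose a := (a1 * 2 ^ s2 + 3 * a2 * 2 ^ s1 + (3 + N.+1 * d))%N.
have a1a : (a1 * 2 ^ s2 <= a)%N by rewrite /a; lia.
have a2a : (3 * a2 * 2 ^ s1 <= a)%N by rewrite /a; lia.
have a3a : (3 + N.+1 * d <= a)%N by rewrite /a; lia.
have a4a : (a1 <= a)%N by rewrite (leq_trans _ a1a)// leq_pmulr// expn_gt0.
have a5a : (3 * a2 <= a)%N by rewrite (leq_trans _ a2a)// leq_pmulr// expn_gt0.
clearbody a; exists (s1 + s2)%N, a.
move=> F X P f e e0 e1 [XN dP f1 HX] [[|[k' z] Z] [//= kE XE XZ ZZ]] eX.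
case: kE XZ ZZ => -> Zks XZ ZZ.
have X1 u : u \in X -> forall x, normc (u.2 x) <= 1 by move=> /HX[].
have dX u : u \in X -> poly_map d u.1 by move=> /HX[].
have XP u : u \in X -> ~ fdeg 0 (u.1 - P) by move=> /HX[].
have [[v vX [vz vP]]|nv] := pselect (exists2 v, v \in X & fdeg k (v.1 - z) /\ ~ fdeg E (v.1 - P)); last first.
  have {H1} [] := H1 F X P f e e0 e1.
  - by split.
  - exists Z; split => //; first by rewrite /cells; case: ifP.
    + move=> u uX; have [?|[c]] := XZ u uX; first by left.
      rewrite inE => /predU1P[->|cZ] /= uc; last by right; exists c.
      by left; apply: contrapT => uP; apply: nv; exists u.
    + by move=> c c' cZ c'Z; apply: ZZ; rewrite inE ?cZ ?c'Z orbT.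
  - by [].
  - by move=> S; left; apply: small_le S.
  - move=> /(gowers_up s2 e0) S; right; apply: le_trans S.
    exact: exp_le.
have dQ := dX _ vX; have QE := XE _ vX.
move: v.1 vz vP dQ QE => Q vz vP dQ QE.
have PQ1 : ~ fdeg 1 (P - Q).
  move=> H0; apply: vP; apply: (fdeg_leq E0); apply: eq_fdegP (fdegN H0) _.
  by apply/funext => y /=; rewrite !fctE; ring.
have [S|[h eh Xh]] := good_difference e0 e1 XN f1 X1 dP dQ dX PQ1 XP eX.
  by left; apply: small_le S.
have e30 : 0 < e ^+ 3 by rewrite exprn_gt0.
have e31 : e ^+ 3 <= 1 / 2 by exact: exp_le_half.
have Qz : fdeg k (Q - z) by [].
have {H2} [] := H2 F (vdc X P f Q h) (P - Q) f (e ^+ 3) e30 e31.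
- split => //; first by rewrite (leq_trans (size_vdc _ _ _ _ _))// ltnS leq_double.
    exact: poly_mapB.
  move=> u uX; split; last exact: Xh.
    move: uX; rewrite inE mem_cat => /or3P[/eqP->|/mapP[w]|/mapP[w]] /=.
    + exact/poly_map_shift/poly_mapB.
    + by rewrite mem_filter => /andP[_ wX] -> /=; apply: poly_mapB => //; exact: dX.
    + rewrite mem_filter => /andP[_ wX] -> /=; apply: poly_map_shift.
      by apply: poly_mapB => //; exact: dX.
  exact: (vdc_bounded f1 X1 uX).
(* Exactly [N] new centres are listed; positions without a member of the cell
   get the centre 0, the difference of the pivot with itself. *)
- pose rep i : F -> F := let w := (nth v X i).1 in
    if `[< fdeg k (w - z) >] then w - Q else 0.
  have repP i : exists2 w, fdeg k (w - z) & rep i = w - Q.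
    rewrite /rep; case: asboolP => [wz|_]; first by exists (nth v X i).1.
    by exists Q => //; apply/funext => y; rewrite !fctE subrr.
  pose Znew := if k == 0%N then [::] else mkseq (fun i => (k.-1, rep i)) N.
  pose Zold := [seq (c.1, c.2 - Q) | c <- Z].
  have oldP c : c \in Zold -> exists2 w, (c.1, w) \in Z & c.2 = w - Q.
    by move=> /mapP[[l w] wZ ->]; exists w.
  have newP c : c \in Znew -> c.1.+1 = k /\ exists2 w, fdeg k (w - z) & c.2 = w - Q.
    rewrite /Znew; case: eqP => // k0 /mapP[i _ ->]; split; last exact: repP.
    by rewrite /= prednK// lt0n; apply/eqP.
  have kZ l w : (l, w) \in Z -> (k <= l)%N.
    by move=> lZ; apply: (allP kks); rewrite -Zks; apply/mapP; exists (l, w).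
  have zZ l w : (l, w) \in Z -> fdeg l.+1 (w - z).
    move=> lZ; apply: (ZZ (l, w) (k, z)) => /=; last exact: kZ lZ.
      by rewrite inE lZ orbT.
    by rewrite inE eqxx.
  have vdcP u : u \in vdc X P f Q h -> [\/ u.1 = shift h (P - Q),
      (exists2 w, w \in X & ~ fdeg 0 (w.1 - Q) /\ u.1 = w.1 - Q) |
      (exists2 w, w \in X & ~ fdeg 0 (w.1 - Q) /\ u.1 = shift h (w.1 - Q))].
    rewrite inE mem_cat => /or3P[/eqP->|/mapP[w]|/mapP[w]]; first by constructor 1.
    + by rewrite mem_filter => /andP[/asboolP wQ wX] ->; constructor 2; exists w.
    + by rewrite mem_filter => /andP[/asboolP wQ wX] ->; constructor 3; exists w.
  have QPE : fdeg E.+1 (P - Q).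
    by apply: eq_fdegP (fdegN QE) _; apply/funext => y /=; rewrite !fctE; ring.
  have wQE w : w \in X -> fdeg E.+1 (w.1 - Q).
    move=> wX; apply: eq_fdegP (fdegB (XE w wX) QE) _.
    by apply/funext => y /=; rewrite !fctE; ring.
  have newX w : w \in X -> fdeg k (w.1 - z) -> (0 < k)%N -> (k.-1, w.1 - Q) \in Znew.
    move=> wX wz k0; rewrite /Znew -leqn0 leqNgt k0; apply/mapP; exists (index w X).
      by rewrite mem_iota (leq_trans _ XN)// index_mem.
    by rewrite /rep nth_index//; case: asboolP.
  (* the shifted copy stays in the cell of the unshifted one *)
  have shifted l (A B : F -> F) : fdeg l (A - B) -> fdeg l.+1 A -> fdeg l (shift h A - B).
    move=> AB /(_ h) A1; apply: eq_fdegP (fdegD AB A1) _.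
    by apply/funext => y; rewrite /delta /shift !fctE; ring.
  have cell w : w \in X -> ~ fdeg 0 (w.1 - Q) ->
      (fdeg E ((w.1 - Q) - (P - Q)) \/
       exists2 c, c \in Znew ++ Zold & fdeg c.1 ((w.1 - Q) - c.2) /\ fdeg c.1.+1 (w.1 - Q)).
    move=> wX wQ; have [wE|[[l c] cZ /= wc]] := XZ w wX.
      by left; apply: eq_fdegP wE _; apply/funext => y /=; rewrite !fctE; ring.
    right; move: cZ; rewrite inE => /predU1P[[lk cz]|cZ].
      rewrite {}lk {}cz in wc.
      have wQk : fdeg k (w.1 - Q).
        by apply: eq_fdegP (fdegB wc Qz) _; apply/funext => y /=; rewrite !fctE; ring.
      have k0 : (0 < k)%N by rewrite lt0n; apply/eqP => k0; apply: wQ; rewrite -k0.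
      exists (k.-1, w.1 - Q); first by rewrite mem_cat newX.
      split; first by rewrite subrr; exact: fdeg0.
      by move: wQk; rewrite -{1}(prednK k0).
    exists (l, c - Q); first by rewrite mem_cat (map_f (fun c => (c.1, c.2 - Q)) cZ) orbT.
    split; first by apply: eq_fdegP wc _; apply/funext => y /=; rewrite !fctE; ring.
    have kl := kZ _ _ cZ.
    apply: eq_fdegP (fdegB (fdegD (fdegS wc) (zZ _ _ cZ)) (fdeg_leq (leqW kl) Qz)) _.
    by apply/funext => y /=; rewrite !fctE; ring.
  exists (Znew ++ Zold); split.
  + rewrite map_cat; congr (_ ++ _); last by rewrite -Zks -map_comp.
    rewrite /Znew /cells; case: eqP => // _.
    by rewrite -map_comp /mkseq (eq_map (g := fun=> k.-1))// map_cst size_iota.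
  + move=> u /vdcP[->|[w wX [_ ->]]|[w wX [_ ->]]].
    * by apply/fdegS/shifted; [rewrite subrr; exact: fdeg0|].
    * by apply: eq_fdegP (XE w wX) _; apply/funext => y /=; rewrite !fctE; ring.
    * apply: shifted; last exact/fdegS/wQE.
      by apply: eq_fdegP (XE w wX) _; apply/funext => y /=; rewrite !fctE; ring.
  + move=> u /vdcP[->|[w wX [wQ ->]]|[w wX [wQ ->]]].
    * by left; apply: shifted => //; rewrite subrr; exact: fdeg0.
    * by have [|[c cZ [wc _]]] := cell w wX wQ; [left|right; exists c].
    * have [wE|[c cZ [wc wc1]]] := cell w wX wQ; first by left; apply: shifted => //; exact: wQE.
      by right; exists c => //; exact: shifted.
  + have cross w w' l : fdeg k (w' - z) -> (k <= l)%N -> fdeg l.+1 (w - z) ->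
        fdeg l.+1 ((w - Q) - (w' - Q)).
      move=> w'z kl wz; apply: eq_fdegP (fdegB wz (fdeg_leq (leqW kl) w'z)) _.
      by apply/funext => y /=; rewrite !fctE; ring.
    move=> c c'; rewrite !mem_cat => /orP[/newP[ck [w wz ->]]|/oldP[w wZ ->]].
      move=> /orP[/newP[ck' [w' wz' ->]] _|/oldP[w' wZ' ->]].
        rewrite ck; apply: eq_fdegP (fdegB wz wz') _.
        by apply/funext => y /=; rewrite !fctE; ring.
      by move=> H0; have := kZ _ _ wZ'; rewrite -ck ltnNge H0.
    move=> /orP[/newP[ck' [w' wz' ->]] _|/oldP[w' wZ' ->] cc'].
      by apply: cross => //; [exact: kZ wZ|exact: zZ].
    have H0 : fdeg c.1.+1 (w - w').
      by apply: (ZZ (c.1, w) (c'.1, w')) => //; rewrite inE ?wZ ?wZ' orbT.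
    by apply: eq_fdegP H0 _; apply/funext => y /=; rewrite !fctE; ring.
- by [].
- by rewrite -exprM => S; left; apply: small_le S.
- rewrite -exprM => /(gowers_up s1 e0) S; right; rewrite addnC; apply: le_trans S.
  exact: exp_le.
Qed.

Lemma controlled_nil E : controlled (within E) -> controlled (covered E [::]).
Proof.
move=> H N d; have [s [a {}H]] := H N d; exists s, a => F X P f e e0 e1 adm.
move=> [Z [ZE XE XZ _]] eX; case: Z ZE XZ => // _ XZ; apply: (H F X P f e) => // u uX.
by have [|[]] := XZ u uX.
Qed.

Lemma controlled_nseq E k ks : (0 < E)%N -> all (leq k) ks ->
  controlled (covered E ks) -> forall n, controlled (covered E (nseq n k ++ ks)).
Proof.
move=> E0; elim: k ks => [|k IHk] ks kks H; elim=> [|n IHn] //=.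
  apply: controlled_cons => //; first by rewrite all_cat kks all_nseq orbT.
apply: controlled_cons => //; first by rewrite all_cat kks all_nseq leqnn orbT.
move=> m; apply: IHk => //; rewrite all_cat all_nseq leqnSn orbT/=.
by apply: sub_all kks => i; exact: ltnW.
Qed.

(** Once the far members are eliminated the diameter of the family has dropped. *)
Lemma controlled_within E : controlled (within E.+1).
Proof.
elim: E => [|E IH].
  move=> N d; exists N, ((2 ^ N + d.+1 ^ N) * 2 * 2 ^ N)%N => F X P f e e0 e1.
  move=> [XN dP f1 HX] XE eX; right; apply: (linear_control e0 e1 XN f1 _ dP _ XE _ eX).
  - by move=> u /HX[].
  - by move=> u /HX[].
  - by move=> u /HX[].
move=> N d.
have [s [a H]] := @controlled_nseq E.+1 E.+1 [::] isT isT (controlled_nil IH) N N d.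
exists s, a => F X P f e e0 e1 adm XE eX; apply: (H F X P f e) => //.
have [XN _ _ _] := adm.
exists ([seq (E.+1, u.1) | u <- X] ++ nseq (N - size X) (E.+1, P)); split => //.
- rewrite cats0 map_cat -map_comp map_nseq /= (eq_map (g := fun=> E.+1))//.
  by rewrite map_cst -nseqD subnKC.
- move=> u uX; right; exists (E.+1, u.1); last first.
    by change (fdeg E.+1 (u.1 - u.1)); rewrite subrr; exact: fdeg0.
  by rewrite mem_cat map_f.
- have cP c : c \in [seq (E.+1, u.1) | u <- X] ++ nseq (N - size X) (E.+1, P) ->
      c.1 = E.+1 /\ fdeg E.+2 (c.2 - P).
    rewrite mem_cat => /orP[/mapP[u uX ->]|]; first by split => //; exact: XE.
    rewrite mem_nseq => /andP[_ /eqP->]; split => //.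
    by change (fdeg E.+2 (P - P)); rewrite subrr; exact: fdeg0.
  move=> c c' /cP[-> H1] /cP[_ H2] _.
  by apply: eq_fdegP (fdegB H1 H2) _; apply/funext => y /=; rewrite !fctE; ring.
Qed.

(** A polynomial of degree [d] has degree at most [d] in the sense of [fdeg], so
    that every admissible family has bounded diameter. *)
Theorem gowers_control N d : exists s a : nat,
  forall (F : finFieldType) X P f (e : R), 0 < e -> e <= 1 / 2 ->
    @admissible F N d X P f -> e <= normc (average X P f) ->
    #|F|%:R * e ^+ a <= 1 \/ e ^+ a <= gowers s f.
Proof.
have [s [a H]] := controlled_within d N d.
exists s, a => F X P f e e0 e1 adm eX; apply: (H F X P f e) => // u uX.
have [_ dP _ /(_ u uX)[du _ _]] := adm.
exact/fdegS/poly_map_fdeg/poly_mapB.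
Qed.
End PET.

(** * Additive characters *)

Section Character.
Context {R : realType} {F : finFieldType}.
Local Notation C := R[i].

(** [psi] is x |-> zeta ^ (trace of x) for a primitive p-th root of unity zeta: a
    unitary character with the same kernel as the trace. *)
Record trace_char (p k : nat) (psi : F -> C) : Prop := TraceChar {
  tc_prime : prime p;
  tc_pchar : p \in [pchar F];
  tc_card : #|F| = (p ^ k)%N;
  tc_add : forall x y, psi (x + y) = psi x * psi y;
  tc_norm : forall x, normc (psi x) = 1;
  tc_ker : forall x, psi x = 1 <-> \sum_(j < k) x ^+ (p ^ j) = 0 }.

Context {p k : nat} {psi : F -> C} (tc : trace_char p k psi).
Let p_pr := tc_prime tc.
Let charFp := tc_pchar tc.

Lemma psi_neq0 x : psi x != 0.
Proof. by apply/eqP => x0; have := tc_norm tc x; rewrite x0 normc0 => /eqP; rewrite eq_sym oner_eq0. Qed.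

Lemma psi0 : psi 0 = 1.
Proof. by apply: (mulfI (psi_neq0 0)); rewrite -(tc_add tc) addr0 mulr1. Qed.

Lemma psiN x : psi (- x) = ((psi x)^*)%C.
Proof.
apply: (mulfI (psi_neq0 x)); rewrite -(tc_add tc) subrr psi0 -sqr_normcE.
by rewrite (tc_norm tc) expr1n.
Qed.

Lemma psiB x y : psi (x - y) = psi x * ((psi y)^*)%C.
Proof. by rewrite (tc_add tc) psiN. Qed.

Lemma psi_sum I (r : seq I) (P : pred I) (f : I -> F) :
  psi (\sum_(i <- r | P i) f i) = \prod_(i <- r | P i) psi (f i).
Proof. exact: (big_morph _ (tc_add tc) psi0). Qed.

Lemma psiB1 x y : psi (x - y) = 1 <-> psi x = psi y.
Proof.
split=> [H|H]; last by rewrite psiB H -sqr_normcE (tc_norm tc) expr1n.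
by rewrite -(subrK y x) (tc_add tc) H mul1r.
Qed.

Lemma sum_expp I (r : seq I) (P : pred I) (f : I -> F) j :
  (\sum_(i <- r | P i) f i) ^+ (p ^ j) = \sum_(i <- r | P i) f i ^+ (p ^ j).
Proof.
apply: (big_morph (fun x => x ^+ (p ^ j))) => [x y|].
  by rewrite exprDn_pchar// (eq_pnat _ (pcharf_eq charFp)) pnatX pnat_id.
by rewrite expr0n expn_eq0 eqn0Ngt prime_gt0.
Qed.

Lemma expf_card_pk (x : F) : x ^+ (p ^ k) = x.
Proof. by rewrite -(tc_card tc) expf_card. Qed.

(** The trace does not change under Frobenius: the sum telescopes. *)
Lemma psi_frob x j : psi (x ^+ (p ^ j)) = psi x.
Proof.
elim: j => [|j IH]; first by rewrite expr1.
rewrite -[RHS]IH; apply/psiB1/(tc_ker tc); set z := x ^+ (p ^ j).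
rewrite expnSr exprM -/z.
rewrite (eq_bigr (fun i : 'I_k => z ^+ (p ^ i.+1) - z ^+ (p ^ i))) => [|i _].
  rewrite -(big_mkord xpredT (fun i => z ^+ (p ^ i.+1) - z ^+ (p ^ i))) telescope_sumr//.
  by rewrite expf_card_pk expr1 subrr.
have pi : [pchar F].-nat (p ^ i)%N by rewrite (eq_pnat _ (pcharf_eq charFp)) pnatX pnat_id.
by rewrite exprDn_pchar// exprNn_pchar// -exprM expnS.
Qed.

Lemma k_gt0 : (0 < k)%N.
Proof.
by rewrite lt0n; apply/eqP => k0; have := finNzRing_gt1 F; rewrite (tc_card tc) k0.
Qed.

(** The trace is a polynomial of degree p^(k-1) with leading coefficient 1, so it
    does not vanish on a field with p^k elements. *)
Lemma psi_nontrivial : exists x, psi x != 1.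
Proof.
apply/not_existsP => H.
pose T : {poly F} := \sum_(j < k) 'X^(p ^ j).
have sT : (size T <= (p ^ k.-1).+1)%N.
  rewrite (leq_trans (size_sum _ _ _))//; apply/bigmax_leqP => j _.
  by rewrite size_polyXn ltnS leq_pexp2l ?prime_gt0// -ltnS prednK ?k_gt0.
have : T`_1 = 0.
  suff -> : T = 0 by rewrite coef0.
  apply/eqP/contraT => T0; have := max_poly_roots T0 (rs := enum F).
  rewrite enum_uniq -cardE (tc_card tc) => /(_ _ isT) H1.
  have : (p ^ k < size T)%N.
    apply: H1; apply/allP => x _; rewrite /root horner_sum; apply/eqP.
    under eq_bigr do rewrite hornerXn.
    by apply/(tc_ker tc)/eqP; have := H x; case: eqP.
  move=> /leq_trans /(_ sT); rewrite ltnS leq_exp2l ?prime_gt1//.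
  by rewrite -ltnS prednK ?ltnn ?k_gt0.
rewrite coef_sum; case: k k_gt0 => // k' _; rewrite big_ord_recl coefXn expn0 eqxx.
rewrite big1 => [|j _]; first by rewrite addr0 => /eqP; rewrite oner_eq0.
rewrite coefXn; case: eqP => // H1.
by have := ltn_exp2l 0 (bump 0 j) (prime_gt1 p_pr); rewrite -H1.
Qed.

Lemma avg_psi a : (EE x, psi (a * x)) = (a == 0)%:R.
Proof.
have [->|a0] := eqVneq a 0.
  rewrite (eq_avg (g := fun=> 1)) => [|x]; last by rewrite mul0r psi0.
  by rewrite (avg_cst (0 : F)).
have [x0 px0] := psi_nontrivial; set S := avg _.
have : S = psi x0 * S.
  rewrite /S {1}(avg_shift (a^-1 * x0)) -avgZ; apply: eq_avg => x.
  by rewrite mulrDr mulrA divff// mul1r (tc_add tc) mulrC.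
move/eqP; rewrite -subr_eq0 -{1}(mul1r S) -mulrBl mulf_eq0 subr_eq0 eq_sym.
by rewrite (negPf px0) => /eqP.
Qed.
End Character.

(** * Polynomial phases that are constant *)

Section Exponents.
Local Open Scope nat_scope.

(** The exponents up to [d] that are prime to [p] lie in different cyclotomic cosets
    modulo q - 1, and these cosets have full length [k]. *)
Lemma cyclotomic_exponents p k d s t j : prime p -> j < k ->
  2 * (d.+1 ^ 2) < p ^ k -> 0 < s <= d -> 0 < t <= d -> ~~ (p %| s) -> ~~ (p %| t) ->
  (s * p ^ j).-1 = t.-1 %[mod (p ^ k).-1] -> j = 0 /\ s = t.
Proof.
move=> p_pr jk dq /andP[s0 sd] /andP[t0 td] ps pt.
have p0 : 0 < p by exact: prime_gt0.
set q := p ^ k in dq *.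
have dq2 : 2 * d.+1 < q.
  by apply: leq_ltn_trans dq; rewrite leq_mul2l /= -{1}(expn1 d.+1) leq_pexp2l.
have tq : t.-1 < q.-1 by clear dq; lia.
rewrite (modn_small tq) => H.
set c := (s * p ^ j).-1 %/ q.-1.
have E : s * p ^ j + c = c * q + t.
  have := divn_eq (s * p ^ j).-1 q.-1; rewrite H -/c => E0.
  have x0 : 0 < s * p ^ j by rewrite muln_gt0 s0 expn_gt0 p0.
  have q0 : 0 < q by exact: leq_ltn_trans dq2.
  have cq : c <= c * q by rewrite leq_pmulr.
  move: E0; rewrite -(subn1 q) mulnBr muln1.
  move: (s * p ^ j) (c * q) x0 cq => x y x0 cq; clear -x0 cq t0; lia.
clearbody c; clear H.
have qE : q = p ^ (k - j) * p ^ j by rewrite -expnD subnK// ltnW.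
have p2 : 2 <= p ^ (k - j).
  by rewrite (leq_trans (prime_gt1 p_pr))// -{1}(expn1 p) leq_pexp2l// subn_gt0.
have cd : c <= d.
  rewrite leqNgt; apply/negP => dc.
  have xq : 2 * (s * p ^ j) <= d * q.
    by rewrite mulnCA leq_mul// qE leq_mul2r p2 orbT.
  have dcq : d.+1 * q <= c * q by rewrite leq_mul2r dc orbT.
  have c3 : 3 * c <= c * q.
    by rewrite mulnC leq_mul2l; apply/orP; right; clear -dq2; lia.
  move: E xq dcq c3; rewrite (mulSn d).
  move: (s * p ^ j) (c * q) (d * q) => x y z; clear -t0 dc dq2; lia.
have [j0|j0] := posnP j.
  split; first exact: j0.
  move: E; rewrite j0 expn0 muln1; case: (c) => [|c']; first by rewrite mul0n addn0.
  have c'q : c' <= c' * q by rewrite leq_pmulr// (leq_ltn_trans _ dq2).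
  rewrite mulSn; move: (c' * q) c'q => y; clear -sd dq2 t0; lia.
exfalso; have [ct|ct] := eqVneq c t.
  have : s * p ^ j = t * p ^ (k - j) * p ^ j.
    by apply/eqP; rewrite -mulnA -qE -(eqn_add2r c) E ct.
  move/eqP; rewrite eqn_pmul2r ?expn_gt0 ?p0// => /eqP sE.
  by move/negP: ps; apply; rewrite sE dvdn_mull// dvdn_exp// subn_gt0.
have pjd : p ^ j <= d.
  have : c = t %[mod p ^ j].
    have := congr1 (modn^~ (p ^ j)) E; rewrite qE mulnA.
    by rewrite -modnDml modnMl add0n -[in RHS]modnDml modnMl add0n.
  move=> /eqP; rewrite /= => H1.
  have [lct|lct|lct] := ltngtP c t; last by rewrite lct eqxx in ct.
    have : p ^ j %| t - c by rewrite -eqn_mod_dvd 1?ltnW// eq_sym.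
    by move=> /dvdn_leq; rewrite subn_gt0 => /(_ lct) /leq_trans; apply; exact: leq_trans (leq_subr _ _) _.
  have : p ^ j %| c - t by rewrite -eqn_mod_dvd 1?ltnW.
  by move=> /dvdn_leq; rewrite subn_gt0 => /(_ lct) /leq_trans; apply; exact: leq_trans (leq_subr _ _) _.
have sj : s * p ^ j <= d * d by exact: leq_mul.
have dd : d * d < d.+1 ^ 2 by rewrite -mulnn ltn_mul.
have c0 : c = 0.
  case: (c) E => // c'; rewrite mulSn.
  have c'q : c' <= c' * q by rewrite leq_pmulr// (leq_ltn_trans _ dq2).
  move: (s * p ^ j) (d * d) (d.+1 ^ 2) (c' * q) sj dd dq c'q => x y z w.
  clear -t0; lia.
move: E; rewrite c0 addn0 mul0n add0n => E.
by move/negP: pt; apply; rewrite -E dvdn_mull// dvdn_exp.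
Qed.
End Exponents.

Section NormalForm.
Context {R : realType} {F : finFieldType} {p k : nat} {psi : F -> R[i]}.
Context (tc : trace_char p k psi).
Let p_pr := tc_prime tc.
Let p0 : (0 < p)%N := prime_gt0 p_pr.

(** The trace of the sum is a polynomial in [y] that vanishes identically. Reduce
    the exponents modulo q - 1: the resulting polynomial has degree below q, hence
    is zero, and by [cyclotomic_exponents] its coefficient at y^s is [n s]. *)
Lemma reduced_trivial d (n : nat -> F) : (2 * (d.+1 ^ 2) < p ^ k)%N ->
  (forall y, psi (\sum_(s < d.+1 | ~~ (p %| s)%N) n s * y ^+ s) = 1) ->
  forall s : nat, (s <= d)%N -> ~~ (p %| s)%N -> n s = 0.
Proof.
move=> dq H t td pt; set q := (p ^ k)%N in dq *.
have qF : #|F| = q by exact: tc_card tc.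
have dq2 : (2 * d.+1 < q)%N.
  by apply: leq_ltn_trans dq; rewrite leq_mul2l /= -{1}(expn1 d.+1) leq_pexp2l.
have q1 : (0 < q.-1)%N by clear -dq2; lia.
have pos s : ~~ (p %| s)%N -> (0 < s)%N by case: s => //; rewrite dvdn0.
pose r e := ((e.-1) %% q.-1).+1.
have rE (y : F) e : (0 < e)%N -> y ^+ e = y ^+ r e.
  case: e => // e _; rewrite /r /=; have [->|y0] := eqVneq y 0; first by rewrite !expr0n.
  rewrite !exprS {1}(divn_eq e q.-1) exprD mulnC exprM.
  suff -> : y ^+ q.-1 = 1 by rewrite expr1n mul1r.
  by apply: (mulfI y0); rewrite -exprS prednK ?mulr1 -?qF ?expf_card//; lia.
pose G : {poly F} := \sum_(j < k) \sum_(s < d.+1 | ~~ (p %| s)%N)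
   (n s ^+ (p ^ j)) *: 'X^(r (s * p ^ j)%N).
have G0 : G = 0.
  apply/eqP/contraT => G0.
  have sG : (size G <= q)%N.
    rewrite (leq_trans (size_sum _ _ _))//; apply/bigmax_leqP => j _.
    rewrite (leq_trans (size_sum _ _ _))//; apply/bigmax_leqP => s _.
    rewrite (leq_trans (size_scale_leq _ _))// size_polyXn /r.
    move: (_ %% _)%N (ltn_pmod (s * p ^ j).-1 q1) => u; clear; lia.
  have := max_poly_roots G0 (rs := enum F); rewrite enum_uniq -cardE qF => H1.
  have : (q < size G)%N.
    apply: H1 => //; apply/allP => y _; rewrite /root horner_sum; apply/eqP.
    have /(tc_ker tc) E := H y; rewrite -[RHS]E; apply: eq_bigr => j _.
    rewrite (sum_expp tc) horner_sum; apply: eq_bigr => s ps.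
    by rewrite hornerZ hornerXn exprMn -exprM -rE// muln_gt0 pos// expn_gt0 p0.
  by rewrite ltnNge sG.
have k0 : (0 < k)%N by exact: k_gt0 tc.
have := congr1 (fun G : {poly F} => G`_t) G0; rewrite coef0 coef_sum.
have rP (j : 'I_k) (s : 'I_d.+1) : ~~ (p %| s)%N -> r (s * p ^ j)%N = t ->
    (j : nat) = 0%N /\ (s : nat) = t.
  move=> ps rt; apply: (cyclotomic_exponents p_pr (ltn_ord j) dq) => //.
  - by rewrite pos//= -ltnS ltn_ord.
  - by rewrite pos.
  - rewrite -rt /r /= modn_mod //.
rewrite (bigD1 (Ordinal k0))//= [X in _ + X]big1 ?addr0 => [|j j0]; last first.
  rewrite coef_sum big1// => s ps; rewrite coefZ coefXn; case: eqP => [rt|]; last by rewrite mulr0.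
  have [jE _] := rP j s ps (esym rt).
  by move: j0; rewrite -val_eqE /= jE eqxx.
rewrite coef_sum (bigD1 (Ordinal (td : (t < d.+1)%N)))//= big1 => [|s /andP[ps st]]; last first.
  rewrite coefZ coefXn; case: eqP => [rt|]; last by rewrite mulr0.
  have [_ sE] := rP (Ordinal k0) s ps (esym rt).
  by move: st; rewrite -val_eqE /= sE eqxx.
rewrite addr0 coefZ coefXn expn0 muln1 expr1 /r.
rewrite modn_small ?prednK ?pos// ?eqxx ?mulr1//.
have := pos _ pt; clear -td dq2; lia.
Qed.

(** The part of [n] prime to [p]. As [psi] is Frobenius invariant,
    [psi (c * y ^ (s * p ^ a))] only depends on [s] and on a Frobenius twist of
    [c]; [nform P s] collects the coefficients of [P] with the same [s]. *)
Definition pfree n := (n %/ p ^ logn p n)%N.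
Definition nform d (P : {poly F}) s : F :=
  \sum_(n < d.+1 | (0 < n)%N && (pfree n == s)) P`_n ^+ (p ^ (d - logn p n)).

Lemma pfreeE n : (0 < n)%N -> n = (pfree n * p ^ logn p n)%N.
Proof. by move=> n0; rewrite divnK// pfactor_dvdnn. Qed.

Lemma pfreeP n : (0 < n)%N -> ~~ (p %| pfree n)%N /\ (pfree n <= n)%N.
Proof.
move=> n0; split; last exact: leq_div.
apply/negP => H; have := pfactor_dvdn (logn p n).+1 p_pr n0.
by rewrite ltnn {2}(pfreeE n0) expnS dvdn_mul.
Qed.

Lemma psi_nform d (P : {poly F}) y : (size P <= d.+1)%N ->
  psi (P.[y] - P`_0) =
  psi (\sum_(s < d.+1 | ~~ (p %| s)%N) nform d P s * (y ^+ (p ^ d)) ^+ s).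
Proof.
move=> sP; rewrite (horner_coef_wide _ sP) big_ord_recl /= expr0 mulr1 addrC addKr.
rewrite (eq_bigl (fun s : 'I_d.+1 => ~~ (p %| s)%N))// !(psi_sum tc).
transitivity (\prod_(n < d.+1 | (0 < n)%N) psi (P`_n * y ^+ n)).
  by rewrite [RHS]big_mkcond big_ord_recl /= mul1r.
rewrite (partition_big (fun n : 'I_d.+1 => inord (pfree n) : 'I_d.+1)
  (fun s : 'I_d.+1 => ~~ (p %| s)%N)) /= => [|n n0]; last first.
  have [pn nn] := pfreeP n0; rewrite inordK// ltnS (leq_trans nn)// -ltnS ltn_ord//.
apply: eq_bigr => s ps; rewrite mulr_suml (psi_sum tc); apply: eq_big => n.
  case: (posnP n) => //= n0; have [pn nn] := pfreeP n0.
  by rewrite -val_eqE /= inordK// ltnS (leq_trans nn)// -ltnS ltn_ord.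
move=> /andP[n0 /eqP ns]; have [pn nn] := pfreeP n0.
have nd : (n <= d)%N by rewrite -ltnS ltn_ord.
have sE : s = pfree n :> nat.
  by rewrite -ns inordK// ltnS (leq_trans nn).
have lnd : (logn p n <= d)%N.
  rewrite (leq_trans _ nd)// (leq_trans _ (dvdn_leq n0 (pfactor_dvdnn p n)))// ltnW//.
  exact/ltn_expl/prime_gt1.
rewrite -[LHS](psi_frob tc _ (d - logn p n)) exprMn -!exprM; congr (psi (_ * _ ^+ _)).
by rewrite {1}(pfreeE n0) -mulnA -expnD subnKC// sE mulnC.
Qed.

Lemma frob_surj d (Y : F) : exists y, Y = y ^+ (p ^ d).
Proof.
have inj : injective (fun y : F => y ^+ (p ^ d)).
  elim: d => [|d IH] x y; first by rewrite !expr1.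
  rewrite expnSr !exprM => H; apply: IH; apply: (fmorph_inj (pFrobenius_aut (tc_pchar tc))).
  exact: H.
by have [g _ gK] := injF_bij inj; exists (g Y); rewrite gK.
Qed.

Lemma psi_constP d (P : {poly F}) : (2 * (d.+1 ^ 2) < p ^ k)%N -> (size P <= d.+1)%N ->
  (forall y, psi P.[y] = psi P.[0]) <->
  (forall s : nat, (s <= d)%N -> ~~ (p %| s)%N -> nform d P s = 0).
Proof.
move=> dq sP; have E y : psi P.[y] = psi P.[0] <-> psi (P.[y] - P`_0) = 1.
  by rewrite horner_coef0; have [H1 H2] := psiB1 tc P.[y] P`_0; split.
split=> [H|H y].
  apply: (reduced_trivial (n := nform d P) dq) => Y; have [y ->] := frob_surj d Y.
  by rewrite -(psi_nform y sP); apply/E.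
apply/E; rewrite (psi_nform y sP) big1 ?(psi0 tc)// => s ps.
by rewrite H ?mul0r// -ltnS ltn_ord.
Qed.

(** The phases that become constant after differencing by [h] are cut out by
    polynomial equations in [h]. *)
Lemma generic_psi_const d (P : {poly F}) (S : {set F}) :
  (2 * (d.+1 ^ 2) < p ^ k)%N -> (size P <= d.+1)%N -> (d * p ^ d < #|S|)%N ->
  (forall h, h \in S -> forall y, psi (P.[y + h] - P.[y]) = psi (P.[h] - P.[0])) ->
  forall h y, psi (P.[y + h] - P.[y]) = psi (P.[h] - P.[0]).
Proof.
move=> dq sP dS HS.
pose D h := \poly_(n < d.+1) (P^`N(n) - (P`_n)%:P).[h].
have DE h y : (D h).[y] = P.[y + h] - P.[y].
  rewrite horner_poly (addrC y h) (nderiv_taylor_wide _ sP); last exact: mulrC.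
  rewrite (horner_coef_wide _ sP) -sumrB; apply: eq_bigr => n _.
  by rewrite hornerD hornerN hornerC mulrBl.
have sD h : (size (D h) <= d.+1)%N by exact: size_poly.
pose M (s : nat) : {poly F} := \sum_(n < d.+1 | (0 < n)%N && (pfree n == s))
   (P^`N(n) - (P`_n)%:P) ^+ (p ^ (d - logn p n)).
have MD h s : nform d (D h) s = (M s).[h].
  rewrite /M horner_sum; apply: eq_bigr => n _; by rewrite coef_poly ltn_ord horner_exp.
have sM s : (size (M s) <= (d * p ^ d).+1)%N.
  rewrite (leq_trans (size_sum _ _ _))//; apply/bigmax_leqP => n _.
  rewrite (leq_trans (size_poly_exp_leq _ _))// ltnS leq_mul ?leq_pexp2l ?leq_subr//.
  suff : (size (P^`N(n) - (P`_n)%:P)%R <= d.+1)%N by case: (size _).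
  rewrite (leq_trans (size_polyD _ _))// size_polyN geq_max.
  rewrite (leq_trans (size_polyC_leq1 _))// andbT.
  apply/leq_sizeP => j dj; rewrite coef_nderivn nth_default ?mul0rn//.
  by rewrite (leq_trans sP)// (leq_trans dj)// leq_addl.
have M0 (s : nat) : (s <= d)%N -> ~~ (p %| s)%N -> forall h, (M s).[h] = 0.
  move=> sd ps; apply: (poly_map_zeros (d := (d * p ^ d)%N) (S := S)) => //.
    by exists (M s).
  move=> h hS; rewrite -MD; move: s sd ps; apply/psi_constP => // y.
  by rewrite !DE add0r HS.
move=> h y; rewrite -DE -[P.[h]]/(P.[h]) -{2}(add0r h) -DE; move: y.
by apply/(psi_constP dq (sD h)) => s sd ps; rewrite MD M0.
Qed.
End NormalForm.

(** * Weyl's inequality *)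

Section Weyl.
Context {R : realType}.

(** Induction on the degree by differencing. If the sum is large then, by the
    induction hypothesis, P(y + h) - P(y) has constant phase for many [h], hence
    for all [h] by [generic_psi_const]. Then [psi] of P(y) - P(0) is a character
    of the additive group, and a character with nonzero mean is trivial. *)
Theorem weyl_dichotomy (p d : nat) : exists a : nat,
  forall (F : finFieldType) k (psi : F -> R[i]) (P : {poly F}) (e : R),
    trace_char p k psi -> 0 < e -> e <= 1 / 2 -> (size P <= d.+1)%N ->
    e <= normc (EE y, psi P.[y]) ->
    #|F|%:R * e ^+ a <= 1 \/ forall y, psi P.[y] = psi P.[0].
Proof.
elim: d => [|d [a IH]].
  exists 0%N => F k psi P e _ _ _ sP _; right => y.
  by rewrite (size1_polyC sP) !hornerC.
pose K1 := (2 * d.+2 ^ 2)%N; pose K2 := (d.+1 * p ^ d.+1)%N.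
exists (3 * a + (3 + K2) + K1)%N => F k psi P e tc e0 e1 sP eP.
have small b : (b <= 3 * a + (3 + K2) + K1)%N -> #|F|%:R * e ^+ b <= 1 ->
    #|F|%:R * e ^+ (3 * a + (3 + K2) + K1) <= 1 by exact: small_le.
have [qK1|K1q] := leqP (p ^ k)%N K1.
  left; apply: (small K1); first exact: leq_addl.
  rewrite -[K1]add0n; apply: absorb => //.
  by rewrite expr0 mulr1 ler_nat (tc_card tc).
pose f y := psi P.[y].
have f1 x : normc (f x) <= 1 by rewrite (tc_norm tc).
pose S := [set h | e ^+ 2 / 2 <= normc (avg (dif f h))].
have Sbig : e ^+ 2 / 2 * #|F|%:R <= #|S|%:R.
  apply: popular; first by move=> h; apply: normc_avg_le1 => x; exact: dif_le1.
    by rewrite exprn_ge0// ltW.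
  apply: le_trans (normc_avg _); rewrite avg_dif normc_real ger0_norm ?sqr_ge0//.
  by rewrite lerXn2r ?nnegrE ?normc_ge0// ltW.
have e23 : e ^+ 3 <= e ^+ 2 / 2.
  by rewrite exprSr ler_wpM2l ?exprn_ge0 ?(ltW e0)//; lra.
have [SK|KS] := leqP #|S| K2.
  left; apply: (small (3 + K2)%N); first by rewrite -addnA (addnC (3 * a)%N) -addnA leq_addr.
  apply: absorb => //; apply: (le_trans _ (_ : #|S|%:R <= _)); last by rewrite ler_nat.
  by apply: le_trans Sbig; rewrite mulrC ler_wpM2r.
have [[h hS hP]|noh] := pselect (exists2 h, h \in S & #|F|%:R * (e ^+ 3) ^+ a <= 1).
  by left; apply: (small (3 * a)%N); [rewrite -addnA leq_addr | rewrite exprM].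
have HS h : h \in S -> forall y, psi (P.[y + h] - P.[y]) = psi (P.[h] - P.[0]).
  move=> hS; have [D sD DP] := poly_map_delta h (P := horner P) (ex_intro2 _ _ P sP (fun=> erefl)).
  have eD : e ^+ 3 <= normc (EE y, psi D.[y]).
    rewrite inE in hS; apply: le_trans e23 (le_trans hS _).
    rewrite -[leRHS]normcJ avgJ le_eqVlt; apply/orP; left; apply/eqP; congr normc.
    apply: eq_avg => y; rewrite -DP /delta (psiB tc) rmorphM /= conjcK mulrC.
    by rewrite /dif /f.
  have e30 : 0 < e ^+ 3 by rewrite exprn_gt0.
  have [H|H y] := IH F k psi D _ tc e30 (exp_le_half 2 e0 e1) sD eD.
    by case: noh; exists h.
  by have := H y; rewrite -!DP /delta add0r.
have HF := generic_psi_const (d := d.+1) tc K1q sP KS HS.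
right; pose th y := psi (P.[y] - P.[0]).
have thM x h : th (x + h) = th x * th h.
  by rewrite /th -[psi (P.[h] - _)](HF h x) -(tc_add tc); congr psi; ring.
suff th1 y : th y = 1 by move=> y; apply/(psiB1 tc)/th1.
apply: contrapT => thy; have : avg th = th y * avg th.
  by rewrite {1}(avg_shift y) -avgZ; apply: eq_avg => x; rewrite thM mulrC.
move/eqP; rewrite -subr_eq0 -{1}(mul1r (avg th)) -mulrBl mulf_eq0 subr_eq0 eq_sym.
case/orP => [/eqP//|/eqP th0]; move: eP.
rewrite (_ : avg _ = avg th * psi P.[0]).
  by rewrite th0 mul0r normc0 leNgt e0.
by rewrite -avgZr; apply: eq_avg => x; rewrite /th -(tc_add tc) subrK.
Qed.
End Weyl.

(** * Fourier analysis and removable phases *)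

Section DegreeLowering.
Context {R : realType} {F : finFieldType} {p r : nat} {psi : F -> R[i]}.
Context (tc : trace_char p r psi).
Local Notation C := R[i].
Implicit Types (f g : F -> C).
Let opp : nat -> F -> F := fun _ => -%R.

Let oppB i a b : opp i (a - b) = opp i a - opp i b.
Proof. by rewrite /opp opprD. Qed.

Definition fourier f b : C := EE x, (f x * psi (b * x)).

Lemma sum_psi z : \sum_b psi (b * z) = #|F|%:R * (z == 0)%:R.
Proof.
rewrite -(avg_psi tc z) /avg mulrA divff ?mul1r ?(card_neq0 (0 : F))//.
by apply: eq_bigr => b _; rewrite mulrC.
Qed.

Lemma parseval f : \sum_b normc (fourier f b) ^+ 2 = EE x, (normc (f x) ^+ 2).
Proof.
apply: (@complexI R); rewrite rmorph_sum avgC /=.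
transitivity (\sum_b EE x, EE y, (f x * (f y)^*%C * psi (b * (x - y)))).
  apply: eq_bigr => b _; rewrite normc_avg_sqr; apply: eq_avg => x; apply: eq_avg => y.
  by rewrite mulrBr (psiB tc) rmorphM mulrACA.
transitivity (EE x, EE y, (f x * (f y)^*%C * \sum_b psi (b * (x - y)))).
  rewrite {1}/avg -mulr_sumr exchange_big /=; congr (_ * _); apply: eq_bigr => x _.
  rewrite -mulr_sumr exchange_big /=; congr (_ * _); apply: eq_bigr => y _.
  by rewrite mulr_sumr.
apply: eq_avg => x.
under eq_avg => y do rewrite sum_psi subr_eq0.
rewrite /avg (bigD1 x)//= big1 => [|y yx]; last by rewrite eq_sym (negPf yx) !mulr0.
rewrite eqxx mulr1 addr0 sqr_normcE mulrCA mulVf ?mulr1//.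
exact: (card_neq0 (0 : F)).
Qed.

(** The Fourier coefficients of an autocorrelation are the squared moduli of those
    of the function. *)
Lemma fourier_autocorrelation f b :
  fourier (fun a => avg (dif f a)) b = ((normc (fourier f (- b)) ^+ 2)%:C)%C.
Proof.
rewrite normc_avg_sqr /fourier.
under eq_avg => a do rewrite -avgZr.
rewrite avg_exch; apply: eq_avg => x; rewrite [RHS](avg_shift x); apply: eq_avg => a.
rewrite /dif rmorphM -!mulrA; congr (_ * _); rewrite (addrC a x) mulrCA; congr (_ * _).
by rewrite -(psiB tc); congr psi; ring.
Qed.

(** The left side is the sum of the fourth powers of the Fourier coefficients,
    and the sum of their squares is at most 1. *)
Lemma u2_inverse f : (forall x, normc (f x) <= 1) ->
  exists b, (EE a, (normc (avg (dif f a)) ^+ 2)) <= normc (fourier f b) ^+ 2.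
Proof.
move=> f1; pose b0 := [arg max_(b > 0) normc (fourier f b)]%O.
have b0P b : normc (fourier f b) <= normc (fourier f b0).
  by rewrite /b0; case: Order.TotalTheory.arg_maxP => // i _; apply.
exists b0; rewrite -(parseval (fun a => avg (dif f a))).
under eq_bigr => b do rewrite fourier_autocorrelation normc_real ger0_norm ?sqr_ge0//.
apply: le_trans (_ : \sum_b normc (fourier f b0) ^+ 2 * normc (fourier f (- b)) ^+ 2 <= _).
  apply: ler_sum => b _; rewrite expr2 ler_wpM2r ?sqr_ge0//.
  by rewrite lerXn2r ?nnegrE ?normc_ge0.
rewrite -mulr_sumr -[leRHS]mulr1 ler_wpM2l ?sqr_ge0//.
have <- : \sum_b normc (fourier f b) ^+ 2 = \sum_b normc (fourier f (- b)) ^+ 2.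
  exact: (reindex_inj (@oppr_inj F)).
rewrite parseval.
apply: (avg_le_cst (0 : F)) => x; by rewrite exprn_ile1 ?normc_ge0.
Qed.

Lemma avg_lmap_opp (K : numFieldType) k (phi : seq F -> K) :
  avg (fun h : k.-tuple F => phi (lmap opp h)) = avg (fun h : k.-tuple F => phi h).
Proof.
elim: k phi => [|k IH] phi; first by rewrite (avg_nil (fun h => phi (lmap opp h))) avg_nil.
rewrite (avg_cons (fun h => phi (lmap opp h))) (avg_cons phi).
rewrite [RHS](avg_bij _ (h := -%R)); last by exists -%R; exact: opprK.
by apply: eq_avg => a; exact: (IH (fun h => phi (- a :: h))).
Qed.

(** Expanding the square introduces one more differencing parameter [t], and the
    phase becomes a product of factors [psi (- (ph i h * t))], each missing [h_i].
    The box Cauchy--Schwarz inequality removes them together with all vertices of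
    the cube but one. *)
Lemma split_phases k f (ph : nat -> seq F -> F) (e : R) :
  (forall x, normc (f x) <= 1) -> (forall i, indep 0 i (ph i)) -> 0 <= e ->
  e <= (EE h : k.-tuple F, (normc (fourier (difs h f) (\sum_(i < k) ph i h)) ^+ 2)) ->
  e ^+ (2 ^ k) <= gowers k f.
Proof.
move=> f1 phi e0 H.
pose g (z : F * F) h := dif f z.2 (z.1 + lsum opp h).
pose B i (z : F * F) h := far (dif f z.2) h z.1 i * psi (- (ph i h * z.2)).
have B1 i z h : normc (B i z h) <= 1.
  by rewrite normcM_le1 ?far_le1 ?(tc_norm tc)//; exact: dif_le1.
have Bi i z : indep 0 i (B i z).
  by move=> h h' hh' E; rewrite /B (phi i _ _ hh' E); congr (_ * _); exact: far_indep hh' E.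
have := box_cauchy_schwarz k g B1 Bi.
have -> : (EE z : F * F, EE u : k.-tuple F, EE v : k.-tuple F, cube k (g z) u v) =
    ((gowers k f)%:C)%C.
  rewrite avg_pair avg_exch -gowersE; apply: eq_avg => t.
  rewrite (avg_cube k (dif f t) oppB).
  exact: (avg_lmap_opp k (fun l => EE x, difs l (dif f t) x)).
rewrite normc_real ger0_norm ?gowers_ge0//; apply: le_trans.
rewrite lerXn2r ?nnegrE ?normc_ge0//; apply: le_trans H _.
rewrite -[leLHS]ger0_norm; last by apply: avg_ge0 => h; exact: sqr_ge0.
rewrite -normc_real avgC le_eqVlt; apply/orP; left; apply/eqP; congr normc.
rewrite avg_pair [RHS]avg_exch.
transitivity (EE h : k.-tuple F, EE t, EE x,
   (g (x, t) h * \prod_(i < k) B i (x, t) h)); last first.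
  by rewrite [LHS]avg_exch; apply: eq_avg => t; rewrite [LHS]avg_exch.
apply: eq_avg => h; rewrite normc_avg_sqr.
transitivity (EE x, EE t, (dif (difs h f) t x * psi (- (\sum_(i < k) ph i h * t)))).
  apply: eq_avg => x; rewrite (avg_shift x); apply: eq_avg => t.
  rewrite /dif rmorphM -!mulrA; congr (_ * _); rewrite (addrC t x) mulrCA; congr (_ * _).
  by rewrite -(psiB tc) -mulr_suml; congr psi; ring.
rewrite avg_exch; apply: eq_avg => t; rewrite (avg_shift (lsum opp h)); apply: eq_avg => x.
rewrite -difs_dif difs_far size_tuple /g /B big_split mulrA; congr (_ * _).
by rewrite -sumrN (psi_sum tc).
Qed.

(** The additive counterpart of [cube]. *)
Fixpoint acube k (Phi : seq F -> F) (u v : seq F) : F :=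
  match k, u, v with
  | k'.+1, a :: u', b :: v' => acube k' (fun h => Phi (a :: h) - Phi (b :: h)) u' v'
  | _, _, _ => Phi [::]
  end.

Lemma acubeB k A B u v : acube k (fun h => A h - B h) u v = acube k A u v - acube k B u v.
Proof.
elim: k A B u v => [|k IH] A B [|a u] [|b v] //=; rewrite -IH.
by congr acube; apply/funext => h; ring.
Qed.

Lemma acubeD k A B u v : acube k (fun h => A h + B h) u v = acube k A u v + acube k B u v.
Proof.
elim: k A B u v => [|k IH] A B [|a u] [|b v] //=; rewrite -IH.
by congr acube; apply/funext => h; ring.
Qed.

Lemma acubeMr k A x u v : acube k (fun h => A h * x) u v = acube k A u v * x.
Proof.
elim: k A u v => [|k IH] A [|a u] [|b v] //=; rewrite -IH.
by congr acube; apply/funext => h; ring.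
Qed.

Lemma cube_psi k A u v : cube k (fun h => psi (A h)) u v = psi (acube k A u v).
Proof.
elim: k A u v => [|k IH] A [|a u] [|b v] //=; rewrite -IH.
by congr cube; apply/funext => h; rewrite (psiB tc).
Qed.

(** [acube k Phi u v] differs from [Phi u] by terms missing a coordinate of [u]. *)
Fixpoint others k (Phi : seq F -> F) (v : seq F) (i : nat) (u : seq F) : F :=
  match k, v, u with
  | k'.+1, b :: v', a :: u' =>
      if i is i'.+1 then others k' (fun h => Phi (a :: h)) v' i' u'
      else acube k' (fun h => Phi (b :: h)) u' v'
  | _, _, _ => 0
  end.

Lemma acube_others k Phi (u v : k.-tuple F) :
  acube k Phi u v = Phi u - \sum_(i < k) others k Phi v i u.
Proof.
elim: k Phi u v => [|k IH] Phi [[|a u] su] [[|b v] sv] //=.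
  by rewrite big_ord0 subr0.
have uk : size u == k by []. have vk : size v == k by [].
rewrite acubeB (IH _ (Tuple uk) (Tuple vk)) big_ord_recl /=.
by rewrite opprD addrA addrAC.
Qed.

Lemma others_indep k Phi v i : indep 0 i (others k Phi v i).
Proof.
move=> h; elim: k Phi v i h => [|k IH] Phi [|b v] i [|a h] [|a' h'] //= [hh'] e.
case: i e => [|i] e.
  suff -> : h = h' by [].
  by apply: (@eq_from_nth _ 0) => // j _; exact: (e j.+1).
have -> : a = a' by exact: (e 0).
by apply: IH => // j ji; exact: (e j.+1).
Qed.
End DegreeLowering.

(** * Degree lowering *)

Section DegreeLoweringStep.
Context {R : realType}.
Local Notation C := R[i].
Local Notation opp := (fun _ : nat => -%R).

Lemma avg_large (T : finType) (x0 : T) (f : T -> R) d : d <= avg f -> exists x, d <= f x.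
Proof.
move=> df; pose m := [arg max_(x > x0) f x]%O; exists m; apply: le_trans df _.
by apply: (avg_le_cst x0) => x; rewrite /m; case: Order.TotalTheory.arg_maxP => // i _; apply.
Qed.

Lemma difs_cst (F : finFieldType) l (c : C) :
  exists2 c' : C, normc c <= 1 -> normc c' <= 1 & difs l (fun _ : F => c) = fun=> c'.
Proof.
elim: l c => [|a l IH] c; first by exists c.
have [c' c'1 E] := IH (c * (c^*)%C); exists c' => [c1|]; last exact: E.
by apply: c'1; rewrite normcM_le1 ?normcJ.
Qed.

Context {F : finFieldType} {p r : nat} {psi : F -> C} (tc : trace_char p r psi).
Implicit Types (f : F -> C) (g : F -> F -> C).

(** The correlation, with weights [c] and phases [Phi], of iterated differences in
    which the factor at one vertex has been replaced by the average over [y] of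
    [g y]. *)
Definition dual_sum k f g (c : seq F -> C) (Phi : seq F -> F) : C :=
  EE h : k.-tuple F, (c h * EE x, EE y, (g y (x + lsum opp h) *
    (psi (Phi h * (x + lsum opp h)) * \prod_(i < k) far f h x i))).

(** The average over [y] is kept outside Cauchy--Schwarz, so that all vertices of
    the final cube carry the same [y]. *)
Lemma dual_difference k f g c Phi :
  (forall x, normc (f x) <= 1) ->
  normc (dual_sum k f g c Phi) ^+ (2 ^ k) <=
  EE u : k.-tuple F, EE v : k.-tuple F, (normc (cube k c u v) *
    normc (EE y, fourier (psi := psi) (difs (ldif opp u v) (g y)) (acube k Phi u v))).
Proof.
move=> f1; pose G (z : F * F) h := c h *
  (psi (Phi h * (z.1 + lsum opp h)) * g z.2 (z.1 + lsum opp h)).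
pose B i (z : F * F) h := far f h z.1 i.
have B1 i z h : normc (B i z h) <= 1 by exact: far_le1.
have Bi i z : indep 0 i (B i z) by exact: far_indep.
have -> : dual_sum k f g c Phi =
    EE z, EE h : k.-tuple F, (G z h * \prod_(i < k) B i z h).
  rewrite avg_pair; transitivity (EE h : k.-tuple F, EE x, EE y,
      (G (x, y) h * \prod_(i < k) B i (x, y) h)).
    apply: eq_avg => h; rewrite -avgZ; apply: eq_avg => x; rewrite -avgZ; apply: eq_avg => y.
    by rewrite /G /= -!mulrA; congr (_ * _); rewrite mulrCA.
  by rewrite [LHS]avg_exch; apply: eq_avg => x; rewrite [LHS]avg_exch.
apply: le_trans (box_cauchy_schwarz k G B1 Bi) _.
rewrite avg_exch; apply: le_trans (normc_avg _) _; apply: ler_avg => u.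
rewrite avg_exch; apply: le_trans (normc_avg _) _; apply: ler_avg => v.
set b := acube k Phi u v; set l := ldif opp u v.
pose A0 := acube k (fun h => Phi h * lsum opp h) u v - b * lsum opp u.
suff -> : (EE z, cube k (G z) u v) =
    cube k c u v * (psi A0 * EE y, fourier (psi := psi) (difs l (g y)) b).
  by rewrite !normcM (tc_norm tc) mul1r.
rewrite avg_pair -avgZ -avgZ avg_exch; apply: eq_avg => y.
rewrite /fourier -avgZ -avgZ [RHS](avg_shift (lsum opp u)); apply: eq_avg => x.
rewrite /G !cubeM (cube_psi tc) (cube_difs (g y) opp x u v) -/l /=.
congr (_ * _); rewrite mulrCA mulrC -(tc_add tc); congr (_ * psi _).
rewrite (_ : (fun h => Phi h * (x + lsum opp h)) =
   (fun h => Phi h * x + Phi h * lsum opp h)); last by apply/funext => h; ring.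
by rewrite acubeD acubeMr -/b /A0; ring.
Qed.

(** By hypothesis on [g] the alternating sum of the phases vanishes on many boxes.
    Fixing one vertex [v] shows that [Phi] coincides on a large set with a sum of
    functions each missing one parameter, and [split_phases] applies. *)
Lemma dual_lowering k a0 f g c Phi (e : R) : 0 < e -> e <= 1 / 2 ->
  (forall x, normc (f x) <= 1) -> (forall y x, normc (g y x) <= 1) ->
  (forall h, normc (c h) <= 1) ->
  (forall h, c h != 0 -> e / 2 <= normc (fourier (psi := psi) (difs h f) (Phi h)) ^+ 2) ->
  (forall l b (d : R), size l = k -> b != 0 -> 0 < d -> d <= 1 / 2 ->
     d <= normc (EE y, fourier (psi := psi) (difs l (g y)) b) ->
     #|F|%:R * d ^+ a0 <= 1) ->
  e / 2 <= normc (dual_sum k f g c Phi) ->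
  #|F|%:R * e ^+ ((2 * 2 ^ k).+1 * a0) <= 1 \/ e ^+ (((2 * 2 ^ k).+1 + 2) * 2 ^ k) <= gowers k f.
Proof.
move=> e0 e1 f1 g1 c1 cH Hg; set S := dual_sum _ _ _ _ _ => eS.
have ee : e ^+ 2 <= e / 2 by rewrite expr2 ler_wpM2l ?(ltW e0)//; lra.
set b := (2 * 2 ^ k).+1.
pose val (z : k.-tuple F * k.-tuple F) := normc (cube k c z.1 z.2) *
    normc (EE y, fourier (psi := psi) (difs (ldif opp z.1 z.2) (g y)) (acube k Phi z.1 z.2)).
have fou1 (f' : F -> C) z : (forall x, normc (f' x) <= 1) -> normc (fourier (psi := psi) f' z) <= 1.
  by move=> f'1; apply: normc_avg_le1 => x; rewrite normcM (tc_norm tc) mulr1.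
have val1 z : val z <= 1.
  rewrite mulr_ile1 ?normc_ge0 ?normc_cube// normc_avg_le1// => y.
  by apply: fou1 => x; apply: difs_le1.
pose E := (e / 2) ^+ (2 ^ k).
have E0 : 0 <= E by rewrite exprn_ge0// divr_ge0// ltW.
have eE : e ^+ b <= E / 2.
  rewrite /b exprSr exprM ler_pM ?exprn_ge0 ?(ltW e0)//; last by rewrite -[leRHS]mul1r.
  by rewrite lerXn2r ?nnegrE ?exprn_ge0 ?divr_ge0 ?(ltW e0).
have EV : E <= avg val.
  rewrite avg_pair; apply: le_trans (dual_difference k g c Phi f1).
  by rewrite lerXn2r ?nnegrE ?normc_ge0 ?divr_ge0// ltW.
have := popular val1 E0 EV; set T0 := [set z | E / 2 <= val z] => T0big.
have T0P z : z \in T0 -> c z.1 != 0 /\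
    e ^+ b <= normc (EE y, fourier (psi := psi) (difs (ldif opp z.1 z.2) (g y)) (acube k Phi z.1 z.2)).
  rewrite inE => /(le_trans eE); rewrite /val; set w := normc (cube _ _ _ _); set w' := normc _ => H.
  have w0 : w != 0.
    by apply: contraTneq H => ->; rewrite mul0r -ltNge exprn_gt0.
  split.
    by apply: (@cube_neq0 _ _ k _ z.1 z.2); apply: contraNneq w0; rewrite /w => ->; rewrite normc0.
  apply: le_trans H _; rewrite ler_piMl ?normc_ge0//; exact: normc_cube.
have [[z zT zb]|nob] := pselect (exists2 z, z \in T0 & acube k Phi z.1 z.2 != 0).
  left; have [_ Hz] := T0P z zT.
  rewrite exprM; apply: (Hg _ _ _ _ zb _ _ Hz); first exact: size_ldif.
    by rewrite exprn_gt0.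
  exact: exp_le_half.
right; pose t0 : k.-tuple F := [tuple of nseq k 0].
have [v Hv] : exists v, e ^+ b <= EE u : k.-tuple F, (((u, v) \in T0)%:R : R).
  apply: (avg_large t0); rewrite avg_exch -(avg_pair (fun z => (z \in T0)%:R)).
  apply: le_trans eE _; rewrite /avg [leRHS]mulrC ler_pdivlMr; last first.
    by rewrite lt0r (card_neq0 (t0, t0)) ler0n.
  apply: le_trans T0big _; rewrite -sum1_card natr_sum big_mkcond.
  by apply: ler_sum => z _; case: (z \in T0).
rewrite exprM; apply: (split_phases tc f1 (ph := fun i => others k Phi v i)).
- by move=> i; exact: others_indep.
- by rewrite exprn_ge0// ltW.
rewrite exprD; apply: le_trans (ler_pM _ _ Hv ee) _; rewrite ?exprn_ge0 ?(ltW e0)//.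
rewrite -avgZr; apply: ler_avg => u.
have [uT|_] := boolP (_ \in T0); last by rewrite mul0r sqr_ge0.
have [cu _] := T0P _ uT; rewrite mul1r (_ : \sum_(i < k) _ = Phi u); first exact: cH.
apply/eqP; rewrite eq_sym -subr_eq0 -acube_others.
by apply/contraT => ub; case: nob; exists (u, v).
Qed.

(** The phases [Phi] come from the inverse theorem for the norm of order two,
    applied to the iterated differences of [f]. The mean [c0] subtracted from the
    dual function is treated as another dual function, one for which the
    hypothesis on [g] holds because nontrivial characters have mean zero. *)
Lemma degree_lowering k a0 (f : F -> C) g c0 (e : R) : 0 < e -> e <= 1 / 2 ->
  (forall y x, normc (g y x) <= 1) -> normc c0 <= 1 ->
  f =1 (fun x => 2^-1 * ((EE y, g y x) - c0)) ->
  (forall l b (d : R), size l = k -> b != 0 -> 0 < d -> d <= 1 / 2 ->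
     d <= normc (EE y, fourier (psi := psi) (difs l (g y)) b) ->
     #|F|%:R * d ^+ a0 <= 1) ->
  e <= gowers k.+1 f ->
  #|F|%:R * e ^+ ((2 * 2 ^ k).+1 * a0) <= 1 \/ e ^+ (((2 * 2 ^ k).+1 + 2) * 2 ^ k) <= gowers k f.
Proof.
move=> e0 e1 g1 c01 fE Hg eU.
have n2 : normc (2^-1 : C) = 2^-1.
  by rewrite normcV -(rmorph_nat (real_complex R)) normc_real ger0_norm.
have f1 x : normc (f x) <= 1.
  rewrite fE normcM n2 ler_pdivrMl// mulr1.
  apply: le_trans (le_normcD _ _) _; rewrite normcN -[2]/(1 + 1).
  by rewrite lerD// normc_avg_le1.
have [Phi PhiP] := choice (fun h => u2_inverse tc (difs_le1 h f1)).
pose Z h := fourier (psi := psi) (difs h f) (Phi h).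
(* Only the differences with a large Fourier coefficient are kept, and the weight
   makes the terms of the correlation nonnegative. *)
pose c h : C := if e / 2 <= normc (Z h) ^+ 2 then ((Z h)^*)%C else 0.
have Z1 h : normc (Z h) <= 1.
  by apply: normc_avg_le1 => x; rewrite normcM (tc_norm tc) mulr1 difs_le1.
have c1 h : normc (c h) <= 1.
  by rewrite /c; case: ifP => _; rewrite ?normcJ ?normc0.
have cH h : c h != 0 -> e / 2 <= normc (Z h) ^+ 2.
  by rewrite /c; case: ifP => //; rewrite eqxx.
have ZE h (s : k.-tuple F) : h = s :> seq F -> Z h = EE x, (f (x + lsum opp h) *
    (psi (Phi h * (x + lsum opp h)) * \prod_(i < k) far f h x i)).
  move=> hs; rewrite /Z /fourier (avg_shift (lsum opp h)); apply: eq_avg => x.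
  by rewrite difs_far hs size_tuple mulrAC mulrA.
pose S := EE h : k.-tuple F, (c h * Z h).
have eS : e / 2 <= normc S.
  have -> : S = ((EE h : k.-tuple F, (if e / 2 <= normc (Z h) ^+ 2 then normc (Z h) ^+ 2 else 0))%:C)%C.
    rewrite avgC; apply: eq_avg => h; rewrite /c; case: ifP => _; last by rewrite mul0r.
    by rewrite sqr_normcE mulrC.
  rewrite normc_real ger0_norm; last first.
    by apply: avg_ge0 => h; case: ifP => // _; exact: sqr_ge0.
  have t0 : k.-tuple F := [tuple of nseq k 0].
  have : e <= EE h : k.-tuple F,
      ((if e / 2 <= normc (Z h) ^+ 2 then normc (Z h) ^+ 2 else 0) + e / 2).
    apply: le_trans eU _; rewrite gowersS; apply: ler_avg => h.
    apply: le_trans (PhiP h) _; rewrite -/(Z h); case: (leP (e / 2)) => H.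
      by rewrite lerDl divr_ge0// ltW.
    by rewrite add0r ltW.
  rewrite avgD (avg_cst t0); lra.
have SE : S = 2^-1 * (dual_sum k f g c Phi - dual_sum k f (fun _ _ => c0) c Phi).
  rewrite /S /dual_sum -avgB -avgZ; apply: eq_avg => h.
  rewrite (ZE _ h)// -mulrBr [RHS]mulrCA; congr (_ * _).
  rewrite -avgB -avgZ; apply: eq_avg => x; rewrite fE -mulrA; congr (_ * _).
  by rewrite avgZr (avg_cst (0 : F)) mulrBl.
have [S1|S2] : e / 2 <= normc (dual_sum k f g c Phi) \/
    e / 2 <= normc (dual_sum k f (fun _ _ => c0) c Phi).
  apply/orP; rewrite -implyNb; apply/implyP; rewrite -ltNge => S1.
  rewrite leNgt; apply/negP => S2.
  have := le_normcD (dual_sum k f g c Phi) (- dual_sum k f (fun _ _ => c0) c Phi).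
  rewrite normcN; move: eS; rewrite SE normcM n2; lra.
- exact: (dual_lowering e0 e1 f1 g1 c1 cH Hg S1).
apply: (dual_lowering e0 e1 f1 _ c1 cH _ S2) => // l b d _ b0 d0 _ H; exfalso.
have [c' _ E] := @difs_cst F l c0; move: H; rewrite leNgt => /negP; apply.
rewrite (_ : (EE y : F, _) = 0) ?normc0//.
rewrite -[RHS](avg_cst (0 : F)); apply: eq_avg => y.
by rewrite /fourier E avgZ (avg_psi tc) (negPf b0) mulr0.
Qed.
End DegreeLoweringStep.

(** * Joint averages: set-up and the case of characters *)

Section Joint.
Context {R : realType}.
Local Notation C := R[i].

Definition lam (F : finFieldType) m (P : 'I_m -> F -> F) (f0 : F -> C) (f : 'I_m -> F -> C) : C :=
  EE x, EE y, (f0 x * \prod_i f i (x + P i y)).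

(** No nontrivial character of the product group is constant along [P]. *)
Definition independent (F : finFieldType) m (psi : F -> C) (P : 'I_m -> F -> F) :=
  forall a : 'I_m -> F,
    (forall y, psi (\sum_i a i * P i y) = psi (\sum_i a i * P i 0)) -> forall i, a i = 0.

(** Constant multiples are allowed because differencing turns a character into a
    constant. *)
Definition charlike (F : finFieldType) (psi : F -> C) (f : F -> C) :=
  exists c b, normc c <= 1 /\ forall x, f x = c * psi (b * x).

Section OneField.
Context {F : finFieldType}.
Implicit Types (f g : F -> C).

Lemma difsM l f g x : difs l (fun x => f x * g x) x = difs l f x * difs l g x.
Proof.
elim: l f g x => //= a l IH f g x; rewrite -IH; congr (difs _ _ _).
by apply/funext => z; rewrite /dif rmorphM mulrACA.
Qed.

Lemma difs_shift l f s x : difs l (fun x => f (x + s)) x = difs l f (x + s).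
Proof.
elim: l f x => //= a l IH f x; rewrite -IH; congr (difs _ _ _).
by apply/funext => z; rewrite /dif addrAC.
Qed.

Lemma difs_conj l f : difs l (conjf f) = conjf (difs l f).
Proof.
elim: l f => //= a l IH f; rewrite -IH; congr (difs _ _).
by apply/funext => z; rewrite /dif /conjf rmorphM.
Qed.

Lemma gowers_conj k f : gowers k (conjf f) = gowers k f.
Proof.
apply: eq_avg => h; rewrite difs_conj; congr (_ ^+ 2).
by rewrite -[RHS]normcJ avgJ.
Qed.

Context {p r : nat} {psi : F -> C} (tc : trace_char p r psi).

Lemma charlike_difs l f : charlike psi f -> charlike psi (difs l f).
Proof.
elim: l f => //= a l IH f [c [b [c1 fE]]]; apply: IH.
exists (c * (c^*)%C * ((psi (b * a))^*)%C), 0; split.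
  by rewrite !normcM_le1 ?normcJ ?(tc_norm tc).
move=> x; have E : psi (b * x) * ((psi (b * x))^*)%C = 1.
  by rewrite -sqr_normcE (tc_norm tc) expr1n.
rewrite /dif !fE mul0r (psi0 tc) mulr1 mulrDr (tc_add tc) !rmorphM /=.
by rewrite -[RHS]mulr1 -E; ring.
Qed.

Lemma independent_nonconstant m (P : 'I_m -> F -> F) : independent psi P ->
  (forall i, ~ fdeg 0 (P i)) /\ (forall i j, i != j -> ~ fdeg 0 (P i - P j)).
Proof.
move=> iP; have D y l : \sum_k (k == l)%:R * P k y = P l y.
  by rewrite (bigD1 l)//= eqxx mul1r big1 ?addr0// => k /negPf ->; rewrite mul0r.
split=> [i Pi|i j ij Pij].
  have /iP/(_ i) : forall y, psi (\sum_k (k == i)%:R * P k y) = psi (\sum_k (k == i)%:R * P k 0).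
    by move=> y; rewrite !D (Pi y 0).
  by rewrite eqxx => /eqP; rewrite oner_eq0.
have E y : \sum_k ((k == i)%:R - (k == j)%:R) * P k y = P i y - P j y.
  by under eq_bigr do rewrite mulrBl; rewrite sumrB !D.
have /iP/(_ i) : forall y, psi (\sum_k ((k == i)%:R - (k == j)%:R) * P k y) =
    psi (\sum_k ((k == i)%:R - (k == j)%:R) * P k 0).
  by move=> y; rewrite !E; congr psi; exact: (Pij y 0).
by rewrite eqxx (negPf ij) subr0 => /eqP; rewrite oner_eq0.
Qed.
End OneField.

(** The tracked function can be any of the [f l]; [f0] is the member of the family
    attached to the zero map. *)
Lemma lam_control m d : exists s a : nat,
  forall (F : finFieldType) (P : 'I_m -> F -> F) f0 f l (e : R),
    0 < e -> e <= 1 / 2 -> (forall i, poly_map d (P i)) ->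
    (forall i, ~ fdeg 0 (P i)) -> (forall i j, i != j -> ~ fdeg 0 (P i - P j)) ->
    (forall x, normc (f0 x) <= 1) -> (forall i x, normc (f i x) <= 1) ->
    e <= normc (lam P f0 f) ->
    #|F|%:R * e ^+ a <= 1 \/ e ^+ a <= gowers s (f l).
Proof.
have [s [a H]] := @gowers_control R m.+1 d; exists s, a => F P f0 f l e e0 e1 dP P0 Pij f01 f1 eL.
pose X := ((fun=> 0), f0) :: [seq (P i, f i) | i <- enum 'I_m & i != l].
apply: (H F X (P l) (f l) e e0 e1).
  split => //.
    by rewrite /= ltnS size_map size_filter (leq_trans (count_size _ _))// size_enum_ord.
  move=> u; rewrite /X in_cons => /orP[/eqP ->|uX].
    split => //=; first exact: poly_map_cst.
    move=> H0; apply: (P0 l) => y z; have := H0 y z; rewrite !fctE !sub0r; exact: oppr_inj.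
  have [i iX ->] := mapP uX; move: iX; rewrite mem_filter => /andP[il _].
  split => //=; exact: Pij.
rewrite (_ : average X (P l) (f l) = lam P f0 f)//.
apply: eq_avg => x; apply: eq_avg => y.
rewrite /X big_cons addr0 mulrCA; congr (_ * _).
by rewrite big_map big_filter big_enum_cond /= [RHS](bigD1 l).
Qed.

(** The statement to be proved, for families in which all functions from the
    [l]-th on are characters. *)
Definition joint p d m l := exists a : nat,
  forall (F : finFieldType) r psi (P : 'I_m -> F -> F) f0 f (e : R),
    trace_char p r psi -> 0 < e -> e <= 1 / 2 ->
    (forall i, poly_map d (P i)) -> independent psi P ->
    (forall x, normc (f0 x) <= 1) -> (forall i x, normc (f i x) <= 1) ->
    (forall i : 'I_m, (l <= i)%N -> charlike psi (f i)) ->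
    e <= normc (lam P f0 f - avg f0 * \prod_i avg (f i)) ->
    #|F|%:R * e ^+ a <= 1.

(** The average factors through an exponential sum. *)
Lemma joint0 p d m : joint p d m 0.
Proof.
have [a W] := @weyl_dichotomy R p d; exists a => F r psi P f0 f e tc e0 e1 dP iP f01 f1 fc eL.
have [c cP] := choice (fun i => fc i isT); have [b bP] := choice cP.
pose S y := \sum_i b i * P i y.
have lamE : lam P f0 f = (EE x, (f0 x * \prod_i f i x)) * EE y, psi (S y).
  rewrite -avgZr; apply: eq_avg => x; rewrite -avgZ; apply: eq_avg => y.
  rewrite -mulrA; congr (_ * _); rewrite /S (psi_sum tc) -big_split; apply: eq_bigr => i _ /=.
  by have [_ fE] := bP i; rewrite !fE mulrDr (tc_add tc) mulrA.
have fi i : avg (f i) = c i * (b i == 0)%:R.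
  have [_ fE] := bP i; rewrite (eq_avg fE) avgZ; congr (_ * _); exact: avg_psi tc _.
have [b0|/existsNP[i /eqP bi]] := pselect (forall i, b i = 0).
  exfalso; move: eL; rewrite lamE (eq_avg (f := fun y => psi (S y)) (g := fun=> 1)) => [|y]; last first.
    by rewrite /S big1 ?(psi0 tc)// => i _; rewrite b0 mul0r.
  have -> : (EE x, (f0 x * \prod_i f i x)) = avg f0 * \prod_i avg (f i).
    rewrite -avgZr; apply: eq_avg => x; congr (_ * _); apply: eq_bigr => i _.
    by have [_ fE] := bP i; rewrite fi fE b0 eqxx mul0r (psi0 tc).
  by rewrite (avg_cst (0 : F)) mulr1 subrr normc0 leNgt e0.
move: eL; rewrite (bigD1 i)//= fi (negPf bi) mulr0 mul0r mulr0 subr0 lamE normcM => eL.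
have [|s sd sP] := @poly_map_sum _ d _ (index_enum 'I_m) (fun i y => b i * P i y).
  by move=> j; exact: poly_mapZ.
have {}eL : e <= normc (EE y, psi s.[y]).
  rewrite -(eq_avg (f := fun y => psi (S y))); last by move=> y; rewrite -sP.
  apply: le_trans eL _; rewrite ler_piMl ?normc_ge0// normc_avg_le1// => x.
  by rewrite normcM_le1// normc_prod_le1.
have [//|H] := W F r psi s e tc e0 e1 sd eL.
by move: bi; rewrite (iP b) ?eqxx// => y; have := H y; rewrite -!sP.
Qed.
End Joint.

(** * Joint averages: the induction *)

Section JointStep.
Context {R : realType}.
Local Notation C := R[i].

(** The dual function of the family with respect to its [l]-th member is the
    average over [y] of [dual P f0 f l y]. *)
Definition dual (F : finFieldType) m (P : 'I_m -> F -> F) (f0 : F -> C) (f : 'I_m -> F -> C)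
    (l : 'I_m) (y x : F) : C :=
  f0 (x - P l y) * \prod_(i | i != l) f i (x + (P i y - P l y)).

Definition replace (F : finFieldType) m (f : 'I_m -> F -> C) l g : 'I_m -> F -> C :=
  fun i => if i == l then g else f i.

Lemma lam_replace (F : finFieldType) m (P : 'I_m -> F -> F) f0 f l (g : F -> C) :
  lam P f0 (replace f l g) = EE x, (g x * EE y, dual P f0 f l y x).
Proof.
rewrite /lam (avg_translate (P l)); apply: eq_avg => x; rewrite -avgZ; apply: eq_avg => y.
rewrite (bigD1 l)//= {1}/replace eqxx subrK mulrCA; congr (_ * (_ * _)).
apply: eq_bigr => i /negPf il; rewrite /replace il; congr (f i _); ring.
Qed.

Lemma replace_same (F : finFieldType) m (f : 'I_m -> F -> C) l : replace f l (f l) = f.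
Proof. by apply/funext => i; rewrite /replace; case: eqP => [->|]. Qed.

(** Differencing the dual function and testing it against a character gives an
    average of the same kind, with a character in place of the [l]-th function. *)
Lemma fourier_dual (F : finFieldType) (psi : F -> C) m (P : 'I_m -> F -> F) f0 f l s b :
  (EE y, fourier (psi := psi) (difs s (dual P f0 f l y)) b) =
  lam P (difs s f0) (replace (fun i => difs s (f i)) l (fun x => psi (b * x))).
Proof.
rewrite lam_replace avg_exch; apply: eq_avg => x; rewrite -avgZ; apply: eq_avg => y.
rewrite mulrC; congr (_ * _); rewrite /dual difsM (difs_shift _ _ (- P l y)).
by rewrite (difs_prod _ _ _ _ (fun i => P i y - P l y)).
Qed.

(** At order one the norm is the modulus of the mean, which is zero here. *)
Lemma lowering_chain p d m (l : 'I_m) : @joint R p d m l -> forall k, exists a : nat,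
  forall (F : finFieldType) r psi (P : 'I_m -> F -> F) f0 f (e : R),
    trace_char p r psi -> 0 < e -> e <= 1 / 2 ->
    (forall i, poly_map d (P i)) -> independent psi P ->
    (forall x, normc (f0 x) <= 1) -> (forall i x, normc (f i x) <= 1) ->
    (forall i : 'I_m, (l < i)%N -> charlike psi (f i)) ->
    let D x := EE y, dual P f0 f l y x in
    e <= gowers k (fun x => 2^-1 * (D x - avg D)) ->
    #|F|%:R * e ^+ a <= 1.
Proof.
move=> [a0 H]; elim=> [|k [a IH]].
  exists 0%N => F r psi P f0 f e tc e0 e1 dP iP f01 f1 fc D.
  rewrite /gowers (avg_nil (fun h => normc (avg (difs h _)) ^+ 2)) /=.
  by rewrite avgZ avgB (avg_cst (0 : F)) subrr mulr0 normc0 expr0n/= leNgt e0.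
exists ((2 * 2 ^ k).+1 * a0 + (((2 * 2 ^ k).+1 + 2) * 2 ^ k) * a)%N.
move=> F r psi P f0 f e tc e0 e1 dP iP f01 f1 fc D eD.
have g1 y x : normc (dual P f0 f l y x) <= 1 by rewrite normcM_le1// normc_prod_le1.
have D1 : normc (avg D) <= 1 by apply: normc_avg_le1 => x; apply: normc_avg_le1.
have Hg s b (d' : R) : size s = k -> b != 0 -> 0 < d' -> d' <= 1 / 2 ->
    d' <= normc (EE y, fourier (psi := psi) (difs s (dual P f0 f l y)) b) ->
    #|F|%:R * d' ^+ a0 <= 1.
  move=> _ b0 d0 d1; rewrite fourier_dual => Hd.
  apply: (H F r psi P (difs s f0) (replace (fun i => difs s (f i)) l (fun x => psi (b * x))) d') => //.
  - by move=> x; exact: difs_le1.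
  - move=> i x; rewrite /replace; case: ifP => _; first by rewrite (tc_norm tc).
    exact: difs_le1.
  - move=> i li; rewrite /replace; case: (eqVneq i l) => il.
      by exists 1, b; split => [|x]; rewrite ?normc1 ?mul1r.
    apply: (charlike_difs tc); apply: fc; rewrite ltn_neqAle li andbT.
    by rewrite eq_sym.
  - rewrite (bigD1 l)//= {2}/replace eqxx (avg_psi tc) (negPf b0) mul0r mulr0 subr0.
    exact: Hd.
have [S|S] := degree_lowering tc e0 e1 g1 D1 (fun=> erefl) Hg eD.
  by apply: small_le S => //; rewrite leq_addr.
have [B BE] : exists B, (((2 * 2 ^ k).+1 + 2) * 2 ^ k = B.+1)%N.
  by exists (((2 * 2 ^ k).+1 + 2) * 2 ^ k).-1%N; rewrite prednK// muln_gt0 expn_gt0.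
rewrite BE in S *; apply: (small_le (a := (B.+1 * a)%N)) => //; first exact: leq_addl.
rewrite exprM; apply: (IH F r psi P f0 f _ tc _ _ dP iP f01 f1 fc) => //.
  by rewrite exprn_gt0.
exact: exp_le_half.
Qed.

(** As [f l] has mean zero, only the centred part [Fo] of the dual function
    matters, and by Cauchy--Schwarz [f l] may be replaced by the conjugate of
    [Fo]. *)
Lemma joint_mean_zero p d m (l : 'I_m) : @joint R p d m l -> exists a : nat,
  forall (F : finFieldType) r psi (P : 'I_m -> F -> F) f0 f (e : R),
    trace_char p r psi -> 0 < e -> e <= 1 / 2 ->
    (forall i, poly_map d (P i)) -> independent psi P ->
    (forall x, normc (f0 x) <= 1) -> (forall i x, normc (f i x) <= 1) ->
    (forall i : 'I_m, (l < i)%N -> charlike psi (f i)) ->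
    avg (f l) = 0 -> e <= normc (lam P f0 f) -> #|F|%:R * e ^+ a <= 1.
Proof.
move=> /lowering_chain H; have [s [a1 U]] := @lam_control R m d; have [a2 {}H] := H s.
exists (4 * a1 + 4 * a1.+1 * a2)%N => F r psi P f0 f e tc e0 e1 dP iP f01 f1 fc fl eL.
have [P0 Pij] := independent_nonconstant iP.
pose D x := EE y, dual P f0 f l y x; pose Fo x := 2^-1 * (D x - avg D).
have n2 : normc (2^-1 : C) = 2^-1.
  by rewrite normcV -(rmorph_nat (real_complex R)) normc_real ger0_norm.
have D1 x : normc (D x) <= 1.
  by apply: normc_avg_le1 => y; rewrite normcM_le1// normc_prod_le1.
have Fo1 x : normc (Fo x) <= 1.
  rewrite normcM n2 ler_pdivrMl// mulr1.
  apply: le_trans (le_normcD _ _) _; rewrite normcN -[2]/(1 + 1).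
  by rewrite lerD// normc_avg_le1.
have Fo0 : avg Fo = 0 by rewrite avgZ avgB (avg_cst (0 : F)) subrr mulr0.
have DFo x : D x = 2 * Fo x + avg D.
  by rewrite /Fo mulrA divff ?mul1r ?subrK// pnatr_eq0.
have E1 : lam P f0 f = 2 * EE x, (f l x * Fo x).
  rewrite -{1}(replace_same f l) lam_replace.
  transitivity (EE x, (2 * (f l x * Fo x) + f l x * avg D)).
    apply: eq_avg => x; rewrite -/(D x) DFo; ring.
  by rewrite avgD avgZ avgZr fl mul0r addr0.
have E2 : lam P f0 (replace f l (conjf Fo)) = ((2 * EE x, (normc (Fo x) ^+ 2))%:C)%C.
  rewrite lam_replace.
  transitivity (EE x, (2 * ((normc (Fo x) ^+ 2)%:C)%C + conjf Fo x * avg D)).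
    apply: eq_avg => x; rewrite -/(D x) DFo sqr_normcE /conjf; ring.
  rewrite avgD avgZ avgZr [RHS]rmorphM /= avgC rmorph_nat.
  rewrite (_ : avg (conjf Fo) = 0) ?mul0r ?addr0//.
  by rewrite /conjf -avgJ Fo0 conjc0.
have e2 : e / 2 <= normc (EE x, (f l x * Fo x)).
  move: eL; rewrite E1 normcM (_ : normc (2 : C) = 2); first lra.
  by rewrite -(rmorph_nat (real_complex R)) normc_real ger0_norm.
have {e2} e2 : e ^+ 4 <= normc (lam P f0 (replace f l (conjf Fo))).
  rewrite E2 normc_real ger0_norm; last by rewrite mulr_ge0// avg_ge0// => x; exact: sqr_ge0.
  have : (e / 2) ^+ 2 <= EE x, (normc (Fo x) ^+ 2).
    apply: le_trans (cauchy_schwarz Fo (f1 l)).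
    by rewrite lerXn2r ?nnegrE ?normc_ge0 ?divr_ge0// ltW.
  have : e ^+ 4 <= (e / 2) ^+ 2.
    rewrite -[4%N]/(2 * 2)%N exprM lerXn2r ?nnegrE ?exprn_ge0 ?divr_ge0 ?(ltW e0)//.
    by rewrite expr2 ler_wpM2l ?(ltW e0)//; lra.
  have : 0 <= EE x, (normc (Fo x) ^+ 2) by apply: avg_ge0 => x; exact: sqr_ge0.
  lra.
have e40 : 0 < e ^+ 4 by rewrite exprn_gt0.
have e41 : e ^+ 4 <= 1 / 2 by exact: exp_le_half.
have R1 i x : normc (replace f l (conjf Fo) i x) <= 1.
  by rewrite /replace; case: ifP => // _; rewrite normcJ.
have [S|S] := U F P f0 (replace f l (conjf Fo)) l _ e40 e41 dP P0 Pij f01 R1 e2.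
  by rewrite -exprM in S; apply: small_le S => //; exact: leq_addr.
rewrite /replace eqxx gowers_conj -exprM in S.
have {}S : e ^+ (4 * a1.+1) <= gowers s Fo.
  by apply: le_trans S; rewrite exp_le// leq_mul2l/=.
apply: (small_le (a := (4 * a1.+1 * a2)%N)) => //; first exact: leq_addl.
rewrite exprM; apply: (H F r psi P f0 f _ tc _ _ dP iP f01 f1 fc S).
  by rewrite exprn_gt0.
by rewrite mulnS; exact: exp_le_half.
Qed.

(** Split the [l]-th function into its mean, which is a multiple of the trivial
    character, and a function of mean zero. *)
Lemma jointS p d m l : @joint R p d m l -> @joint R p d m l.+1.
Proof.
have [ml|lm] := leqP m l.
  move=> [a H]; exists a => F r psi P f0 f e tc e0 e1 dP iP f01 f1 _.
  apply: (H F r psi P f0 f e tc) => // i li.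
  by have := ltn_ord i; rewrite ltnNge (leq_trans ml).
pose l0 := Ordinal lm => H; have [a1 H1] := joint_mean_zero (l := l0) H.
case: H => a0 H; exists (2 * a0 + 3 * a1)%N => F r psi P f0 f e tc e0 e1 dP iP f01 f1 fc eL.
have ee : e ^+ 2 <= e / 2 by rewrite expr2 ler_wpM2l ?(ltW e0)//; lra.
pose c := avg (f l0); have c1 : normc c <= 1 by exact: normc_avg_le1.
pose g x := 2^-1 * (f l0 x - c).
have n2 : normc (2^-1 : C) = 2^-1.
  by rewrite normcV -(rmorph_nat (real_complex R)) normc_real ger0_norm.
have g1 x : normc (g x) <= 1.
  rewrite normcM n2 ler_pdivrMl// mulr1.
  apply: le_trans (le_normcD _ _) _; rewrite normcN -[2]/(1 + 1).
  by rewrite lerD.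
pose f' := replace f l0 (fun=> 1); pose f'' := replace f l0 g.
have E : lam P f0 f - avg f0 * \prod_i avg (f i) =
    2 * lam P f0 f'' + c * (lam P f0 f' - avg f0 * \prod_i avg (f' i)).
  have -> : \prod_i avg (f i) = c * \prod_i avg (f' i).
    rewrite (bigD1 l0)//= [in RHS](bigD1 l0)//= {1}/f' /replace eqxx.
    rewrite (avg_cst (0 : F)) mul1r; congr (_ * _).
    by apply: eq_bigr => i /negPf il; rewrite /f' /replace il.
  suff -> : lam P f0 f = 2 * lam P f0 f'' + c * lam P f0 f' by ring.
  rewrite -{1}(replace_same f l0) !lam_replace -!avgZ -avgD; apply: eq_avg => x.
  rewrite /g; move: (avg _) => D.
  have -> : 2 * (2^-1 * (f l0 x - c) * D) = (f l0 x - c) * D.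
    by rewrite !mulrA divff ?mul1r// pnatr_eq0.
  ring.
have fc' g' : charlike psi g' -> forall i : 'I_m, (l <= i)%N -> charlike psi (replace f l0 g' i).
  move=> cg i li; rewrite /replace; case: (eqVneq i l0) => // il.
  by apply: fc; rewrite ltn_neqAle li andbT eq_sym.
have bnd g' : (forall x, normc (g' x) <= 1) -> forall i x, normc (replace f l0 g' i x) <= 1.
  by move=> g'1 i x; rewrite /replace; case: ifP.
have c0' : charlike psi (fun=> 1).
  by exists 1, 0; split => [|x]; rewrite ?normc1// mul0r (psi0 tc) mulr1.
have [S|S] : e ^+ 2 <= normc (lam P f0 f' - avg f0 * \prod_i avg (f' i)) \/
    e ^+ 3 <= normc (lam P f0 f'').
  apply/orP; rewrite -implyNb; apply/implyP; rewrite -ltNge => S1.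
  have e3 : e ^+ 3 <= e / 4.
    by rewrite exprS ler_wpM2l ?(ltW e0)//; apply: le_trans ee _; lra.
  set B := normc (_ - _) in S1.
  have {}eL : e <= 2 * normc (lam P f0 f'') + normc c * B.
    apply: le_trans eL _; rewrite E; apply: le_trans (le_normcD _ _) _.
    rewrite !normcM (_ : normc (2 : C) = 2)//.
    by rewrite -(rmorph_nat (real_complex R)) normc_real ger0_norm.
  have : normc c * B <= B by rewrite ler_piMl ?normc_ge0.
  lra.
- apply: (small_le (a := (2 * a0)%N)) => //; first exact: leq_addr.
  rewrite exprM; apply: (H F r psi P f0 f' _ tc _ _ dP iP f01 _ _ S).
  + by rewrite exprn_gt0.
  + exact: exp_le_half.
  + by apply: bnd => x; rewrite normc1.
  + exact: fc'.
apply: (small_le (a := (3 * a1)%N)) => //; first exact: leq_addl.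
rewrite exprM; apply: (H1 F r psi P f0 f'' _ tc _ _ dP iP f01 _ _ _ S).
- by rewrite exprn_gt0.
- exact: exp_le_half.
- exact: bnd.
- move=> i /= li; rewrite /f'' /replace; case: (eqVneq i l0) => il; last exact: fc.
  by move: li; rewrite il ltnn.
- by rewrite /f'' /replace eqxx avgZ avgB (avg_cst (0 : F)) subrr mulr0.
Qed.

Lemma joint_all p d m : @joint R p d m m.
Proof. by elim: {2}m => [|l]; [exact: joint0 | exact: jointS]. Qed.
End JointStep.

(** * Haar measure of the level sets of a coefficient *)

Section Haar.
Local Open Scope classical_set_scope.
Local Open Scope quotient_scope.
Context {R : realType} {F : finFieldType}.

(** The coefficient of t^-1, which is well defined modulo polynomials. *)
Definition res (x : torus F) : F := lcoef (repr x) (- 1).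

Lemma res_modpoly (u : laurent F) : res (modpoly u) = u (- 1).
Proof.
rewrite /res /modpoly; set v := repr _.
have : \pi_(torus_zmod (F := F)) v = \pi_(torus_zmod (F := F)) u by exact: reprK.
move=> /eqP; rewrite -Quotient.idealrBE => /asboolP[n vun].
by apply/eqP; rewrite -subr_eq0 -lcoefB vun.
Qed.

Lemma modpolyD (u v : laurent F) : modpoly (u + v) = modpoly u + modpoly v.
Proof. exact: (@Quotient.pi_add _ (GRing.ZmodClosed.clone (laurent F) polynomial_pred _) u v). Qed.

Lemma modpoly_repr (x : torus F) : modpoly (repr x) = x.
Proof. exact: reprK. Qed.

Lemma resD (x y : torus F) : res (x + y) = res x + res y.
Proof. by rewrite -{1}(modpoly_repr x) -{1}(modpoly_repr y) -modpolyD res_modpoly. Qed.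

Lemma res_continuous {Z : topologicalType} (g : F -> Z) :
  continuous (fun x : torus F => g (res x)).
Proof.
apply/quotient_continuous => u; apply: cvg_near_cst.
  exact: (@nbhs_filter (laurent F) u).
exists (- 1) => v uv /=; rewrite -[\pi_ _ v]/(modpoly v) -[\pi_ _ u]/(modpoly u).
by rewrite !res_modpoly (uv (- 1)).
Qed.

(** Level sets of [res] are open. *)
Lemma measurable_res (c : F) : measurable ([set x : torus F | res x = c] : set (borel_torus F)).
Proof.
apply: sub_sigma_algebra; have : open [set b : bool | b] by exact: discrete_open.
have /continuousP := @res_continuous bool (fun z => z == c); move=> H /H.
by congr open; apply/seteqP; split => x /= /eqP.
Qed.

(** Translating by t^-1 moves the level sets of the coefficient of t^-1. *)
Lemma haar_level (mu : probability (borel_torus F) R) (c : F) : is_haar mu ->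
  mu [set x : torus F | res x = c + 1] = mu [set x : torus F | res x = c].
Proof.
move=> haar; pose u : int -> F := fun j => (j == - 1)%:R.
have uP : u \in laurent_pred.
  by apply/asboolP; exists 0 => j j0; rewrite /u; case: eqP => // j1; move: j0; rewrite j1.
rewrite -(haar (modpoly (Laurent uP)) _ (measurable_res c)); congr (mu _).
have ru : res (modpoly (Laurent uP)) = 1 by rewrite res_modpoly /= /u eqxx.
apply/seteqP; split => [x /= xc|_ [x /= xc <-]]; last by rewrite resD ru xc addrC.
exists (x - modpoly (Laurent uP)); last by rewrite addrC subrK.
by apply: (addIr 1); rewrite -{1}ru -resD subrK.
Qed.

Lemma haar_level_neq1 (mu : probability (borel_torus F) R) (c : F) : is_haar mu ->
  mu [set x : torus F | res x = c] <> 1%E.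
Proof.
move=> haar mu1; have mu2 := haar_level c haar; rewrite mu1 in mu2.
have : (mu ([set x : torus F | res x = c] `|` [set x : torus F | res x = (c + 1)%R]) <= 1)%E.
  by apply: probability_le1; apply: measurableU; exact: measurable_res.
have -> : (mu ([set x : torus F | res x = c] `|` [set x : torus F | res x = (c + 1)%R]) =
    mu [set x : torus F | res x = c] + mu [set x : torus F | res x = (c + 1)%R])%E.
  apply: measureU; try exact: measurable_res.
  apply/seteqP; split => // x /= [-> /eqP].
  by rewrite -[X in X == _]addr0 (inj_eq (addrI _)) eq_sym oner_eq0.
by rewrite mu1 mu2 -EFinD lee_fin gerDl ler10.
Qed.

(** Polynomials of degree below [N]: they absorb every translation once [N] is
    large. *)
Definition box (N : nat) : {fset {poly F}} :=
  [fset x in [seq Poly (tval t) | t <- enum {: N.-tuple F}]]%fset.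

Lemma in_box N n : (n \in box N) = (size n <= N)%N.
Proof.
rewrite !inE; apply/mapP/idP => [[t _ ->]|nN].
  by rewrite (leq_trans (size_Poly _))// size_tuple.
exists [tuple n`_i | i < N]; first by rewrite mem_enum.
apply/polyP => i; rewrite coef_Poly; have [iN|Ni] := ltnP i N.
  by rewrite -(tnth_nth 0 [tuple n`_i | i < N] (Ordinal iN)) tnth_mktuple.
by rewrite !nth_default ?size_tuple// (leq_trans nN).
Qed.

Lemma box_folner : folner (R := R) box.
Proof.
split=> [N|n].
  by apply/fset0Pn; exists 0; rewrite in_box size_poly0.
apply: cvg_near_cst; exists (size n) => // N /= nN.
have -> : ([fset (k + n)%R | k in box N] = box N)%fset.
  apply/fsetP => k; rewrite in_box; apply/imfsetP/idP => [[l /= ] |kN].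
    by rewrite in_box => lN ->; rewrite (leq_trans (size_polyD _ _))// geq_max lN.
  exists (k - n); last by rewrite subrK.
  by rewrite /= in_box (leq_trans (size_polyD _ _))// geq_max kN size_polyN.
by rewrite fsetDv fsetU0 cardfs0 mul0r.
Qed.

(** If the coefficient of t^-1 of [a n] does not depend on [n] then the level
    set where it lies has full Haar measure. *)
Lemma not_well_distributed (a : {poly F} -> laurent F) (c : F) :
  (forall n, a n (- 1) = c) -> ~ well_distributed (R := R) a.
Proof.
move=> ac [mu haar H]; pose f (x : torus F) : R[i]^o := (res x == c)%:R.
have fc : continuous f by exact: (@res_continuous (R[i]^o) (fun z => (z == c)%:R)).
have := H f fc box box_folner.
have -> : (fun N => #|` box N|%:R^-1 * \sum_(n <- box N) f (modpoly (a n)) : R[i]^o) = fun=> 1.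
  apply/funext => N; rewrite (eq_bigr (fun=> 1)) => [|n _]; last first.
    by rewrite /f res_modpoly ac eqxx.
  rewrite big_const_seq count_predT iter_addr_0 mulVf// pnatr_eq0 cardfs_eq0.
  by case: box_folner => /(_ N).
move=> /(cvg_unique (@norm_hausdorff _ _)) /(_ (cvg_cst _)) /(congr1 (@complex.Re R)) /=.
pose A := [set x : torus F | res x = c].
have -> : (\int[mu]_x complex.Re (f x) = fine (mu A))%R.
  have E : (fun x : torus F => (complex.Re (f x))%:E) =
      fun x => (\1_(A : set (borel_torus F)) x)%:E.
    apply/funext => x; rewrite /f indicE; congr (_%:E).
    by case: eqP => xc; [rewrite mem_set|rewrite memNset].
  rewrite /Rintegral E integral_indic ?setIT//; exact: measurable_res.
move=> muA; apply: (haar_level_neq1 (mu := mu) (c := c) haar); rewrite -/A.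
by rewrite -[mu A]fineK ?muA// fin_num_measure//; exact: measurable_res.
Qed.
End Haar.

(** * Torsion of the annihilator of a good family *)

Section Duality.
Context {F : finFieldType} {m : nat}.
Implicit Types (x y : 'I_m -> nat -> F) (v : 'I_m -> {poly F}).

(** Arrays are the functionals on vectors of polynomials; an array is a point of
    the dual group (F((1/t)) / F[t]) ^ m, read off its negative coefficients. *)
Definition pairing x v : F := \sum_i \sum_(j < size (v i)) (v i)`_j * x i j.

Lemma pairing_wide M x v : (forall i, (size (v i) <= M)%N) ->
  pairing x v = \sum_i \sum_(j < M) (v i)`_j * x i j.
Proof.
move=> vM; apply: eq_bigr => i _.
rewrite (big_ord_widen _ (fun j => (v i)`_j * x i j) (vM i)) big_mkcond.
by apply: eq_bigr => j _; case: ltnP => // H; rewrite nth_default ?mul0r.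
Qed.

Lemma pairing_local M x y v : (forall i, (size (v i) <= M)%N) ->
  (forall i j, (j < M)%N -> x i j = y i j) -> pairing x v = pairing y v.
Proof.
move=> vM xy; rewrite !(pairing_wide _ vM); apply: eq_bigr => i _.
by apply: eq_bigr => j _; rewrite xy.
Qed.

Lemma pairingD x y v : pairing (x + y) v = pairing x v + pairing y v.
Proof.
rewrite /pairing -big_split; apply: eq_bigr => i _; rewrite -big_split.
by apply: eq_bigr => j _; rewrite !fctE mulrDr.
Qed.

Lemma pairingB x y v : pairing (x - y) v = pairing x v - pairing y v.
Proof.
rewrite /pairing -sumrB; apply: eq_bigr => i _; rewrite -sumrB.
by apply: eq_bigr => j _; rewrite !fctE mulrBr.
Qed.

Lemma size_bound v : exists M, forall i, (size (v i) <= M)%N.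
Proof. by exists (\max_i size (v i))%N => i; exact: leq_bigmax. Qed.

Definition killed_by (N : {poly F}) x := forall v, pairing x (fun i => N * v i) = 0.

Lemma killed_by_mul N N' x : killed_by N x -> killed_by (N * N') x.
Proof.
move=> H v; rewrite -[RHS](H (fun i => N' * v i)); congr pairing.
by apply/funext => i; rewrite mulrA.
Qed.

Section GlidingHump.
Context (K : ('I_m -> nat -> F) -> Prop).
Hypotheses (K0 : K 0) (KB : forall x y, K x -> K y -> K (x - y)).
Hypothesis Kclosed : forall x,
  (forall M, exists2 y, K y & forall i j, (j < M)%N -> x i j = y i j) -> K x.
Hypothesis Ktorsion : forall x, K x -> exists2 N : {poly F}, N != 0 & killed_by N x.

Let KD x y : K x -> K y -> K (x + y).
Proof. by move=> Kx Ky; rewrite -(opprK y); apply: KB => //; rewrite -sub0r; exact: KB. Qed.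

(** The functionals of [K] that vanish on a given finite box form a subgroup of
    finite index. If one polynomial killed this subgroup then, multiplied by
    polynomials that kill representatives of the cosets, it would kill [K]. *)
Lemma escape : ~ (exists2 N : {poly F}, N != 0 & forall x, K x -> killed_by N x) ->
  forall M (N : {poly F}), N != 0 -> exists y, [/\ K y, forall i j, (j < M)%N -> y i j = 0 & ~ killed_by N y].
Proof.
move=> noN M N N0; apply: contrapT => H; apply: noN.
pose pat x : {ffun 'I_m * 'I_M -> F} := [ffun ij : 'I_m * 'I_M => x ij.1 ij.2].
have C (r : {ffun 'I_m * 'I_M -> F}) : exists N' : {poly F}, N' != 0 /\
    forall x, K x -> pat x = r -> exists y, [/\ K y, pat y = r & killed_by N' y].
  have [[x [Kx xr]]|no] := pselect (exists x, K x /\ pat x = r).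
    have [N' N'0 N'x] := Ktorsion Kx; exists N'; split => // _ _ _; by exists x.
  by exists 1; split => [|x Kx xr]; [exact: oner_neq0|case: no; exists x].
have [f fP] := choice C.
exists (N * \prod_r f r).
  by rewrite mulf_neq0//; apply/prodf_neq0 => r _; have [] := fP r.
move=> x Kx v; have [_ /(_ x Kx erefl)[y [Ky yx yf]]] := fP (pat x).
rewrite -(subrK y x) pairingD.
have -> : pairing (x - y) (fun i => N * (\prod_r f r) * v i) = 0.
  apply: killed_by_mul; apply: contrapT => nk; apply: H; exists (x - y); split => //.
    exact: KB.
  move=> i j jM; have := congr1 (fun g : {ffun _ -> F} => g (i, Ordinal jM)) yx.
  by rewrite !ffunE /= => e; rewrite !fctE e subrr.
rewrite add0r (bigD1 (pat x))//= mulrCA; exact: killed_by_mul.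
Qed.

(** Gliding hump: if no single polynomial kills [K], list all nonzero polynomials
    and add successively, far enough out, functionals that escape the next one
    without disturbing the values that witness earlier escapes. The limit lies in
    [K] and escapes all of them. *)
Theorem uniform_torsion : exists2 N : {poly F}, N != 0 & forall x, K x -> killed_by N x.
Proof.
apply: contrapT => /escape esc.
pose enumN (j : nat) : {poly F} :=
  let N := odflt (1 : {poly F}) (choice.unpickle j) in if N == 0 then 1 else N.
have enumN0 j : enumN j != 0.
  by rewrite /enumN; case: ifPn => // _; exact: oner_neq0.
pose state := (('I_m -> nat -> F) * nat)%type.
pose good j (s s' : state) := [/\ K s'.1, (s.2 <= s'.2)%N, (j < s'.2)%N,
  forall i t, (t < s.2)%N -> s'.1 i t = s.1 i t &
  exists v, (forall i, (size (enumN j * v i)%R <= s'.2)%N) /\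
            pairing s'.1 (fun i => enumN j * v i) != 0].
have [g gP] : exists g : nat * state -> state, forall js, K js.2.1 -> good js.1 js.2 (g js).
  suff H (js : nat * state) : exists s', K js.2.1 -> good js.1 js.2 s'.
    by have [g gP] := choice H; exists g.
  case: js => j [x M] /=; have [Kx|nK] := pselect (K x); last by exists (x, M).
  have [x' [Kx' x'x /existsNP[v vx]]] : exists x', [/\ K x',
      forall i t, (t < M)%N -> x' i t = x i t & ~ killed_by (enumN j) x'].
    have [kx|nk] := pselect (killed_by (enumN j) x); last by exists x.
    have [y [Ky y0 ny]] := esc M _ (enumN0 j).
    exists (x + y); split; first exact: KD.
      by move=> i t tM; rewrite !fctE y0// addr0.
    by move=> H; apply: ny => v; have := H v; rewrite pairingD kx add0r.
  have [B vB] := size_bound (fun i => enumN j * v i).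
  exists (x', maxn M (maxn j.+1 B)) => _; split => //=.
  - exact: leq_maxl.
  - by rewrite !leq_max leqnn orbT.
  - exists v; split => [i|]; last exact/eqP.
    by rewrite !leq_max vB !orbT.
pose S := fix S j : state := if j is j'.+1 then g (j', S j') else (0, 0%N).
have KS j : K (S j).1 by elim: j => [|j /(gP (j, S j))[]].
have SS j : good j (S j) (S j.+1) by exact: (gP (j, S j)) (KS j).
have Smono j l : (j <= l)%N -> ((S j).2 <= (S l).2)%N /\
    forall i t, (t < (S j).2)%N -> (S l).1 i t = (S j).1 i t.
  move=> /subnKC <-; elim: (l - j)%N => [|n [IH1 IH2]]; first by rewrite addn0.
  rewrite addnS; have [_ H1 _ H2 _] := SS (j + n)%N; split; first exact: leq_trans H1.
  by move=> i t tj; rewrite H2 ?IH2// (leq_trans tj).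
have Sbig j : (j <= (S j).2)%N by case: j => // j; have [] := SS j.
pose x : 'I_m -> nat -> F := fun i t => (S t.+1).1 i t.
have xS j i t : (t < (S j).2)%N -> x i t = (S j).1 i t.
  move=> tj; rewrite /x; have [jt|tj'] := leqP j t.+1; first by have [_ ->] := Smono _ _ jt.
  by have [_ H] := Smono _ _ (ltnW tj'); rewrite -H// Sbig.
have Kx : K x.
  apply: Kclosed => M; exists (S M).1 => // i j jM; apply: xS.
  exact: leq_trans jM (Sbig M).
have [N N0 Nx] := Ktorsion Kx.
have eN : enumN (choice.pickle N) = N by rewrite /enumN choice.pickleK /= (negPf N0).
have [_ _ _ _ [v [vM /eqP]]] := SS (choice.pickle N); apply.
rewrite eN in vM *; rewrite -[RHS](Nx v); apply: (pairing_local vM) => i j jM.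
by rewrite (xS _ _ _ jM).
Qed.
End GlidingHump.
End Duality.

Section GoodFamilies.
Context {R : realType} {F : finFieldType} {m : nat}.

Fact tail_subproof (s : nat -> F) :
  (fun j : int => if j is Negz i then s i else 0) \in laurent_pred.
Proof. by apply/asboolP; exists 0 => -[]. Qed.
(** The Laurent series with the coefficients [s] at t^-1, t^-2, and so on. *)
Definition tail s : laurent F := Laurent (tail_subproof s).

Lemma coef_scale_tail (n : {poly F}) s : (n *: tail s) (- 1) = \sum_(j < size n) n`_j * s j.
Proof.
apply: eq_bigr => j _; congr (_ * _).
by have -> : (- 1 - (j : nat)%:Z)%R = Negz j by rewrite NegzE -opprD.
Qed.

Lemma coef_sum_tail (v : 'I_m -> {poly F}) x :
  (\sum_i v i *: tail (x i)) (- 1) = pairing x v.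
Proof.
rewrite /pairing (big_morph (fun u : laurent F => u (- 1)) (id1 := 0) (op1 := +%R))//.
by apply: eq_bigr => i _; exact: coef_scale_tail.
Qed.

Lemma coef_scale_poly (n k : {poly F}) : (n *: laurent_of_poly k) (- 1) = 0.
Proof.
rewrite [LHS]big1// => j _; rewrite /= (_ : (- 1 - (j : nat)%:Z)%R = Negz j) ?mulr0//.
by rewrite NegzE -opprD.
Qed.

(** Dually: the vectors P(n) - P(0) generate a group that contains all multiples
    of some nonzero N. *)
Theorem good_torsion (P : 'I_m -> {poly {poly F}}) :
  good_for_irrational_equidistribution R (fun i n => (P i).[n]) ->
  exists2 N : {poly F}, N != 0 & forall x : 'I_m -> nat -> F,
    (forall n, pairing x (fun i => (P i).[n] - (P i).[0]) = 0) ->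
    forall v, pairing x (fun i => N * v i) = 0.
Proof.
move=> hP; apply: uniform_torsion.
- by move=> n; rewrite /pairing big1// => i _; rewrite big1// => j _; rewrite mulr0.
- by move=> x y Kx Ky n; rewrite pairingB Kx Ky subrr.
- move=> x H n; have [M vM] := size_bound (fun i => (P i).[n] - (P i).[0]).
  by have [y Ky xy] := H M; rewrite (pairing_local vM xy).
move=> x Kx.
have pairB v w : pairing x (fun i => v i - w i) = pairing x v - pairing x w.
  rewrite -!coef_sum_tail -lcoefB -sumrB; congr (lcoef _ _).
  by apply: eq_bigr => i _; rewrite scalerBl.
have rat : forall i, Defs.rational (tail (x i)).
  apply: contrapT => /hP; apply: (not_well_distributed (c := pairing x (fun i => (P i).[0]))).
  move=> n; rewrite coef_sum_tail; apply/eqP; rewrite -subr_eq0 -pairB; apply/eqP; exact: Kx.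
have [k kP] := choice rat; have [N NP] := choice kP.
exists (\prod_i N i); first by apply/prodf_neq0 => i _; have [] := NP i.
move=> v; rewrite -coef_sum_tail (big_morph (fun u : laurent F => u (- 1)) (id1 := 0) (op1 := +%R))//.
rewrite big1// => i _; have [_ E] := NP i.
have -> : \prod_j N j * v i = (\prod_(j | j != i) N j * v i) * N i.
  by rewrite (bigD1 i)//=; ring.
by rewrite -scalerA E coef_scale_poly.
Qed.
End GoodFamilies.

(** * Passage to the finite fields *)

Section ExistsCharacter.
Context {R : realType}.

Lemma exists_root_of_unity p : prime p -> exists z : R[i], p.-primitive_root z.
Proof.
move=> p_pr; pose s : {poly R[i]} := \poly_(i < p) 1.
have ps : size s = p by apply: size_poly_eq; rewrite oner_neq0.
have /closed_rootP[z /rootP sz] : size s != 1%N.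
  by rewrite ps; have := prime_gt1 p_pr; case: (p) => [|[]].
have szE : \sum_(i < p) z ^+ i = 0.
  by rewrite -[RHS]sz horner_poly; apply: eq_bigr => i _; rewrite mul1r.
have zp : z ^+ p = 1 by apply/eqP; rewrite -subr_eq0 subrX1 szE mulr0.
have [r zr rp] := prim_order_exists (prime_gt0 p_pr) zp.
exists z; have [_ /(_ r rp) /orP[/eqP r1|/eqP <-//]] := primeP p_pr.
have z1 : z = 1 by have := prim_expr_order zr; rewrite r1 expr1.
move: szE; rewrite z1 (eq_bigr (fun=> 1)) => [|i _]; last by rewrite expr1n.
rewrite sumr_const card_ord => /eqP; rewrite pnatr_eq0 => /eqP p0.
by move: p_pr; rewrite p0.
Qed.

(** The trace of [F] down to its prime field, and the character it gives. *)
Lemma exists_trace_char (F : finFieldType) (p k : nat) : prime p -> p \in [pchar F] ->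
  #|F| = (p ^ k)%N -> exists (tau : F -> 'F_p) (psi : F -> R[i]),
    [/\ {morph tau : x y / x + y}, trace_char p k psi & forall x, psi x = 1 <-> tau x = 0].
Proof.
move=> p_pr pF cF; have [z zp] := exists_root_of_unity p_pr.
pose T (x : F) := \sum_(j < k) x ^+ (p ^ j).
have p0 := prime_gt0 p_pr; have p1 := prime_gt1 p_pr.
have frob i : [pchar F].-nat (p ^ i)%N by rewrite (eq_pnat _ (pcharf_eq pF)) pnatX pnat_id.
have TD x y : T (x + y) = T x + T y.
  by rewrite /T -big_split; apply: eq_bigr => j _ /=; rewrite exprDn_pchar.
have sumX n (f : 'I_n -> F) : (\sum_j f j) ^+ p = \sum_j f j ^+ p.
  apply: (big_morph (fun x => x ^+ p)) => [x y|]; last by rewrite expr0n eqn0Ngt p0.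
  by have := frob 1%N; rewrite expn1 => fp; rewrite exprDn_pchar.
have TX x : T x ^+ p = T x.
  apply/eqP; rewrite -subr_eq0 /T sumX -sumrB; apply/eqP.
  rewrite (eq_bigr (fun i : 'I_k => x ^+ (p ^ i.+1) - x ^+ (p ^ i))) => [|i _].
    rewrite -(big_mkord xpredT (fun i => x ^+ (p ^ i.+1) - x ^+ (p ^ i))) telescope_sumr//.
    by rewrite -cF expf_card expr1 subrr.
  by rewrite -exprM expnSr.
have natF (R' : nzRingType) (a b : nat) : p \in [pchar R'] ->
    (a%:R = b%:R :> R') <-> (a = b %[mod p]).
  move=> pR'; wlog ab : a b / (a <= b)%N => [H|].
    have [/H//|/ltnW/H H'] := leqP a b.
    by split => [/esym/H'->|/esym/H'->].
  split => [H|H]; last by rewrite -(GRing.natr_mod_pchar pR' a) H GRing.natr_mod_pchar.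
  apply/eqP; rewrite eq_sym eqn_mod_dvd// (dvdn_pcharf pR') natrB// H subrr//.
have Tnat x : exists n : nat, n%:R = T x.
  apply: contrapT => nT; have XpX : ('X^p - 'X : {poly F}) != 0.
    by rewrite -size_poly_gt0 size_polyDl ?size_polyXn// size_polyN size_polyX.
  have := max_poly_roots XpX (rs := T x :: [seq (n : nat)%:R | n <- iota 0 p]).
  rewrite size_polyDl ?size_polyN ?size_polyX ?size_polyXn// => H.
  suff : (size (T x :: [seq n%:R : F | n <- iota 0 p]) < p.+1)%N.
    by rewrite /= size_map size_iota ltnn.
  apply: H.
    rewrite /= /root !hornerE TX subrr eqxx /=; apply/allP => _ /mapP[n _ ->].
    rewrite /root !hornerE subr_eq0; apply/eqP.
    by have := frob 1%N; rewrite expn1 => fp; exact: (pFrobenius_aut_nat pF n).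
  rewrite /= map_inj_in_uniq ?iota_uniq ?andbT.
    by apply/negP => /mapP[n _ E]; apply: nT; exists n.
  move=> a b; rewrite !mem_iota !add0n /= => ap bp /(natF _ _ _ pF).
  by rewrite !modn_small.
have [t tP] := choice Tnat.
have pFp := pchar_Fp p_pr.
pose tau x : 'F_p := (t x)%:R; pose psi x := z ^+ t x.
have tD x y : t (x + y) = (t x + t y)%N %[mod p].
  by apply/(natF F _ _ pF); rewrite natrD !tP TD.
have psi1 x : psi x = 1 <-> (p %| t x)%N.
  by rewrite (prim_order_dvd zp); split => /eqP.
exists tau, psi; split.
- by move=> x y; rewrite /tau -natrD; apply/(natF _ _ _ pFp)/tD.
- split => //.
  + by move=> x y; rewrite /psi -exprD -(prim_expr_mod zp) tD prim_expr_mod.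
  + move=> x; apply/eqP; rewrite -(@pexpr_eq1 _ _ p) ?normc_ge0// /psi -normcX.
    by rewrite exprAC (prim_expr_order zp) expr1n normc1.
  + by move=> x; rewrite psi1 (dvdn_pcharf pF) tP; split => /eqP.
- by move=> x; rewrite psi1 (dvdn_pcharf pFp); split => /eqP.
Qed.
End ExistsCharacter.

Section Quotient.
Context {R : realType} {p : nat} {m : nat} (P : 'I_m -> {poly {poly 'F_p}}).
Context (Q : {poly 'F_p}) (hQ : monic_irreducible_poly Q).
Local Notation L := {poly %/ Q with hQ}.

Definition red : {poly 'F_p} -> L := in_qpoly Q.
HB.instance Definition _ := GRing.RMorphism.copy red (in_qpoly Q : {poly 'F_p} -> L).

Lemma red_surj (z : L) : exists n, red n = z.
Proof.
exists (z : {poly 'F_p}); apply/val_inj; apply: in_qpoly_small; exact: size_mk_monic.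
Qed.

(** Below the degree of [Q] reduction is injective. *)
Lemma red_neq0 (n : {poly 'F_p}) : n != 0 -> (size n < size Q)%N -> red n != 0.
Proof.
move=> n0 nQ; apply: contra_neq n0 => /(congr1 val) /= H.
by rewrite -[LHS](@in_qpoly_small _ Q) ?(mk_monicE hQ).
Qed.

Lemma poly_mod_red (f : {poly {poly 'F_p}}) n : @poly_mod _ Q hQ f (red n) = red f.[n].
Proof. exact: (horner_map red). Qed.

Lemma poly_mod_poly_map d (f : {poly {poly 'F_p}}) : (size f <= d.+1)%N ->
  poly_map d (@poly_mod _ Q hQ f).
Proof.
by move=> fd; exists (map_poly red f) => //; exact: leq_trans (size_poly _ _) fd.
Qed.

Lemma red_scale c n : red (c *: n) = red c%:P * red n.
Proof. by rewrite -mul_polyC rmorphM. Qed.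

(** A constant phase makes v |-> tau (\sum_i a_i v_i) a functional that vanishes on
    all P(n) - P(0), hence on all multiples of [N]; as [N] is invertible modulo
    [Q] it vanishes identically. *)
Lemma independent_mod (tau : L -> 'F_p) k (psi : L -> R[i]) (N : {poly 'F_p}) :
  trace_char p k psi -> {morph tau : x y / x + y} -> (forall x, psi x = 1 <-> tau x = 0) ->
  red N != 0 ->
  (forall x : 'I_m -> nat -> 'F_p,
    (forall n, pairing x (fun i => (P i).[n] - (P i).[0]) = 0) ->
    forall v, pairing x (fun i => N * v i) = 0) ->
  independent psi (fun i => @poly_mod _ Q hQ (P i)).
Proof.
move=> tc tauD psitau N0 HN a Ha.
have tau0 : tau 0 = 0 by apply/psitau; exact: psi0 tc.
have tauZ c z : tau (red c%:P * z) = c * tau z.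
  have -> : c = (c : nat)%:R by rewrite natr_Zp.
  rewrite -[(_ : nat)%:R%:P]/(polyC _) rmorph_nat rmorph_nat !mulr_natl.
  by elim: (c : nat) => [|n IH]; rewrite ?mulr0n// !mulrS tauD IH.
pose x i j := tau (a i * red 'X^j).
have pairE v : pairing x v = tau (\sum_i a i * red (v i)).
  rewrite (big_morph tau tauD tau0); apply: eq_bigr => i _.
  have -> : red (v i) = \sum_(j < size (v i)) red ((v i)`_j *: 'X^j).
    by rewrite -rmorph_sum -poly_def coefK.
  rewrite mulr_sumr (big_morph tau tauD tau0).
  by apply: eq_bigr => j _; rewrite /x red_scale mulrCA tauZ.
have Kx n : pairing x (fun i => (P i).[n] - (P i).[0]) = 0.
  rewrite pairE; apply/psitau; rewrite -[X in X = _](_ : psi (\sum_i a i * @poly_mod _ Q hQ (P i) (red n) - \sum_i a i * @poly_mod _ Q hQ (P i) 0) = _).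
    by apply/(psiB1 tc)/Ha.
  rewrite -sumrB; congr psi; apply: eq_bigr => i _.
  by rewrite rmorphB /= mulrBr -!poly_mod_red rmorph0.
move=> i; apply/eqP/contraT => ai; have [z0 /eqP pz0] := psi_nontrivial tc.
have [v0 v0E] := red_surj ((red N)^-1 * (a i)^-1 * z0).
case: pz0; apply/psitau; rewrite -(HN x Kx (fun j => if j == i then v0 else 0)) pairE.
rewrite (bigD1 i)//= eqxx big1 => [|j /negPf ->]; last by rewrite mulr0 rmorph0 mulr0.
by rewrite addr0 rmorphM /= v0E !mulrA mulfK// divff// mul1r.
Qed.
End Quotient.

(** * The theorem *)

(** The square of the norm is the average in which [f0] is the conjugate of the
    function whose norm is taken. *)
Lemma L2norm_control (R : realType) p d m : exists a : nat,
  forall (L : finFieldType) k (psi : L -> R[i]) (P : 'I_m -> L -> L) (f : 'I_m -> L -> R[i]),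
    trace_char p k psi -> (forall i, poly_map d (P i)) -> independent psi P ->
    (forall i x, normc (f i x) <= 1) ->
    let D := L2norm (fun x => avg (fun y => \prod_i f i (x + P i y)) - \prod_i avg (f i)) in
    #|L|%:R * (D ^+ 2 / 8) ^+ a.+1 <= 1.
Proof.
have [a H] := joint_all (R := R) p d m.
exists a => L k psi P f tc dP iP f1; set D := L2norm _; rewrite /=.
pose A x := avg (fun y => \prod_i f i (x + P i y)) - \prod_i avg (f i).
have A2 x : normc (A x) <= 2.
  rewrite /A; apply: le_trans (le_normcD _ _) _; rewrite normcN -[2]/(1 + 1) lerD//.
    by apply: normc_avg_le1 => y; exact: normc_prod_le1.
  by apply: normc_prod_le1 => i; exact: normc_avg_le1.
have DE : D ^+ 2 = EE x, (normc (A x) ^+ 2).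
  by rewrite /D /L2norm sqr_sqrtr// avg_ge0// => x; exact: sqr_ge0.
have [->|D0] := eqVneq D 0; first by rewrite expr0n mul0r expr0n mulr0.
have D20 : 0 < D ^+ 2 by rewrite exprn_even_gt0.
have D24 : D ^+ 2 <= 4.
  have -> : (4 : R) = 2 ^+ 2 by ring.
  rewrite DE; apply: (avg_le_cst (0 : L)) => x.
  by rewrite lerXn2r ?nnegrE ?normc_ge0.
pose e := D ^+ 2 / 8.
have e0 : 0 < e by rewrite divr_gt0.
have e1 : e <= 1 / 2 by rewrite /e; lra.
apply: (small_le e0 e1 (leqnSn a)).
have n2 : normc (2^-1 : R[i]) = 2^-1.
  by rewrite normcV -(rmorph_nat (real_complex R)) normc_real ger0_norm.
pose h x := 2^-1 * ((A x)^*)%C.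
have h1 x : normc (h x) <= 1 by rewrite normcM n2 normcJ ler_pdivrMl// mulr1.
apply: (H L k psi P h f e tc e0 e1 dP iP h1 f1) => [i|].
  by rewrite leqNgt ltn_ord.
have -> : lam P h f - avg h * \prod_i avg (f i) = ((2^-1 * D ^+ 2)%:C)%C.
  rewrite DE /lam -avgZr -avgB [RHS]rmorphM /= avgC -[RHS]avgZ; apply: eq_avg => x.
  rewrite avgZ -mulrBr -/(A x) /h sqr_normcE -mulrA (mulrC (A x)); congr (_ * _).
  by rewrite fmorphV rmorph_nat.
rewrite normc_real ger0_norm; last by rewrite mulr_ge0// ltW.
rewrite /e; lra.
Qed.

Lemma L2norm_le2 (R : realType) (T : finType) (f : T -> R[i]) :
  (forall x, normc (f x) <= 2) -> L2norm f <= 2.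
Proof.
move=> f2; rewrite /L2norm -[leRHS]ger0_norm// -sqrtr_sqr ler_wsqrtr//.
have [x0 _|T0] := pickP (fun _ : T => true); last by rewrite avg_empty ?sqr_ge0.
by apply: (avg_le_cst x0) => x; rewrite lerXn2r ?nnegrE ?normc_ge0.
Qed.

Theorem theorem1p11 (R : realType) (p : nat) (hp : prime p)
    (m : nat) (hm : (1 <= m)%N) (P : 'I_m -> {poly {poly 'F_p}})
    (hP : good_for_irrational_equidistribution R (fun i n => (P i).[n])) :
  exists gamma K : R, 0 < gamma /\ 0 < K /\
    forall (k : nat) (Q : {poly 'F_p}) (hQ : monic_irreducible_poly Q),
      size Q = k.+1 ->
    forall f : 'I_m -> {poly %/ Q with hQ} -> R[i],
      (forall i x, `|f i x| <= 1) ->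
      L2norm (fun x : {poly %/ Q with hQ} =>
          avg (fun y : {poly %/ Q with hQ} =>
                 \prod_i f i (x + poly_mod (P i) y))
          - \prod_i avg (f i))
        <= K * (p ^ k)%:R `^ (- gamma).
Proof.
have [N N0 HN] := good_torsion hP.
pose d := (\max_i size (P i))%N.
have [a Ha] := @L2norm_control R p d m.
pose A := (2 * a.+1)%N; pose B := (p ^ size N)%N.
have p0 := prime_gt0 hp.
have A1 : 1 <= A%:R :> R by rewrite ler1n.
have A0 : 0 < A%:R :> R by rewrite ltr0n.
have B1 : 1 <= B%:R :> R by rewrite ler1n expn_gt0 p0.
exists A%:R^-1, (3 * B%:R); split; first by rewrite invr_gt0.
split; first by rewrite mulr_gt0// ltr0n expn_gt0 p0.
move=> k Q hQ sQ f f1.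
have {}f1 i x : normc (f i x) <= 1 by exact/normc_le1.
pose L := {poly %/ Q with hQ}.
set D := L2norm _; set q := (p ^ k)%N.
have q1 : 1 <= q%:R :> R by rewrite ler1n expn_gt0 p0.
have q0 : 0 < q%:R :> R by exact: lt_le_trans q1.
have D2 : D <= 2.
  apply: L2norm_le2 => x; apply: le_trans (le_normcD _ _) _; rewrite normcN -[2]/(1 + 1) lerD//.
    by apply: normc_avg_le1 => y; exact: normc_prod_le1.
  by apply: normc_prod_le1 => i; exact: normc_avg_le1.
have D0 : 0 <= D by exact: sqrtr_ge0.
(* If [size Q <= size N] then [Q] may divide [N]; such fields are bounded in size. *)
have [small|large] := leqP (size Q) (size N).
  have qB : q%:R <= B%:R :> R.
    by rewrite ler_nat leq_pexp2l// -ltnS -sQ (leq_trans small).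
  have : (B%:R^-1 : R) <= (q%:R : R) `^ (- A%:R^-1).
    rewrite powRN lef_pV2 ?posrE ?powR_gt0//; last by exact: lt_le_trans B1.
    apply: le_trans qB; rewrite -[leRHS]powRr1 ?ler0n// ler_powR//.
    by rewrite invf_le1.
  have B0 : 0 < B%:R :> R by exact: lt_le_trans B1.
  rewrite -(ler_pM2l B0) divff ?lt0r_neq0// -mulrA => H.
  apply: le_trans D2 (le_trans (_ : 2 <= 3 * 1) _); first lra.
  by rewrite ler_pM2l.
have pL : p \in [pchar L] by apply: (rmorph_pchar (red hQ)); rewrite pchar_poly pchar_Fp.
have cL : #|L| = q by rewrite card_qfpoly card_Fp// sQ.
have [tau [psi [tauD tc pt]]] := @exists_trace_char R _ _ _ hp pL cL.
have iP := independent_mod tc tauD pt (red_neq0 hQ N0 large) HN.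
have dP i : poly_map d (@poly_mod _ Q hQ (P i)).
  by apply: poly_mod_poly_map; rewrite leqW//; exact: leq_bigmax.
have HD : #|L|%:R * (D ^+ 2 / 8) ^+ a.+1 <= 1 := Ha _ _ _ _ f tc dP iP f1.
rewrite cL in HD.
apply: le_trans (_ : 3 * (q%:R : R) `^ (- A%:R^-1) <= _); last first.
  by rewrite ler_wpM2r ?powR_ge0// ler_peMr.
rewrite -(@ler_pXn2r _ A) ?nnegrE ?mulr_ge0 ?powR_ge0//.
rewrite exprMn -(powR_mulrn _ (powR_ge0 _ _)) -powRrM mulNr mulVf ?gt_eqF// powR_inv1 ?ler0n//.
have {}HD : q%:R * (D ^+ 2) ^+ a.+1 <= 8 ^+ a.+1.
  by move: HD; rewrite expr_div_n mulrA ler_pdivrMr ?exprn_gt0// mul1r.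
rewrite ler_pdivlMr// mulrC /A !exprM; apply: le_trans HD _.
by rewrite lerXn2r ?nnegrE// -natrX ?ler_nat.
Qed.
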